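(* Let $n\ge 2$ be a dimension such that (i) every minimizer for the Markov–Dubins problem in $\mathbf{R}^n$ (that is, every shortest curve in some set $\mathcal{C}(p,q;v,w)$) is either a smooth curve with curvature $1$ and positive torsion, or a $C^1$-concatenation of finitely many circular arcs of curvature $1$ and a line segment, and (ii) every $CCC$-curve whose middle arc has length $<\pi$ is not a minimizer (i.e. is not a shortest curve in the set $\mathcal{C}(p,q;v,w)$ determined by its endpoint data). Then $NIR(K,\mathbf{R}^n)=\frac{1}{2}DCSD(K)$ for every relative minimum $K$ of the ropelength $\ell_e$, where $K$ is a union of finitely many disjoint $C^{1,1}$ simple closed curves in $\mathbf{R}^n$.
   Context: A knot/link $K$ is the image of a one-to-one $C^1$ map $\gamma:D\to\mathbf{R}^n$ with $\gamma'\neq 0$, where $D$ is a finite disjoint union of circles. $K$ is $C^{1,1}$ if $\gamma'$ is Lipschitz (for an arclength parametrization). Normal injectivity radius (thickness): $NIR(K,\mathbf{R}^n)=\sup(\{0\}\cup\{r>0: \text{the map } (p,v)\mapsto p+v \text{ restricted to } \{(p,v): p\in K,\ v\perp T_pK,\ \|v\|<r\} \text{ is one-to-one}\})$. Double critical self distance: a pair of distinct points $p,q\in K$ is a double critical pair if the segment $\overline{pq}$ is perpendicular to $K$ at both $p$ and $q$; $DCSD(K)=\inf\{\|p-q\|:\{p,q\}\text{ a double critical pair}\}$. Ropelength: $\ell_e(K)=\ell(K)/NIR(K,\mathbf{R}^n)$, where $\ell$ is total length. A relative minimum of $\ell_e$ is a $K=\gamma(D)$ having a neighborhood $\mathcal{U}$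 of $\gamma$ in the $C^1$ topology such that $\ell_e(\gamma)\le\ell_e(\eta)$ for all $\eta\in\mathcal{U}$ lying in the same knot/link class as $\gamma$ (the free $C^1$ ambient isotopy class of embeddings $D\to\mathbf{R}^n$ with fixed number of components). Markov–Dubins problem: for $p,q,v,w\in\mathbf{R}^n$ with $\|v\|=\|w\|=1$, $\mathcal{C}(p,q;v,w)$ is the set of $C^{1}$ curves from $p$ to $q$ with unit tangent $v$ at $p$ and $w$ at $q$ and (generalized) curvature $\le 1$; a minimizer is a shortest curve in such a set. Generalized curvature of $\gamma$ at $s$: $\kappa\gamma(s)=\limsup_{t\neq u,\ t,u\to s}\frac{\angle(\gamma'(t),\gamma'(u))}{\ell(\gamma([t,u]))}$. A $CCC$-curve is a $C^1$-concatenation of three arcs of circles of curvature $1$, each arc of positive length, with successive arcs having different centers. Torsion (for a $C^3$ arclength-parametrized curve in $\mathbf{R}^n$, $n\ge3$): $\mathbf{T}=\gamma'$, $\kappa=\|\mathbf{T}'\|$, and if $\kappa>0$, $\mathbf{N}=\mathbf{T}'/\kappa$, $\tau=\|\mathbf{N}'+\kappa\mathbf{T}\|\ge0$. *)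

(* Defs.v *)
From HB Require Import structures.
From mathcomp Require Import all_boot all_order all_algebra.
From mathcomp Require Import all_classical all_reals all_analysis.
Set Implicit Arguments. Unset Strict Implicit. Unset Printing Implicit Defensive.
Import Order.TTheory GRing.Theory Num.Theory.
Import numFieldNormedType.Exports.
Local Open Scope classical_set_scope.
Local Open Scope ring_scope.

Section Defs.
Variables (R : realType) (n : nat).
Notation V := 'rV[R]_n.

Definition dotv (u v : V) : R := (u *m v^T) 0 0.
Definition enorm (u : V) : R := Num.sqrt (dotv u u).
Definition angle (u v : V) : R := acos (dotv u v / (enorm u * enorm v)).

Definition C1curve (g : R -> V) : Prop :=
  (forall t, derivable g t 1) /\ continuous (derive1 g).

Definition is_link (m : nat) (g : 'I_m -> R -> V) : Prop :=
  (forall i t, g i (t + 1) = g i t) /\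
  (forall i, C1curve (g i)) /\
  (forall i t, derive1 (g i) t != 0) /\
  (forall i j s t, g i s = g j t -> i = j /\ exists k : int, s = t + k%:~R).

Definition image_link (m : nat) (g : 'I_m -> R -> V) : set V :=
  [set x | exists i t, x = g i t].

Definition C11 (m : nat) (g : 'I_m -> R -> V) : Prop :=
  exists (L : 'I_m -> R) (h : 'I_m -> R -> V) (C : R),
    (forall i, 0 < L i) /\
    (forall i t, h i (t + L i) = h i t) /\
    (forall i, C1curve (h i)) /\
    (forall i t, enorm (derive1 (h i) t) = 1) /\
    (forall i j s t, h i s = h j t -> i = j /\ exists k : int, s = t + k%:~R * L i) /\
    image_link h = image_link g /\
    (forall i s t, enorm (derive1 (h i) s - derive1 (h i) t) <= C * `|s - t|).

Definition link_length (m : nat) (g : 'I_m -> R -> V) : \bar R :=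
  (\sum_(i < m) \int[@lebesgue_measure R]_(t in `[0%R, 1%R]) (enorm (derive1 (g i) t))%:E)%E.

Definition normal_pair (m : nat) (g : 'I_m -> R -> V) (r : R) (p v : V) : Prop :=
  exists i t, p = g i t /\ dotv v (derive1 (g i) t) = 0 /\ enorm v < r.

Definition NIR (m : nat) (g : 'I_m -> R -> V) : \bar R :=
  ereal_sup ([set 0%E] `|`
    [set r%:E | r in [set r : R | 0 < r /\
       forall p v p' v', normal_pair g r p v -> normal_pair g r p' v' ->
         p + v = p' + v' -> p = p' /\ v = v']]).

Definition double_critical (m : nat) (g : 'I_m -> R -> V) (p q : V) : Prop :=
  p != q /\
  (exists i s, p = g i s /\ dotv (q - p) (derive1 (g i) s) = 0) /\
  (exists j t, q = g j t /\ dotv (q - p) (derive1 (g j) t) = 0).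

Definition DCSD (m : nat) (g : 'I_m -> R -> V) : \bar R :=
  ereal_inf [set x | exists p q, double_critical g p q /\ x = (enorm (p - q))%:E].

(* ropelength, with the convention l/0 = +oo *)
Definition ropelength (m : nat) (g : 'I_m -> R -> V) : \bar R :=
  match NIR g with
  | r%:E => if 0 < r then (link_length g * (r^-1)%:E)%E else +oo%E
  | _ => +oo%E
  end.

Definition C1map (f : V -> V) : Prop :=
  (forall x v, derivable f x v) /\ (forall v, continuous (fun x => 'D_v f x)).

Definition C1diffeo (f : V -> V) : Prop :=
  exists f' : V -> V, cancel f f' /\ cancel f' f /\ C1map f /\ C1map f'.

Definition same_link_class (m : nat) (g h : 'I_m -> R -> V) : Prop :=
  exists H : R -> V -> V,
    (forall t, C1diffeo (H t)) /\
    continuous (fun tx : R * V => H tx.1 tx.2) /\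
    (forall x, H 0 x = x) /\
    H 1 @` image_link g = image_link h.

Definition rel_min_ropelength (m : nat) (g : 'I_m -> R -> V) : Prop :=
  exists eps : R, 0 < eps /\
    forall h : 'I_m -> R -> V, is_link h -> same_link_class g h ->
      (forall i t, enorm (h i t - g i t) < eps /\
                   enorm (derive1 (h i) t - derive1 (g i) t) < eps) ->
      (ropelength g <= ropelength h)%E.

(* generalized curvature at s of an arclength-parametrized curve on [0,L];
   for unit speed, l(g([t,u])) = |u - t| *)
Definition gen_curvature (g : R -> V) (L s : R) : \bar R :=
  ereal_inf [set ereal_sup [set x | exists t u,
                 0 <= t <= L /\ 0 <= u <= L /\ t != u /\
                 `|t - s| < d /\ `|u - s| < d /\
                 x = (angle (derive1 g t) (derive1 g u) / `|u - t|)%:E]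
            | d in [set d : R | 0 < d]].

(* (L, g) : g restricted to [0, L] is an arclength-parametrized curve in
   C(p,q;v,w) (g is a C^1 extension to R) *)
Definition in_dubins (p q v w : V) (L : R) (g : R -> V) : Prop :=
  0 <= L /\ C1curve g /\
  (forall s, 0 <= s <= L -> enorm (derive1 g s) = 1) /\
  g 0 = p /\ g L = q /\ derive1 g 0 = v /\ derive1 g L = w /\
  (forall s, 0 <= s <= L -> (gen_curvature g L s <= 1%:E)%E).

Definition dubins_minimizer (p q v w : V) (L : R) (g : R -> V) : Prop :=
  in_dubins p q v w L g /\
  forall L' g', in_dubins p q v w L' g' -> L <= L'.

Definition smooth (f : R -> V) : Prop :=
  forall k t, derivable (derive1n k f) t 1.

Definition curv (f : R -> V) (s : R) : R := enorm (derive1 (derive1 f) s).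
Definition normalv (f : R -> V) (s : R) : V :=
  (curv f s)^-1 *: derive1 (derive1 f) s.
Definition torsion (f : R -> V) (s : R) : R :=
  enorm (derive1 (normalv f) s + curv f s *: derive1 f s).

Definition smooth_curv1_pos_torsion (g : R -> V) (L : R) : Prop :=
  exists f : R -> V, smooth f /\
    (forall s, 0 <= s <= L -> f s = g s) /\
    (forall s, 0 <= s <= L -> curv f s = 1 /\ 0 < torsion f s).

Definition unit_arc_on (g : R -> V) (a b : R) (c : V) : Prop :=
  exists e1 e2 : V, dotv e1 e1 = 1 /\ dotv e2 e2 = 1 /\ dotv e1 e2 = 0 /\
    forall s, a <= s <= b -> g s = c + cos s *: e1 + sin s *: e2.

Definition segment_on (g : R -> V) (a b : R) : Prop :=
  exists x u : V, enorm u = 1 /\ forall s, a <= s <= b -> g s = x + s *: u.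

Definition arcs_and_segment (g : R -> V) (L : R) : Prop :=
  exists (k : nat) (s : nat -> R) (isseg : nat -> bool),
    s 0%N = 0 /\ s k = L /\
    (forall j, (j < k)%N -> s j < s j.+1) /\
    (forall j, (j < k)%N ->
       if isseg j then segment_on g (s j) (s j.+1)
       else exists c, unit_arc_on g (s j) (s j.+1) c) /\
    (forall j1 j2, (j1 < k)%N -> (j2 < k)%N -> isseg j1 -> isseg j2 -> j1 = j2).

Definition CCC (g : R -> V) (L s1 s2 : R) : Prop :=
  0 < s1 /\ s1 < s2 /\ s2 < L /\
  exists c1 c2 c3 : V,
    unit_arc_on g 0 s1 c1 /\ unit_arc_on g s1 s2 c2 /\ unit_arc_on g s2 L c3 /\
    c1 != c2 /\ c2 != c3.

End Defs.

(* Main.v *)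
Require Import Defs.
From HB Require Import structures.
From mathcomp Require Import all_boot all_order all_algebra.
From mathcomp Require Import all_classical all_reals all_analysis.
From mathcomp Require Import ring lra zify.
Set Implicit Arguments. Unset Strict Implicit. Unset Printing Implicit Defensive.
Import Order.TTheory GRing.Theory Num.Theory.
Import numFieldNormedType.Exports.
Local Open Scope classical_set_scope.
Local Open Scope ring_scope.

(* Let [r] be the thickness and suppose that no double critical pair has length [2r] or
   less.  Rescale to [r = 1].  Empty balls of radius [1] make the unit tangent [T]
   1-Lipschitz, and pairs of points that are far apart along the link stay at distance at
   least [2 + e].  Hence a small [C^1] perturbation that keeps the curvature at most [1] keeps
   the thickness, and by minimality it cannot shorten the link ([length_critical]).  In
   particular short pieces solve the Markov-Dubins problem, and hypothesis (i) applies to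
   them.  Two cases are excluded by explicit variations that shorten the curve.
   - If the curve is everywhere smooth with curvature [1] and torsion at least [t0 > 0], move
     it by [e (N + k c)] with [k = 1 - t0^2 / 2]; the velocity [T + e Z] keeps the curvature at
     most [1] as soon as [<N, Z'> < 2 <T, Z>].
   - Otherwise there is a maximal arc of a unit circle.  It is shorter than [pi], because a half
     circle would end in a double critical pair of length [2].  It is varied by
     [- t x T - N + m' / cos al], where [al] is half its length, [t = tan al / al] and [m'] the
     normal at its midpoint; the change of normal at both ends leaves room to damp the variation
     in thin layers. *)

(** * Euclidean geometry in coordinates *)

(** A velocity [Y = T + e Z] keeps the curvature at most [1] in its own arclength when
    [|Y'| <= |Y|^2]. To first order in [e] this reads [<N, Z'> <= 2 <T, Z>] where the curvature is
    [1] and is no condition where the curve is straight; the length decreases at rate [- <T, Z>]. On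
    a unit circle [N' = - T], so integrating the condition over an arc by parts bounds the integral
    of [<T, Z>] from below by the increment of [<N, Z>]. Hence a field whose velocity vanishes at
    both ends of an arc cannot shorten it: velocity is needed at the ends, and it must be brought to
    rest outside the arc, in layers so thin that their cost in length is negligible. Across such a
    layer [Z] changes fast, and the condition becomes a sign condition on its jump along the normal.
    At the start of the arc the jump from [0] to [z] must go against the normal of the preceding
    piece, if that is curved, and [z] must point along the normal of the arc; both are possible
    because the arc is maximal, so that the two normals differ. With positive torsion [N'] is not
    [- T], which leaves room for a field on the whole curve. *)

Section Dot.
Variables (R : realType) (n : nat).
Notation V := 'rV[R]_n.
Implicit Types (u v w : V) (a b : R).

Lemma dotvE u v : dotv u v = \sum_i u 0 i * v 0 i.
Proof. by rewrite /dotv mxE; apply: eq_bigr => i _; rewrite mxE. Qed.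

Lemma dotvC u v : dotv u v = dotv v u.
Proof. by rewrite !dotvE; apply: eq_bigr => i _; rewrite mulrC. Qed.

Lemma dotvDl u v w : dotv (u + v) w = dotv u w + dotv v w.
Proof. by rewrite /dotv mulmxDl mxE. Qed.

Lemma dotvDr u v w : dotv u (v + w) = dotv u v + dotv u w.
Proof. by rewrite dotvC dotvDl !(dotvC u). Qed.

Lemma dotvZl a u v : dotv (a *: u) v = a * dotv u v.
Proof. by rewrite /dotv -scalemxAl mxE. Qed.

Lemma dotvZr a u v : dotv u (a *: v) = a * dotv u v.
Proof. by rewrite dotvC dotvZl dotvC. Qed.

Lemma dotvNl u v : dotv (- u) v = - dotv u v.
Proof. by rewrite -scaleN1r dotvZl mulN1r. Qed.

Lemma dotvNr u v : dotv u (- v) = - dotv u v.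
Proof. by rewrite dotvC dotvNl dotvC. Qed.

Lemma dotvBl u v w : dotv (u - v) w = dotv u w - dotv v w.
Proof. by rewrite dotvDl dotvNl. Qed.

Lemma dotvBr u v w : dotv u (v - w) = dotv u v - dotv u w.
Proof. by rewrite dotvDr dotvNr. Qed.

Lemma dotv0l u : dotv 0 u = 0.
Proof. by rewrite -(scale0r u) dotvZl mul0r. Qed.

Lemma dotv0r u : dotv u 0 = 0.
Proof. by rewrite dotvC dotv0l. Qed.

Definition dotvS := (dotvDl, dotvDr, dotvBl, dotvBr, dotvNl, dotvNr, dotvZl, dotvZr, dotv0l, dotv0r).

Lemma dotvv_ge0 u : 0 <= dotv u u.
Proof. by rewrite dotvE sumr_ge0// => i _; rewrite -expr2 sqr_ge0. Qed.

Lemma dotvv_eq0 u : (dotv u u == 0) = (u == 0).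
Proof.
apply/idP/eqP => [|->]; last by rewrite dotv0l.
rewrite dotvE psumr_eq0; last by move=> i _; rewrite -expr2 sqr_ge0.
move=> /allP h; apply/rowP => i; rewrite mxE.
by have := h i; rewrite mem_index_enum => /(_ isT); rewrite -expr2 sqrf_eq0 => /eqP.
Qed.

Lemma enorm_ge0 u : 0 <= enorm u.
Proof. exact: sqrtr_ge0. Qed.

Lemma enorm_sq u : enorm u ^+ 2 = dotv u u.
Proof. by rewrite /enorm sqr_sqrtr// dotvv_ge0. Qed.

Lemma enorm0 : enorm (0 : V) = 0.
Proof. by rewrite /enorm dotv0l sqrtr0. Qed.

Lemma enorm_eq0 u : (enorm u == 0) = (u == 0).
Proof. by rewrite -dotvv_eq0 -enorm_sq sqrf_eq0. Qed.

Lemma enorm_gt0 u : (0 < enorm u) = (u != 0).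
Proof. by rewrite lt_def enorm_ge0 andbT enorm_eq0. Qed.

Lemma enormZ a u : enorm (a *: u) = `|a| * enorm u.
Proof. by rewrite /enorm !dotvS mulrA -expr2 sqrtrM ?sqr_ge0// sqrtr_sqr. Qed.

Lemma enormN u : enorm (- u) = enorm u.
Proof. by rewrite -scaleN1r enormZ normrN1 mul1r. Qed.

Lemma enormBC u v : enorm (u - v) = enorm (v - u).
Proof. by rewrite -enormN opprB. Qed.

Lemma enorm1P u : enorm u = 1 <-> dotv u u = 1.
Proof.
by split=> h; [rewrite -enorm_sq h expr1n|rewrite /enorm h sqrtr1].
Qed.

Lemma dotv_le u v : dotv u v <= enorm u * enorm v.
Proof.
have [->|u0] := eqVneq u 0; first by rewrite dotv0l enorm0 mul0r.
have [->|v0] := eqVneq v 0; first by rewrite dotv0r enorm0 mulr0.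
have a0 : 0 < enorm u by rewrite enorm_gt0.
have b0 : 0 < enorm v by rewrite enorm_gt0.
have := dotvv_ge0 ((enorm u)^-1 *: u - (enorm v)^-1 *: v).
rewrite !dotvS (dotvC v u) -!enorm_sq => h.
have {}h : 0 <= 2 - 2 * ((enorm u)^-1 * (enorm v)^-1 * dotv u v).
  apply: le_trans h _; rewrite le_eqVlt; apply/orP; left; apply/eqP.
  by field; rewrite !gt_eqF.
rewrite -[leRHS]mul1r -ler_pdivrMr ?mulr_gt0// invfM mulrC.
lra.
Qed.

Lemma dotv_norm_le u v : `|dotv u v| <= enorm u * enorm v.
Proof.
by rewrite ler_norml dotv_le andbT lerNl -dotvNl -(enormN u) dotv_le.
Qed.

Lemma enormD u v : enorm (u + v) <= enorm u + enorm v.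
Proof.
rewrite -(@ler_pXn2r _ 2)// ?nnegrE ?addr_ge0 ?enorm_ge0//.
rewrite enorm_sq !dotvS (dotvC v u) -!enorm_sq.
have := dotv_le u v; nra.
Qed.

Lemma enormB u v : enorm (u - v) <= enorm u + enorm v.
Proof. by rewrite (le_trans (enormD _ _))// enormN. Qed.

Lemma enorm_dist u v w : enorm (u - w) <= enorm (u - v) + enorm (v - w).
Proof. by rewrite -(subrKA v) enormD. Qed.

Lemma enorm_lerB u v : enorm u - enorm v <= enorm (u - v).
Proof. by rewrite lerBlDr -{1}(subrK v u) enormD. Qed.

Lemma normr_coord_le u i : `|u 0 i| <= `|u|.
Proof.
rewrite [leRHS]/Num.Def.normr/= mx_normrE.
exact: (le_bigmax _ (fun ij : 'I_1 * 'I_n => `|u ij.1 ij.2|) (0, i)).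
Qed.

(** The topology on rows comes from the sup norm; this bound and the next carry estimates between it
    and [enorm], with the crude factor [n] in place of its square root. *)
Lemma normr_le_enorm u : `|u| <= enorm u.
Proof.
rewrite [leLHS]/Num.Def.normr/= mx_normrE; apply: bigmax_le; first exact: enorm_ge0.
move=> -[j i] _ /=; rewrite (ord1 j) -(@ler_pXn2r _ 2)// ?nnegrE ?enorm_ge0//.
rewrite enorm_sq dotvE real_normK ?num_real// (bigD1 i)//= -expr2 lerDl sumr_ge0// => k _.
by rewrite -expr2 sqr_ge0.
Qed.

Lemma enorm_le_normr u : enorm u <= n%:R * `|u|.
Proof.
rewrite -(@ler_pXn2r _ 2)// ?nnegrE ?enorm_ge0// ?mulr_ge0// enorm_sq dotvE.
apply: (@le_trans _ _ (\sum_(i < n) `|u| ^+ 2)).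
  apply: ler_sum => i _; rewrite -expr2 -real_normK ?num_real//.
  by rewrite ler_pXn2r ?nnegrE// normr_coord_le.
rewrite sumr_const card_ord exprMn -[leLHS]mulr_natl.
rewrite ler_wpM2r ?sqr_ge0// -natrX ler_nat.
by case: (n) => // k; rewrite leq_pmulr.
Qed.

(* Cauchy-Schwarz for the components of u and w orthogonal to v *)
Lemma dotv_cos_add u v w a b :
  enorm u = 1 -> enorm v = 1 -> enorm w = 1 -> 0 <= a -> 0 <= b -> a + b <= pi ->
  cos a <= dotv u v -> cos b <= dotv v w -> cos (a + b) <= dotv u w.
Proof.
move=> u1 v1 w1 a0 b0 abpi ua vb.
have itv (x y : V) : enorm x = 1 -> enorm y = 1 -> -1 <= dotv x y <= 1.
  by move=> x1 y1; have := dotv_norm_le x y; rewrite x1 y1 mulr1 ler_norml.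
have iuv := itv _ _ u1 v1; have ivw := itv _ _ v1 w1.
have cs : acos (dotv u v) <= a.
  rewrite leNgt; apply/negP => lt.
  have : cos (acos (dotv u v)) < cos a.
    rewrite ltr_cos ?in_itv//= ?acos_ge0 ?acos_lepi//.
    by rewrite a0 (le_trans _ abpi)// lerDl.
  by rewrite acosK ?in_itv//= ltNge ua.
have cs' : acos (dotv v w) <= b.
  rewrite leNgt; apply/negP => lt.
  have : cos (acos (dotv v w)) < cos b.
    rewrite ltr_cos ?in_itv//= ?acos_ge0 ?acos_lepi//.
    by rewrite b0 (le_trans _ abpi)// lerDr.
  by rewrite acosK ?in_itv//= ltNge vb.
(* As [cos] decreases on [[0, pi]], it is enough to treat the exact angles, for which the addition
   formula meets Cauchy-Schwarz. *)
have le1 : cos (a + b) <= cos (acos (dotv u v) + acos (dotv v w)).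
  rewrite leNgt ltr_cos ?in_itv/=.
  - by rewrite -leNgt lerD.
  - by rewrite addr_ge0 ?acos_ge0//= (le_trans _ abpi)// lerD.
  - by rewrite addr_ge0 ?acos_ge0//= (le_trans _ abpi)// lerD.
apply: le_trans le1 _.
rewrite cosD !acosK ?in_itv//= !sin_acos//.
have := dotv_norm_le (u - dotv u v *: v) (w - dotv v w *: v).
have e (x y : V) : enorm x = 1 -> enorm y = 1 ->
    enorm (x - dotv x y *: y) = Num.sqrt (1 - dotv x y ^+ 2).
  move=> /enorm1P x1 /enorm1P y1; rewrite /enorm !dotvS (dotvC y x) x1 y1; congr Num.sqrt; ring.
rewrite e// (dotvC v w) e// !dotvS.
rewrite (dotvC v w) -enorm_sq v1 ler_norml => /andP[h _]; move: h.
set p := Num.sqrt _; set q := Num.sqrt _.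
lra.
Qed.

End Dot.

(** * Derivatives of curves *)

Section Calculus.
Variables (R : realType).

Section Vector.
Variable n : nat.
Notation V := 'rV[R]_n.

Lemma is_derive_rowP (f : R -> V) (t : R) (d : V) :
  is_derive t 1 f d <-> forall i, is_derive t 1 (fun x => f x 0 i) (d 0 i).
Proof.
split=> [[df fd] i|h].
  have dfi : derivable (fun x => f x 0 i) t 1 by move/derivable_mxP : df.
  by split=> //; rewrite -fd derive_mx// mxE.
have df : derivable f t 1 by apply/derivable_mxP => j i; rewrite (ord1 j).
split=> //; rewrite derive_mx//; apply/rowP => i; rewrite mxE.
by have [_ ->] := h i.
Qed.

Lemma is_derive_continuous (f : R -> V) (t : R) (d : V) :
  is_derive t 1 f d -> continuous_at t f.
Proof. by move=> [/derivable1_diffP /differentiable_continuous]. Qed.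

(** The library rules concern sums of functions [f + g]; these restatements have the eta-expanded
    shape that the goals below take. *)
Lemma is_derive_add (f g : R -> V) (t : R) df dg :
  is_derive t 1 f df -> is_derive t 1 g dg ->
  is_derive t 1 (fun x => f x + g x) (df + dg).
Proof. exact: is_deriveD. Qed.

Lemma is_derive_sub (f g : R -> V) (t : R) df dg :
  is_derive t 1 f df -> is_derive t 1 g dg ->
  is_derive t 1 (fun x => f x - g x) (df - dg).
Proof. exact: is_deriveB. Qed.

Lemma is_derive_opp (f : R -> V) (t : R) df :
  is_derive t 1 f df -> is_derive t 1 (fun x => - f x) (- df).
Proof. exact: is_deriveN. Qed.

Lemma is_derive_const (c : V) (t : R) : is_derive t 1 (fun=> c) 0.
Proof. exact: is_derive_cst. Qed.

Lemma is_derive_scale (a : R -> R) (f : R -> V) (t : R) da df :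
  is_derive t 1 a da -> is_derive t 1 f df ->
  is_derive t 1 (fun x => a x *: f x) (da *: f t + a t *: df).
Proof.
move=> ha /is_derive_rowP hf; apply/is_derive_rowP => i.
rewrite (_ : (fun x => _) = a * (fun x => f x 0 i)); last by apply/funext => x; rewrite mxE.
apply: (is_derive_eq (is_deriveM ha (hf i))).
by rewrite !mxE addrC [_ *: da]mulrC.
Qed.

Lemma is_derive_scalel (k : R) (f : R -> V) (t : R) df :
  is_derive t 1 f df -> is_derive t 1 (fun x => k *: f x) (k *: df).
Proof. exact: is_deriveZ. Qed.

Lemma is_derive_comp (f : R -> V) (s : R -> R) (t : R) ds df :
  is_derive t 1 s ds -> is_derive (s t) 1 f df ->
  is_derive t 1 (fun x => f (s x)) (ds *: df).
Proof.
move=> hs /is_derive_rowP hf; apply/is_derive_rowP => i; rewrite mxE mulrC.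
exact: (@is_derive1_comp _ (fun x => f x 0 i)).
Qed.

Lemma is_derive_dotv (f g : R -> V) (t : R) df dg :
  is_derive t 1 f df -> is_derive t 1 g dg ->
  is_derive t 1 (fun x => dotv (f x) (g x)) (dotv df (g t) + dotv (f t) dg).
Proof.
move=> /is_derive_rowP hf /is_derive_rowP hg.
have := is_derive_sum (fun i => is_deriveM (hf i) (hg i)).
rewrite (_ : \sum_i _ = fun x => dotv (f x) (g x)); last first.
  by apply/funext => x; rewrite dotvE fct_sumE.
move=> h; apply: is_derive_eq h _; rewrite !dotvE big_split/= addrC; congr (_ + _).
by apply: eq_bigr => i _; rewrite mulrC.
Qed.

Lemma is_derive_dotvc (f : R -> V) (t : R) df (c : V) :
  is_derive t 1 f df -> is_derive t 1 (fun x => dotv (f x) c) (dotv df c).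
Proof.
move=> hf; have := is_derive_dotv hf (is_derive_const c t).
by rewrite dotv0r addr0.
Qed.

Lemma is_derive_enorm (f : R -> V) (t : R) df : is_derive t 1 f df -> f t != 0 ->
  is_derive t 1 (fun x => enorm (f x)) (dotv (f t) df / enorm (f t)).
Proof.
move=> hf ft0; have := is_derive_dotv hf hf; rewrite (dotvC df) => h.
have p : 0 < dotv (f t) (f t) by rewrite lt_def dotvv_ge0 dotvv_eq0 ft0.
have hs := @is_derive1_sqrt _ _ p.
have := @is_derive1_comp _ (@Num.sqrt R) (fun x => dotv (f x) (f x)) t _ _ hs h.
move=> hc; apply: is_derive_eq hc _; rewrite -/(enorm _).
have e0 : enorm (f t) != 0 by rewrite enorm_eq0.
field; exact: e0.
Qed.

Lemma continuous_rowP (T : topologicalType) (f : T -> V) (x : T) :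
  continuous_at x f <-> forall i, continuous_at x (fun y => f y 0 i).
Proof.
split=> [h i|h].
  by apply: (@continuous_comp _ _ _ f (fun M : V => M 0 i)) => //; exact: coord_continuous.
apply/cvgrPdist_le => /= e e0; near=> y.
rewrite [leLHS]/Num.Def.normr/= mx_normrE (bigmax_le _ (ltW e0))//= => -[j i] _ /=.
rewrite (ord1 j) !mxE; move: i; near: y; apply: filter_forall => i.
by have /cvgrPdist_le/(_ _ e0) := h i.
Unshelve. all: by end_near. Qed.

Lemma continuous_dotv (T : topologicalType) (f g : T -> V) (x : T) :
  continuous_at x f -> continuous_at x g ->
  continuous_at x (fun y => dotv (f y) (g y)).
Proof.
move=> /continuous_rowP hf /continuous_rowP hg.
rewrite (_ : (fun y => _) = fun y => \sum_i f y 0 i * g y 0 i); last first.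
  by apply/funext => y; rewrite dotvE.
elim: (index_enum _) => [|i r IH].
  by rewrite /continuous_at; under eq_fun do rewrite big_nil; rewrite big_nil; exact: cvg_cst.
rewrite /continuous_at; under eq_fun do rewrite big_cons.
by rewrite big_cons; exact: cvgD (cvgM (hf i) (hg i)) IH.
Qed.

Lemma continuous_enorm (T : topologicalType) (f : T -> V) (x : T) :
  continuous_at x f -> continuous_at x (fun y => enorm (f y)).
Proof.
move=> hf; apply: (@continuous_comp _ _ _ (fun y => dotv (f y) (f y)) Num.sqrt).
  exact: continuous_dotv.
exact: sqrt_continuous.
Qed.

Lemma C1curve_is_derive (f : R -> V) (t : R) : C1curve f -> is_derive t 1 f (derive1 f t).
Proof. by move=> [h _]; rewrite derive1E; exact/derivableP/h. Qed.

Lemma is_derive_derive1 (f f' : R -> V) : (forall t : R, is_derive t 1 f (f' t)) ->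
  derive1 f = f'.
Proof. by move=> h; apply/funext => t; rewrite derive1E; have [_ ->] := h t. Qed.

Lemma C1curveI (f f' : R -> V) : (forall t : R, is_derive t 1 f (f' t)) ->
  continuous f' -> C1curve f.
Proof.
move=> h c; split; last by rewrite (is_derive_derive1 h).
by move=> t; have [] := h t.
Qed.

End Vector.

Lemma is_derive_rcontinuous (f : R -> R) (t : R) (d : R) :
  is_derive t 1 f d -> continuous_at t f.
Proof. by move=> [/derivable1_diffP /differentiable_continuous]. Qed.

Lemma is_derive_radd (f g : R -> R) (t : R) df dg :
  is_derive t 1 f df -> is_derive t 1 g dg ->
  is_derive t 1 (fun x => f x + g x) (df + dg).
Proof. exact: is_deriveD. Qed.

Lemma is_derive_rsub (f g : R -> R) (t : R) df dg :
  is_derive t 1 f df -> is_derive t 1 g dg ->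
  is_derive t 1 (fun x => f x - g x) (df - dg).
Proof. exact: is_deriveB. Qed.

Lemma is_derive_ropp (f : R -> R) (t : R) df :
  is_derive t 1 f df -> is_derive t 1 (fun x => - f x) (- df).
Proof. exact: is_deriveN. Qed.

Lemma is_derive_rconst (c : R) (t : R) : is_derive t 1 (fun=> c) (0 : R).
Proof. exact: is_derive_cst. Qed.

Lemma is_derive_rmul (f g : R -> R) (t : R) df dg :
  is_derive t 1 f df -> is_derive t 1 g dg ->
  is_derive t 1 (fun x => f x * g x) (df * g t + f t * dg).
Proof.
move=> hf hg; apply: (is_derive_eq (is_deriveM hf hg)).
by rewrite addrC [_ *: _]mulrC.
Qed.

Lemma is_derive_rcomp (f s : R -> R) (t : R) ds df :
  is_derive t 1 s ds -> is_derive (s t) 1 f df ->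
  is_derive t 1 (fun x => f (s x)) (df * ds).
Proof. by move=> hs hf; exact: is_derive1_comp. Qed.

Lemma is_derive_rid (t : R) : is_derive t 1 (fun x : R => x) (1 : R).
Proof. exact: is_derive_id. Qed.

Lemma derivative_mvt (f f' : R -> R) (a b : R) : a < b ->
  (forall x, a <= x <= b -> continuous_at x f) ->
  (forall x, a < x < b -> is_derive x 1 f (f' x)) ->
  exists2 c, a < c < b & f b - f a = f' c * (b - a).
Proof.
move=> ab cf df.
have df' x : x \in `]a, b[%R -> is_derive x 1 f (f' x) by rewrite in_itv; exact: df.
have cf' : {within `[a, b], continuous f}.
  by apply: continuous_in_subspaceT => x; rewrite inE/= in_itv/= => /cf.
have [c cab ->] := MVT ab df' cf'.
by exists c => //; move: cab; rewrite in_itv.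
Qed.

Lemma derivative_ge0_le (f f' : R -> R) (a b : R) : a <= b ->
  (forall x, a <= x <= b -> continuous_at x f) ->
  (forall x, a < x < b -> is_derive x 1 f (f' x)) ->
  (forall x, a < x < b -> 0 <= f' x) -> f a <= f b.
Proof.
rewrite le_eqVlt => /predU1P[->//|ab] cf df f0.
have [c cab e] := derivative_mvt ab cf df.
by rewrite -subr_ge0 e mulr_ge0 ?f0// subr_ge0 ltW.
Qed.

Lemma derivative_gt0_lt (f f' : R -> R) (a b : R) : a < b ->
  (forall x, a <= x <= b -> continuous_at x f) ->
  (forall x, a < x < b -> is_derive x 1 f (f' x)) ->
  (forall x, a < x < b -> 0 < f' x) -> f a < f b.
Proof.
move=> ab cf df f0.
have [c cab e] := derivative_mvt ab cf df.
by rewrite -subr_gt0 e mulr_gt0 ?f0// subr_gt0.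
Qed.

End Calculus.

(** * Differentiability by inequalities, antiderivatives, inverses and gluing *)

Section Calculus2.
Variables (R : realType).

(** An inequality that also holds at [x = t] replaces the limit over a punctured neighbourhood; in
    this form derivatives can be localized, glued and compared with chords. *)
Lemma is_derive_epsP (W : normedModType R) (f : R -> W) (t : R) (d : W) :
  is_derive t 1 f d <-> forall e : R, 0 < e -> exists2 r : R, 0 < r &
    forall x, `|x - t| < r -> `|f x - f t - (x - t) *: d| <= e * `|x - t|.
Proof.
split=> [[df fd] e e0|h].
  have : (fun h => h^-1 *: ((f \o shift t) (h *: 1) - f t)) @ 0^' --> d.
    by rewrite -fd; exact: df.
  move/cvgrPdist_le => /(_ _ e0) [r /= r0 hr]; exists r => // x xt.
  have [->|xt0] := eqVneq x t; first by rewrite !subrr scale0r subr0 !normr0 mulr0.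
  have xt0' : x - t != 0 by rewrite subr_eq0.
  have := hr (x - t); rewrite /= sub0r normrN => /(_ xt xt0').
  rewrite [_ *: 1]mulr1 subrK => q.
  rewrite -ler_pdivrMr ?normr_gt0// -normfV mulrC -normrZ scalerBr scalerA mulVf// scale1r.
  by rewrite distrC.
have c : (fun h => h^-1 *: ((f \o shift t) (h *: 1) - f t)) @ 0^' --> d.
  apply/cvgrPdist_le => e e0; have [r r0 hr] := h _ e0; exists r => //= x.
  rewrite /= sub0r normrN => xr x0; rewrite [_ *: 1]mulr1.
  have := hr (x + t); rewrite addrK => /(_ xr).
  rewrite -ler_pdivrMr ?normr_gt0// -normfV mulrC -normrZ scalerBr scalerA mulVf// scale1r.
  by rewrite distrC.
by split; [apply/cvg_ex; exists d|exact: cvg_lim c].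
Qed.

Lemma is_derive_local (W : normedModType R) (f g : R -> W) (t r : R) (d : W) : 0 < r ->
  (forall x, `|x - t| < r -> f x = g x) -> is_derive t 1 f d -> is_derive t 1 g d.
Proof.
move=> r0 fg /is_derive_epsP h; apply/is_derive_epsP => e e0.
have [r' r'0 hr'] := h _ e0; exists (Num.min r r'); first by rewrite lt_min r0.
move=> x; rewrite lt_min => /andP[xr xr'].
rewrite -!fg//; last by rewrite subrr normr0.
exact: hr'.
Qed.

Lemma is_derive_unique (W : normedModType R) (f : R -> W) (t : R) (d d' : W) :
  is_derive t 1 f d -> is_derive t 1 f d' -> d = d'.
Proof. by move=> [_ <-] [_ <-]. Qed.

(** Take the supremum [c] of the points where [P] holds: the step across [c] carries [P] beyond [c]
    unless [c = b]. The step jumps from a point left of [c] to one right of it, since [P] is not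
    known at [c] itself. *)
Lemma real_induction (P : R -> Prop) (a b : R) : a <= b -> P a ->
  (forall c, a <= c <= b -> exists2 r, 0 < r & forall t u, a <= t -> t <= c -> c - r < t ->
     c <= u -> u <= b -> u < c + r -> P t -> P u) -> P b.
Proof.
move=> ab Pa step.
pose A := [set t | a <= t <= b /\ P t].
have hA : has_sup A.
  split; first by exists a; split=> //; rewrite lexx.
  by exists b => t [/andP[]].
have Aa : A a by split=> //; rewrite lexx.
have ac : a <= sup A by apply: ub_le_sup => //; case: hA.
have cb : sup A <= b by apply: ge_sup; [exists a|move=> t [/andP[]]].
have [|r r0 hr] := step (sup A); first by rewrite ac.
have [t [tab Pt] tc] := sup_adherent r0 hA.
move/andP: tab => [at_ tb].
have tc' : t <= sup A by apply: ub_le_sup; [case: hA|split=> //; rewrite at_].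
pose u := Num.min b (sup A + r / 2).
have cu : sup A <= u by rewrite le_min cb/= lerDl divr_ge0// ltW.
have ub : u <= b by rewrite ge_min lexx.
have ur : u < sup A + r.
  by rewrite gt_min ltrD2l ltr_pdivrMr// ltr_pMr// ltr1n orbT.
have Pu := hr t u at_ tc' tc cu ub ur Pt.
have : u <= sup A.
  by apply: ub_le_sup; [case: hA|split=> //; rewrite (le_trans ac)].
rewrite ge_min => /orP[bc|]; last by rewrite gerDl leNgt divr_gt0.
by have <- : u = b by apply/eqP; rewrite eq_le ub/= (le_trans bc).
Qed.

Lemma derivative0_const (f : R -> R) (a b : R) : a <= b ->
  (forall x, a <= x <= b -> is_derive x 1 f (0 : R)) -> f a = f b.
Proof.
rewrite le_eqVlt => /predU1P[->//|ab] h.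
have [||c _] := @derivative_mvt _ f (fun=> 0) a b ab.
- by move=> x /h /is_derive_rcontinuous.
- by move=> x /andP[ax xb]; apply: h; rewrite !ltW.
by rewrite mul0r => /eqP; rewrite subr_eq0 => /eqP.
Qed.

Lemma antiderivative (f : R -> R) : continuous f ->
  exists2 F : R -> R, F 0 = 0 & forall t : R, is_derive t 1 F (f t).
Proof.
move=> cf.
pose I a x := (\int[lebesgue_measure]_(t in [set` `[a, x]]) (f t))%R : R.
have dI a (x : R) : a < x -> is_derive x 1 (I a) (f x).
  move=> ax; have xu : x < x + 1 by rewrite ltrDl.
  have ifi : lebesgue_measure.-integrable `[a, x + 1] (EFin \o f).
    apply: continuous_compact_integrable; first exact: segment_compact.
    exact: continuous_subspaceT.
  have [d e] := continuous_FTC1_closed xu ifi ax (cf x).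
  by rewrite -e derive1E; exact/derivableP.
(* The integral from [a] is differentiable only to the right of [a], so the base point lies left of
   both [x] and [0]; by [FE] every such base point gives the same value. *)
pose a (x : R) : R := - (`|x| + 1).
pose F x := I (a x) x - I (a x) 0.
have FE (b x : R) : b < 0 -> b < x -> F x = I b x - I b 0.
  move=> b0 bx; rewrite /F.
  suff h (c d : R) : c <= d -> d < 0 -> d < x -> I c x - I c 0 = I d x - I d 0.
    have ax0 : a x < 0 by rewrite /a oppr_lt0 ltr_wpDl.
    have axx : a x < x by have := ler_norm (- x); rewrite normrN /a; lra.
    have [le|/ltW le] := leP (a x) b; first exact: h.
    by apply/esym/h.
  move=> cd d0 dx.
  have k (y z : R) : d < y -> y <= z -> I c y - I d y = I c z - I d z.
    move=> dy yz; apply: (@derivative0_const (fun z => I c z - I d z)) => // w /andP[yw _].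
    have dw : d < w by exact: lt_le_trans yw.
    rewrite -(subrr (f w)); apply: is_derive_rsub; apply: dI => //.
    exact: le_lt_trans dw.
  have [x0|/ltW x0] := leP x 0.
    by have := k x 0 dx x0; lra.
  by have := k 0 x d0 x0; lra.
exists F; first by rewrite /F subrr.
move=> t; pose b := - (`|t| + 2).
have b0 : b < 0 by rewrite /b oppr_lt0 ltr_wpDl.
have bt : b < t by have := ler_norm (- t); rewrite normrN /b; lra.
apply: (@is_derive_local _ (fun x => I b x - I b 0) _ _ 1) => //.
  move=> x; rewrite ltr_distl => /andP[xt _]; rewrite (FE b)//.
  by apply: lt_trans xt; have := ler_norm (- t); rewrite normrN /b; lra.
rewrite -(subr0 (f t)); apply: is_derive_rsub; exact: dI.
Qed.

Lemma integral_derivative (F f : R -> R) (a b : R) : a < b ->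
  (forall t : R, is_derive t 1 F (f t)) -> continuous f ->
  (\int[@lebesgue_measure R]_(t in `[a, b]) (f t)%:E = (F b - F a)%:E)%E.
Proof.
move=> ab dF cf; rewrite (@continuous_FTC2 _ f F)// ?EFinB//.
- exact: continuous_subspaceT.
- split.
  + by move=> x _; have [] := dF x.
  + exact/cvg_at_right_filter/(is_derive_rcontinuous (dF a)).
  + exact/cvg_at_left_filter/(is_derive_rcontinuous (dF b)).
- by move=> x _; rewrite derive1E; have [_ ->] := dF x.
Qed.

Lemma increasing_inverse (s s' : R -> R) (c : R) : 0 < c ->
  (forall t : R, is_derive t 1 s (s' t)) -> (forall t, c <= s' t) ->
  exists q : R -> R, [/\ cancel s q, cancel q s &
    forall y : R, is_derive y 1 q (s' (q y))^-1].
Proof.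
move=> c0 ds sc.
have cs t : continuous_at t s by exact: is_derive_rcontinuous (ds t).
have grow a b : a <= b -> c * (b - a) <= s b - s a.
  move=> ab.
  have := @derivative_ge0_le _ (fun x => s x - c * x) (fun x => s' x - c) a b ab.
  move=> h; suff : s a - c * a <= s b - c * b by lra.
  have d (x : R) : is_derive x 1 (fun x => s x - c * x) (s' x - c).
    apply: is_derive_rsub => //.
    have := is_derive_rmul (is_derive_rconst c x) (is_derive_rid x).
    by rewrite mul0r add0r mulr1.
  apply: h => x _ //; last by rewrite subr_ge0.
  exact: is_derive_rcontinuous (d x).
have inc a b : a < b -> s a < s b.
  move=> ab; rewrite -subr_gt0; apply: lt_le_trans (grow _ _ (ltW ab)).
  by rewrite mulr_gt0// subr_gt0.
have sinj : injective s.
  by move=> a b; case: (ltgtP a b) => // /inc; [move=> + e|move=> + e]; rewrite e ltxx.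
have surj y : exists t, s t = y.
  (* Growing at rate at least [c], [s] covers the distance from [s 0] to [y] within [[- M, M]]. *)
  pose M := (`|y - s 0|) / c.
  have M0 : 0 <= M by rewrite divr_ge0// ltW.
  have cM : c * M = `|y - s 0| by rewrite mulrC divfK// gt_eqF.
  have h1 : s 0 + c * M <= s M by have := grow 0 M M0; lra.
  have h2 : s (- M) <= s 0 - c * M by have := grow (- M) 0; rewrite oppr_le0 M0 => /(_ isT); lra.
  have := ler_norm (y - s 0); have := ler_norm (- (y - s 0)); rewrite normrN => n1 n2.
  have [|||t _ st] := @IVT R s (- M) M y.
  - by rewrite (le_trans _ M0)// oppr_le0.
  - exact: continuous_subspaceT.
  - by rewrite ge_min le_max; apply/andP; split; apply/orP; [left|right]; lra.
  by exists t.
pose q y := projT1 (cid (surj y)).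
have qK : cancel q s by move=> y; rewrite /q; case: cid.
have sK : cancel s q by move=> t; apply: sinj; rewrite qK.
exists q; split=> // y.
rewrite -{1}(qK y); apply: is_derive_inverse; [by near=> z; exact: sK|by near=> z; exact: cs|].
by rewrite gt_eqF// (lt_le_trans c0).
Unshelve. all: by end_near. Qed.

Definition glue_at (T : Type) (a : R) (f g : R -> T) (x : R) : T := if x <= a then f x else g x.

Lemma is_derive_glue (W : normedModType R) (a : R) (f g f' g' : R -> W) (x : R) :
  f a = g a -> f' a = g' a ->
  (x <= a -> is_derive x 1 f (f' x)) -> (a <= x -> is_derive x 1 g (g' x)) ->
  is_derive x 1 (glue_at a f g) (glue_at a f' g' x).
Proof.
move=> fga fga' df dg; rewrite {2}/glue_at.
have [xa|ax|xa] := ltgtP x a.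
- apply: (@is_derive_local _ f _ _ (a - x)); first by rewrite subr_gt0.
    by move=> y; rewrite ltr_distl => /andP[_ ya]; rewrite /glue_at ifT//; lra.
  exact/df/ltW.
- apply: (@is_derive_local _ g _ _ (x - a)); first by rewrite subr_gt0.
    by move=> y; rewrite ltr_distl => /andP[ya _]; rewrite /glue_at ifF//; apply/negbTE; rewrite -ltNge; lra.
  exact/dg/ltW.
- rewrite xa; have {}df : is_derive a 1 f (f' a) by rewrite -xa; apply: df; rewrite xa.
  have {}dg : is_derive a 1 g (g' a) by rewrite -xa; apply: dg; rewrite xa.
  move: df => /is_derive_epsP df; move: dg => /is_derive_epsP dg.
  apply/is_derive_epsP => e e0.
  have [r1 r10 h1] := df _ e0; have [r2 r20 h2] := dg _ e0.
  exists (Num.min r1 r2); first by rewrite lt_min r10.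
  move=> y; rewrite lt_min => /andP[y1 y2]; rewrite /glue_at lexx.
  by case: ifP => _; [exact: h1|rewrite fga fga'; exact: h2].
Qed.

Lemma continuous_glue (T : topologicalType) (a : R) (f g : R -> T) (x : R) :
  f a = g a -> (x <= a -> continuous_at x f) -> (a <= x -> continuous_at x g) ->
  continuous_at x (glue_at a f g).
Proof.
move=> fga cf cg; rewrite /continuous_at {2}/glue_at.
have [xa|ax|xa] := ltgtP x a.
- apply: cvg_trans (cf (ltW xa)); apply: near_eq_cvg.
  by near=> y; rewrite /glue_at ifT// ltW//; near: y; exact: lt_nbhsl.
- apply: cvg_trans (cg (ltW ax)); apply: near_eq_cvg.
  near=> y; rewrite /glue_at ifF//; apply/negbTE; rewrite -ltNge; near: y; exact: lt_nbhsr.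
- have xa' : x <= a by rewrite xa.
  have ax' : a <= x by rewrite xa.
  move=> B /= fB; have fB1 := cf xa' B fB.
  have fB2 : nbhs x (g @^-1` B) by apply: cg => //; rewrite xa -fga -xa.
  apply: (filterS _ (filterI (fB1 : nbhs x (f @^-1` B)) fB2)) => y [h1 h2] /=.
  by rewrite /glue_at; case: ifP.
Unshelve. all: by end_near. Qed.

End Calculus2.

(** * Chords of curves with Lipschitz tangent *)

Section Geometry.
Variables (R : realType).

Lemma period_mod (l s t : R) : 0 < l -> exists k : int, s <= t + k%:~R * l < s + l.
Proof.
move=> l0; exists (- Num.floor ((t - s) / l)); rewrite mulrNz mulNr.
have /andP[h1 h2] := floor_itv ((t - s) / l).
move: h1 h2; rewrite ler_pdivlMr// ltr_pdivrMr// intrD mulr1z [(_ + 1) * l]mulrDl mul1r => h1 h2.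
apply/andP; split; lra.
Qed.

Lemma periodic_int (T : Type) (f : R -> T) (l : R) : (forall t, f (t + l) = f t) ->
  forall (k : int) t, f (t + k%:~R * l) = f t.
Proof.
move=> h.
have hn (k : nat) t : f (t + k%:R * l) = f t.
  elim: k t => [|k IH] t; first by rewrite mul0r addr0.
  by rewrite -addn1 natrD mulrDl mul1r addrA h IH.
case=> k t; first exact: hn.
by rewrite NegzE mulrNz mulNr -[LHS](hn k.+1) subrK.
Qed.

(** Unit vectors at distance [x] span an angle slightly larger than [x]; for small [x] the factor
    [K > 1] absorbs the difference. *)
Lemma cos_le_quadratic (K : R) : 1 < K ->
  exists2 d : R, 0 < d & forall x, 0 <= x <= d -> cos (K * x) <= 1 - x ^+ 2 / 2.
Proof.
move=> K1; have K0 : 0 < K by lra.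
have /is_derive_epsP h := is_derive_sin (0 : R).
have e0 : 0 < 1 - K^-1 by rewrite subr_gt0 invf_lt1.
have [r r0 hr] := h _ e0.
exists (r / K); first by rewrite divr_gt0.
move=> x /andP[x0 xr].
pose y := K * x / 2.
have y0 : 0 <= y by rewrite /y divr_ge0// mulr_ge0// ltW.
have yr : `|y - 0| < r.
  by rewrite subr0 ger0_norm// /y; move: xr; rewrite ler_pdivlMr// mulrC; lra.
have := hr _ yr; rewrite sin0 cos0 !subr0 [_ *: 1]mulr1 (ger0_norm y0) ler_norml => /andP[hy _].
have hs : x / 2 <= sin y.
  suff <- : K^-1 * y = x / 2 by lra.
  by rewrite /y; field; rewrite gt_eqF.
have -> : K * x = y *+ 2 by rewrite /y mulr2n; field.
rewrite cos_mulr2n cos2sin2 mulr2n.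
have : (x / 2) ^+ 2 <= sin y ^+ 2 by rewrite lerXn2r// nnegrE; lra.
by rewrite exprMn; lra.
Qed.

Variable n : nat.
Notation V := 'rV[R]_n.
Implicit Types (g T : R -> V) (k : R).

Lemma dotv_of_dist (u v : V) : enorm u = 1 -> enorm v = 1 ->
  dotv u v = 1 - enorm (u - v) ^+ 2 / 2.
Proof.
move=> /enorm1P u1 /enorm1P v1; rewrite enorm_sq !dotvS (dotvC v u) u1 v1; lra.
Qed.

(** The hypothesis bounds chords, the conclusion angles. If the angle [u'] between the end tangents
    exceeded [u], cut the interval into steps so short that each turns by at most [K] times its
    chord bound, with [K * u] halfway between [u] and [u']; [dotv_cos_add] adds the turns and
    contradicts [u']. *)
Lemma lipschitz_cone T k : 0 < k -> (forall t, enorm (T t) = 1) ->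
  (forall s t, enorm (T s - T t) <= k * `|s - t|) ->
  forall s t, k * `|s - t| <= pi -> cos (k * (s - t)) <= dotv (T s) (T t).
Proof.
move=> k0 T1 Tl.
suff main s t : s <= t -> k * (t - s) <= pi -> cos (k * (t - s)) <= dotv (T s) (T t).
  move=> s t; case: (leP s t) => [st|/ltW st].
    rewrite distrC ger0_norm ?subr_ge0// => /(main _ _ st).
    by rewrite -cosN -mulrN opprB.
  by rewrite ger0_norm ?subr_ge0// dotvC; exact: main.
rewrite le_eqVlt => /predU1P[->|st] upi.
  by rewrite subrr mulr0 cos0 -enorm_sq T1 expr1n.
set u := k * (t - s) in upi *.
have u0 : 0 < u by rewrite /u mulr_gt0// subr_gt0.
rewrite leNgt; apply/negP => lt.
set c := dotv (T s) (T t) in lt.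
have c1 : -1 <= c <= 1.
  by have := dotv_norm_le (T s) (T t); rewrite !T1 mulr1 ler_norml.
pose u' := acos c.
have cu' : cos u' = c by rewrite acosK// in_itv.
have u'0 : 0 <= u' by exact: acos_ge0.
have u'pi : u' <= pi by exact: acos_lepi.
have uu' : u < u'.
  rewrite ltNge; apply/negP => u'u.
  have : cos u <= cos u' by rewrite leNgt ltr_cos ?in_itv/= ?u'0 ?u'pi ?upi ?(ltW u0)// -leNgt.
  by rewrite cu' leNgt lt.
pose v := (u + u') / 2.
have uv : u < v by rewrite /v; lra.
have vu' : v < u' by rewrite /v; lra.
pose K := v / u.
have K1 : 1 < K by rewrite /K ltr_pdivlMr// mul1r.
have Ku : K * u = v by rewrite /K divfK// gt_eqF.
have [d d0 hd] := cos_le_quadratic K1.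
pose N := (Num.truncn (u / d)).+1.
have N0 : 0 < N%:R :> R by rewrite ltr0n.
pose x := u / N%:R.
have x0 : 0 <= x by rewrite /x divr_ge0// ltW.
have xd : x <= d.
  rewrite /x ler_pdivrMr// mulrC -ler_pdivrMr//.
  by apply/ltW; rewrite /N; exact: truncnS_gt.
have xN : x * N%:R = u by rewrite /x divfK// gt_eqF.
pose h := (t - s) / N%:R.
have kh : k * h = x by rewrite /h /x /u mulrA.
have h0 : 0 <= h by rewrite /h divr_ge0// subr_ge0 ltW.
have ind (j : nat) : (j <= N)%N -> cos (K * (j%:R * x)) <= dotv (T s) (T (s + j%:R * h)).
  elim: j => [|j IH] jN.
    by rewrite !mul0r mulr0 cos0 addr0 -enorm_sq T1 expr1n.
  have {}IH := IH (ltnW jN).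
  have -> : K * (j.+1%:R * x) = K * (j%:R * x) + K * x by rewrite -natr1; ring.
  have Kx0 : 0 <= K * x by rewrite mulr_ge0//; lra.
  have le1 : K * (j.+1%:R * x) <= pi.
    apply: (@le_trans _ _ v); last by lra.
    rewrite -Ku -xN ler_pM2l; last by lra.
    by rewrite mulrC ler_wpM2l// ler_nat.
  apply: (@dotv_cos_add _ _ _ (T (s + j%:R * h))) => //.
  - by rewrite mulrCA mulr_ge0.
  - by move: le1; rewrite -natr1; lra.
  rewrite dotv_of_dist//; apply: le_trans (hd x _) _; first by rewrite x0.
  suff : enorm (T (s + j%:R * h) - T (s + j.+1%:R * h)) ^+ 2 <= x ^+ 2 by lra.
  rewrite lerXn2r ?nnegrE ?enorm_ge0//.
  apply: le_trans (Tl _ _) _; rewrite -natr1 distrC.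
  rewrite (_ : _ - _ = h); last by ring.
  by rewrite ger0_norm// kh.
have := ind N (leqnn _).
rewrite [N%:R * x]mulrC xN Ku.
have -> : s + N%:R * h = t by rewrite /h mulrC divfK ?gt_eqF// addrC subrK.
rewrite -/c -cu' leNgt => /negP; apply.
rewrite ltr_cos// in_itv/= ?u'0//.
by apply/andP; split; lra.
Qed.

(** Integrates [lipschitz_cone]: in the direction [T m] the curve advances at least as far as a
    circle of curvature [k]. *)
Lemma chord_forward g T k (m a : R) : 0 < k -> (forall t : R, is_derive t 1 g (T t)) ->
  (forall t, enorm (T t) = 1) -> (forall s t, enorm (T s - T t) <= k * `|s - t|) ->
  0 <= a -> k * a <= pi -> sin (k * a) / k <= dotv (g (m + a) - g m) (T m).
Proof.
move=> k0 dg T1 Tl a0 api.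
pose f x := dotv (g (m + x) - g m) (T m) - sin (k * x) / k.
have df (x : R) : is_derive x 1 f (dotv (T (m + x)) (T m) - cos (k * x)).
  apply: is_derive_rsub.
    apply: is_derive_dotvc; rewrite -[T (m + x)]subr0; apply: is_derive_sub.
    have := @is_derive_comp _ _ g (fun x => m + x) x 1 (T (m + x)); rewrite scale1r; apply => //.
    by rewrite -[X in is_derive _ _ _ X]add0r; apply: is_derive_radd.
  have dk : is_derive x 1 (fun x => k * x) k.
    have := is_derive_rmul (is_derive_rconst k x) (is_derive_rid x); by rewrite mul0r add0r mulr1.
  have := is_derive_rmul (is_derive_rcomp dk (is_derive_sin (k * x))) (is_derive_rconst k^-1 x).
  by rewrite mulr0 addr0 mulfK// gt_eqF.
have : f 0 <= f a.
  apply: (derivative_ge0_le a0 _ (fun x _ => df x)) => [x _|x /andP[x0 xa]].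
    exact: is_derive_rcontinuous (df x).
  rewrite subr_ge0; have := lipschitz_cone k0 T1 Tl (s := m + x) (t := m).
  rewrite (_ : m + x - m = x); last by ring.
  apply; rewrite ger0_norm ?(ltW x0)//; apply: le_trans api.
  by rewrite ler_pM2l// ltW.
rewrite /f addr0 subrr dotv0l mulr0 sin0 mul0r subr0.
lra.
Qed.

Lemma chord_backward g T k (m a : R) : 0 < k -> (forall t : R, is_derive t 1 g (T t)) ->
  (forall t, enorm (T t) = 1) -> (forall s t, enorm (T s - T t) <= k * `|s - t|) ->
  0 <= a -> k * a <= pi -> sin (k * a) / k <= dotv (g m - g (m - a)) (T m).
Proof.
move=> k0 dg T1 Tl a0 api.
have := @chord_forward (fun t => g (- t)) (fun t => - T (- t)) k (- m) a k0.
rewrite opprK opprD opprK dotvNr -dotvNl opprB; apply => //.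
- move=> t; rewrite -scaleN1r; exact: is_derive_comp.
- by move=> t; rewrite enormN.
- move=> s t; rewrite -opprD enormN (le_trans (Tl _ _))// -opprD normrN//.
Qed.

(** The quantity is half the derivative of the squared distance from [g m + v]. The chord
    contributes at least [sin (k a) / k], and [v], being orthogonal to [T m], takes away at most
    [|v| sin (k a)]. *)
Lemma foot_convex g T k (m a : R) (v : V) : 0 < k -> (forall t : R, is_derive t 1 g (T t)) ->
  (forall t, enorm (T t) = 1) -> (forall s t, enorm (T s - T t) <= k * `|s - t|) ->
  0 < a -> k * a <= pi / 2 -> dotv v (T m) = 0 -> k * enorm v < 1 ->
  0 < dotv (g (m + a) - (g m + v)) (T (m + a)).
Proof.
move=> k0 dg T1 Tl a0 api vT kv.
have pi0 := pi_gt0 R.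
have ka0 : 0 < k * a by rewrite mulr_gt0.
have sp : 0 < sin (k * a) by apply: sin_gt0_pi; rewrite ka0; lra.
have := @chord_backward g T k (m + a) a k0 dg T1 Tl (ltW a0); rewrite addrK => ch.
have {}ch : sin (k * a) / k <= dotv (g (m + a) - g m) (T (m + a)) by apply: ch; lra.
rewrite opprD addrA dotvBl.
set c := dotv (T m) (T (m + a)).
have hc : cos (k * a) <= c.
  have := lipschitz_cone k0 T1 Tl (s := m + a) (t := m).
  rewrite (_ : m + a - m = a); last by ring.
  by rewrite /c dotvC; apply; rewrite gtr0_norm//; lra.
have c0 : 0 <= cos (k * a) by apply: cos_ge0_pihalf; lra.
have h1 : dotv v (T (m + a)) <= enorm v * sin (k * a).
  have -> : dotv v (T (m + a)) = dotv v (T (m + a) - c *: T m) by rewrite dotvBr dotvZr vT mulr0 subr0.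
  apply: le_trans (dotv_le _ _) _; rewrite ler_wpM2l ?enorm_ge0//.
  rewrite -(@ler_pXn2r _ 2)// ?nnegrE ?enorm_ge0 ?(ltW sp)//.
  rewrite enorm_sq !dotvS (dotvC (T (m + a)) (T m)) -/c -!enorm_sq !T1 sin2cos2 expr1n.
  have : cos (k * a) ^+ 2 <= c ^+ 2 by rewrite lerXn2r ?nnegrE// (le_trans c0).
  lra.
suff : enorm v * sin (k * a) < sin (k * a) / k by lra.
rewrite ltr_pdivlMr//.
have kv' : 0 < 1 - k * enorm v by lra.
by have := mulr_gt0 sp kv'; lra.
Qed.

Lemma foot_convex_backward g T k (m a : R) (v : V) : 0 < k -> (forall t : R, is_derive t 1 g (T t)) ->
  (forall t, enorm (T t) = 1) -> (forall s t, enorm (T s - T t) <= k * `|s - t|) ->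
  0 < a -> k * a <= pi / 2 -> dotv v (T m) = 0 -> k * enorm v < 1 ->
  dotv (g (m - a) - (g m + v)) (T (m - a)) < 0.
Proof.
move=> k0 dg T1 Tl a0 api vT kv.
have := @foot_convex (fun t => g (- t)) (fun t => - T (- t)) k (- m) a v k0.
rewrite opprK opprD opprK dotvNr dotvNr oppr_gt0; apply => //.
- move=> t; rewrite -scaleN1r; exact: is_derive_comp.
- by move=> t; rewrite enormN.
- by move=> s t; rewrite -opprD enormN (le_trans (Tl _ _))// -opprD normrN.
- by rewrite vT oppr0.
Qed.

(* From either foot, <g - x, T> has a strict sign at the midpoint, and the two signs disagree. *)
Lemma short_arc_no_double_foot g T k (a L : R) (v v' : V) :
  0 < k -> (forall t : R, is_derive t 1 g (T t)) ->
  (forall t, enorm (T t) = 1) -> (forall s t, enorm (T s - T t) <= k * `|s - t|) ->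
  0 < L -> k * L <= pi -> dotv v (T a) = 0 -> dotv v' (T (a + L)) = 0 ->
  k * enorm v < 1 -> k * enorm v' < 1 -> g a + v != g (a + L) + v'.
Proof.
move=> k0 dg T1 Tl L0 Lpi vT v'T kv kv'; apply/eqP => e.
have L20 : 0 < L / 2 by lra.
have kL : k * (L / 2) <= pi / 2 by rewrite mulrA ler_pM2r// invr_gt0.
have := @foot_convex g T k a (L / 2) v k0 dg T1 Tl L20 kL vT kv.
have := @foot_convex_backward g T k (a + L) (L / 2) v' k0 dg T1 Tl L20 kL v'T kv'.
rewrite (_ : a + L - L / 2 = a + L / 2); last by field.
rewrite -e; lra.
Qed.

End Geometry.

(** * Unit-speed links *)

Section Systems.
Variables (R : realType).

Lemma finite_positive_min (I : finType) (f : I -> R) : (forall i, 0 < f i) ->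
  exists2 d : R, 0 < d & forall i, d <= f i.
Proof.
move=> f0; exists (\big[Num.min/1]_i f i); first by apply/lt_bigmin.
by move=> i; exact: bigmin_le.
Qed.

Lemma rectangle_min (f : R * R -> R) (a b c d : R) : a <= b -> c <= d -> continuous f ->
  exists x y, [/\ a <= x <= b, c <= y <= d &
    forall x' y', a <= x' <= b -> c <= y' <= d -> f (x, y) <= f (x', y')].
Proof.
move=> ab cd cf.
have [|||[x y]] := @compact_EVT_min _ R f (`[a, b] `*` `[c, d]).
- by exists (a, c); split; rewrite /= in_itv/= lexx.
- by apply: compact_setX; exact: segment_compact.
- exact: continuous_subspaceT.
rewrite inE => -[/=]; rewrite !in_itv/= => xab ycd h.
exists x, y; split=> // x' y' x'ab y'cd; apply: h; rewrite inE; split; rewrite /= in_itv//.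
Qed.

Lemma local_min_derive0 (f : R -> R) (t d r : R) : 0 < r -> is_derive t 1 f d ->
  (forall x, `|x - t| < r -> f t <= f x) -> d = 0.
Proof.
move=> r0 /is_derive_epsP h hm; apply/eqP/negP => /negP d0.
have e0 : 0 < `|d| / 2 by rewrite divr_gt0// normr_gt0.
have [r' r'0 hr'] := h _ e0.
pose e := Num.min r r' / 2.
have m0 : 0 < Num.min r r' by rewrite lt_min r0.
have em : e < Num.min r r' by rewrite /e; lra.
have ep : 0 < e by rewrite /e; lra.
pose x := t - Num.sg d * e.
have xt : x - t = - (Num.sg d * e) by rewrite /x; ring.
have nxt : `|x - t| = e by rewrite xt normrN normrM normr_sg d0 mul1r gtr0_norm.
have := hr' x; rewrite nxt (lt_le_trans em) ?ge_min ?lexx ?orbT// => /(_ isT).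
have := hm x; rewrite nxt (lt_le_trans em) ?ge_min ?lexx// => /(_ isT) h1.
rewrite xt ler_norml => /andP[_].
rewrite [_ *: d](_ : _ = - (e * `|d|)); last by rewrite normrEsg [_ *: d]mulrC; ring.
have : 0 < `|d| * e by rewrite mulr_gt0// normr_gt0.
lra.
Qed.

(** Serves at the right end of an interval, where constancy is known on one side only. *)
Lemma local_const_left_derive0 (f : R -> R) (a b d : R) : a < b -> is_derive b 1 f d ->
  (forall x, a <= x <= b -> f x = f b) -> d = 0.
Proof.
move=> ab /is_derive_epsP h hc; apply/eqP; rewrite -normr_eq0 eq_le normr_ge0 andbT.
apply/ler_addgt0Pl => e e0; rewrite addr0.
have [r r0 hr] := h _ e0.
pose y := Num.max a (b - r / 2).
have yb : y < b by rewrite gt_max ab/=; lra.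
have ay : a <= y by rewrite le_max lexx.
have ny : `|y - b| < r.
  rewrite ltr0_norm ?subr_lt0// opprB.
  have : b - r / 2 <= y by rewrite le_max lexx orbT.
  lra.
have := hr _ ny; rewrite (hc y) ?ay ?(ltW yb)// subrr sub0r normrN normrZ mulrC.
by rewrite ler_pM2r// normr_gt0 subr_eq0 lt_eqF.
Qed.

Variable n : nat.
Notation V := 'rV[R]_n.

Lemma dotv_eq_scale (u w : V) (c : R) : enorm u = c -> enorm w = 1 -> c <= dotv u w ->
  u = c *: w.
Proof.
move=> uc w1 cu; have := enorm_ge0 u; rewrite uc => c0.
apply/eqP; rewrite -subr_eq0 -dotvv_eq0 eq_le dotvv_ge0 andbT.
rewrite !dotvS (dotvC w u) -!enorm_sq w1 uc.
have : c * c <= c * dotv u w by rewrite ler_wpM2l.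
lra.
Qed.

Definition normal_inj (m : nat) (g : 'I_m -> R -> V) (r : R) : Prop :=
  forall p v p' v', normal_pair g r p v -> normal_pair g r p' v' ->
    p + v = p' + v' -> p = p' /\ v = v'.

Definition unit_system (m : nat) (g T : 'I_m -> R -> V) (l : 'I_m -> R) : Prop :=
  [/\ forall i, 0 < l i, forall i t, g i (t + l i) = g i t,
      forall i (t : R), is_derive t 1 (g i) (T i t),
      forall i t, enorm (T i t) = 1 &
      forall i j s t, g i s = g j t -> i = j /\ exists k : int, s = t + k%:~R * l i].

Section OneSystem.
Variables (m : nat) (g T : 'I_m -> R -> V) (l : 'I_m -> R).
Hypothesis sys : unit_system g T l.

Lemma unit_system_derive1 i t : derive1 (g i) t = T i t.
Proof. by case: sys => _ _ d _ _; rewrite (is_derive_derive1 (d i)). Qed.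

Lemma unit_system_periodicT i t : T i (t + l i) = T i t.
Proof.
case: sys => _ per d _ _.
have h : is_derive t 1 (fun x => g i (x + l i)) (1 *: T i (t + l i)).
  apply: is_derive_comp; rewrite -[X in is_derive _ _ _ X]addr0.
  exact: is_derive_radd.
rewrite scale1r in h; apply: is_derive_unique h _.
by rewrite (_ : (fun x => _) = g i); [exact: d|apply/funext => x; rewrite per].
Qed.

(** Normals shorter than [r] that meet have feet less than [2 r] apart, which [far] forbids for
    distant parameters; for close parameters [short_arc_no_double_foot] applies. *)
Lemma unit_system_normal_inj (k r : R) : 0 < k -> k * r <= 1 ->
  (forall i s t, enorm (T i s - T i t) <= k * `|s - t|) ->
  (forall i j s t, i != j \/ (i = j /\ pi / k <= t - s <= l i - pi / k) ->
     2 * r <= enorm (g i s - g j t)) ->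
  normal_inj g r.
Proof.
move=> k0 kr Tl far p v p' v' [i [s [-> [vT vr]]]] [j [t [-> [v'T v'r]]]] e.
case: sys => l0 per dg T1 inj.
rewrite unit_system_derive1 in vT; rewrite unit_system_derive1 in v'T.
suff e' : g i s = g j t.
  by split=> //; apply: (@addrI _ (g i s)); rewrite e e'.
have kv : k * enorm v < 1.
  by apply: lt_le_trans kr; rewrite ltr_pM2l.
have kv' : k * enorm v' < 1.
  by apply: lt_le_trans kr; rewrite ltr_pM2l.
have near : enorm (g i s - g j t) < 2 * r.
  have -> : g i s - g j t = v' - v.
    by apply: (@addIr _ v); rewrite subrK addrAC e addrAC subrr add0r.
  by apply: le_lt_trans (enormB _ _) _; lra.
have [ij|ij] := eqVneq i j; last first.
  by have := far i j s t (or_introl ij); rewrite leNgt near.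
subst j.
(* Shift [t] into [[s, s + l)]. The two points cut the component into two arcs: if one has length at
   most [pi / k] it is short, otherwise the pair is far. *)
have [q /andP[q1 q2]] := period_mod s t (l0 i).
pose t' := t + q%:~R * l i.
have gt' : g i t' = g i t by exact: periodic_int.
have Tt' : T i t' = T i t by apply: periodic_int => x; exact: unit_system_periodicT.
have [st|st] := eqVneq s t'; first by rewrite -gt' -st.
have {st}st : s < t' by rewrite lt_def eq_sym st.
have pik x : pi / k = x -> k * x = pi by move=> <-; rewrite mulrC divfK// gt_eqF.
have kpi x : x <= pi / k -> k * x <= pi by rewrite ler_pdivlMr// mulrC.
have [c1|c1] := leP (t' - s) (pi / k).
  have := @short_arc_no_double_foot _ _ (g i) (T i) k s (t' - s) v v' k0 (dg i) (T1 i) (Tl i).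
  have -> : s + (t' - s) = t' by ring.
  by rewrite Tt' gt' e subr_gt0 eqxx => /(_ st (kpi _ c1) vT v'T kv kv').
have [c2|c2] := leP (s + l i - t') (pi / k).
  have := @short_arc_no_double_foot _ _ (g i) (T i) k t' (s + l i - t') v' v k0 (dg i) (T1 i) (Tl i).
  have -> : t' + (s + l i - t') = s + l i by ring.
  rewrite Tt' gt' per unit_system_periodicT e subr_gt0 eqxx.
  by move=> /(_ q2 (kpi _ c2) v'T vT kv' kv).
have hf : 2 * r <= enorm (g i s - g i t').
  by apply: far; right; split=> //; apply/andP; split; lra.
by move: hf; rewrite gt' leNgt near.
Qed.

(* a half turn of chord 2 is a semicircle, whose endpoints form a double critical pair *)
Lemma half_turn_chord i (s : R) :
  (forall s t, enorm (T i s - T i t) <= `|s - t|) ->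
  (forall s t, g i s != g i t -> dotv (g i t - g i s) (T i s) = 0 ->
     dotv (g i t - g i s) (T i t) = 0 -> 2 < enorm (g i s - g i t)) ->
  2 < enorm (g i s - g i (s + pi)).
Proof.
move=> Tl dc; case: sys => l0 per dg T1 inj.
have pi0 := pi_gt0 R.
pose M := s + pi / 2.
have Tl1 s' t' : enorm (T i s' - T i t') <= 1 * `|s' - t'| by rewrite mul1r.
have p2 : 0 <= pi / 2 :> R by lra.
have p2' : 1 * (pi / 2) <= pi :> R by lra.
have := @chord_forward _ _ (g i) (T i) 1 M (pi / 2) ltr01 (dg i) (T1 i) Tl1 p2 p2'.
have := @chord_backward _ _ (g i) (T i) 1 M (pi / 2) ltr01 (dg i) (T1 i) Tl1 p2 p2'.
rewrite !mul1r sin_pihalf divr1 (_ : M - pi / 2 = s); last by rewrite /M; ring.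
rewrite (_ : M + pi / 2 = s + pi); last by rewrite /M; field.
move=> c1 c2.
set d := g i (s + pi) - g i s.
have dT : 2 <= dotv d (T i M).
  have -> : d = (g i (s + pi) - g i M) + (g i M - g i s) by rewrite /d subrKA.
  by rewrite dotvDl; lra.
have d2 : 2 <= enorm d.
  by apply: le_trans dT _; apply: le_trans (dotv_le _ _) _; rewrite T1 mulr1.
rewrite enormBC -/d lt_def d2 andbT; apply/eqP => d2'.
have dE : d = 2 *: T i M.
  by apply: dotv_eq_scale.
have ddT : dotv d (T i M) = 2 by rewrite dE dotvZl -enorm_sq T1; ring.
have dd : dotv d (T i M) = dotv (g i (s + pi) - g i M) (T i M) + dotv (g i M - g i s) (T i M).
  by rewrite -dotvDl subrKA.
(* Equality in the chord estimate over a quarter turn makes the comparison function [f] constant, so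
   its derivative at the end vanishes; since [cos] is zero there, the end tangent is orthogonal to
   [TT m0]. *)
have end0 (gg TT : R -> V) : (forall t : R, is_derive t 1 gg (TT t)) -> (forall t, enorm (TT t) = 1) ->
    (forall s' t', enorm (TT s' - TT t') <= 1 * `|s' - t'|) ->
    forall m0 : R, dotv (gg (m0 + pi / 2) - gg m0) (TT m0) = 1 -> dotv (TT (m0 + pi / 2)) (TT m0) = 0.
  move=> dgg TT1 TTl m0 e1.
  pose f x := dotv (gg (m0 + x) - gg m0) (TT m0) - sin x.
  have df (x : R) : is_derive x 1 f (dotv (TT (m0 + x)) (TT m0) - cos x).
    apply: is_derive_rsub; apply: is_derive_dotvc.
    rewrite -[TT (m0 + x)]subr0; apply: is_derive_sub.
    have := @is_derive_comp _ _ gg (fun x => m0 + x) x 1 (TT (m0 + x)); rewrite scale1r; apply => //.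
    by rewrite -[X in is_derive _ _ _ X]add0r; apply: is_derive_radd.
  have f' x : 0 <= x <= pi / 2 -> 0 <= dotv (TT (m0 + x)) (TT m0) - cos x.
    move=> /andP[x0 xp]; rewrite subr_ge0.
    have := lipschitz_cone ltr01 TT1 TTl (s := m0 + x) (t := m0).
    rewrite (_ : m0 + x - m0 = x); last by ring.
    by rewrite !mul1r; apply; rewrite ger0_norm//; lra.
  have mono a b : 0 <= a -> a <= b -> b <= pi / 2 -> f a <= f b.
    move=> a0 ab bp; apply: (derivative_ge0_le ab _ (fun x _ => df x)) => [x _|x /andP[x0 xa]].
      exact: is_derive_rcontinuous (df x).
    by apply: f'; apply/andP; split; lra.
  have f0 : f 0 = 0 by rewrite /f addr0 subrr dotv0l sin0 subrr.
  have fp : f (pi / 2) = 0 by rewrite /f e1 sin_pihalf subrr.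
  have p20 : 0 < pi / 2 :> R by lra.
  have := local_const_left_derive0 p20 (df (pi / 2)); rewrite cos_pihalf subr0; apply.
  move=> x /andP[x0 xp]; apply/eqP; rewrite eq_le mono//= fp -f0 mono//.
have e1 : dotv (T i (s + pi)) (T i M) = 0.
  rewrite (_ : s + pi = M + pi / 2); last by rewrite /M; field.
  apply: (end0 (g i)) => //.
  rewrite (_ : M + pi / 2 = s + pi); last by rewrite /M; field.
  by lra.
have e2 : dotv (T i s) (T i M) = 0.
  have := end0 (fun t => g i (- t)) (fun t => - T i (- t)).
  move=> h; have : dotv (- T i (- (- M + pi / 2))) (- T i (- - M)) = 0.
    apply: h.
    - by move=> t; rewrite -scaleN1r; apply: is_derive_comp.
    - by move=> t; rewrite enormN.
    - by move=> s' t'; rewrite -opprD enormN (le_trans (Tl1 _ _))// -opprD normrN.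
    rewrite opprK opprD opprK (_ : M - pi / 2 = s); last by rewrite /M; ring.
    by rewrite dotvNr -dotvNl opprB; lra.
  rewrite opprD opprK (_ : M - pi / 2 = s); last by rewrite /M; ring.
  by rewrite dotvNl dotvNr opprK.
have : 2 < enorm (g i s - g i (s + pi)).
  apply: dc.
  - by rewrite eq_sym -subr_eq0 -/d -enorm_eq0 d2' pnatr_eq0.
  - by rewrite -/d dE dotvZl dotvC e2 mulr0.
  - by rewrite -/d dE dotvZl dotvC e1 mulr0.
by rewrite enormBC -/d d2' ltxx.
Qed.


Lemma sq_enorm_min_critical (f : R -> V) (t : R) (d : V) (r : R) : 0 < r ->
  is_derive t 1 f d -> (forall x, `|x - t| < r -> enorm (f t) <= enorm (f x)) ->
  dotv (f t) d = 0.
Proof.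
move=> r0 df h.
have := local_min_derive0 r0 (is_derive_dotv df df).
rewrite (dotvC d) => e; suff : dotv (f t) d + dotv (f t) d = 0 by lra.
by apply: e => x /h hx; rewrite -!enorm_sq ler_pXn2r ?nnegrE ?enorm_ge0.
Qed.

Lemma unit_system_continuous i : continuous (g i).
Proof. by move=> t; case: sys => _ _ d _ _; exact: is_derive_continuous (d i t). Qed.

Lemma unit_system_min_apart (i j : 'I_m) :
  exists s t, forall s' t', enorm (g i s - g j t) <= enorm (g i s' - g j t').
Proof.
case: (sys) => l0 per dg T1 inj.
have cF : continuous (fun x : R * R => enorm (g i x.1 - g j x.2)).
  move=> x; apply: continuous_enorm; apply: cvgB.
    apply: (@continuous_comp _ _ _ fst (g i)); [exact: cvg_fst|exact: unit_system_continuous].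
  apply: (@continuous_comp _ _ _ snd (g j)); [exact: cvg_snd|exact: unit_system_continuous].
have [s [t [_ _ /= hm]]] := rectangle_min (ltW (l0 i)) (ltW (l0 j)) cF.
exists s, t => s' t'.
have [k /andP[k1 k2]] := period_mod 0 s' (l0 i).
have [k' /andP[k1' k2']] := period_mod 0 t' (l0 j).
rewrite -(periodic_int (per i) k s') -(periodic_int (per j) k' t').
by apply: hm; rewrite ?k1 ?k1'/= ltW// -[ltRHS]add0r.
Qed.

(** A closest pair on two different components is a double critical pair. *)
Lemma unit_system_far_apart (i j : 'I_m) : i != j ->
  (forall s t, g i s != g j t -> dotv (g j t - g i s) (T i s) = 0 ->
     dotv (g j t - g i s) (T j t) = 0 -> 2 < enorm (g i s - g j t)) ->
  exists2 d, 2 < d & forall s t, d <= enorm (g i s - g j t).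
Proof.
move=> ij dc; case: (sys) => l0 per dg T1 inj.
have [s [t hm]] := unit_system_min_apart i j.
exists (enorm (g i s - g j t)) => //; apply: dc.
- by apply/negP => /eqP /inj[/eqP]; rewrite (negbTE ij).
- rewrite -opprB dotvNl; apply/eqP; rewrite oppr_eq0; apply/eqP.
  apply: (@sq_enorm_min_critical (fun x => g i x - g j t) s (T i s) 1) => //.
  by rewrite -[X in is_derive _ _ _ X]subr0; apply: is_derive_sub.
- apply: (@sq_enorm_min_critical (fun x => g j x - g i s) t (T j t) 1) => //.
    by rewrite -[X in is_derive _ _ _ X]subr0; apply: is_derive_sub.
  by move=> x _; rewrite enormBC (enormBC (g j x)).
Qed.

Lemma unit_system_min_self (i : 'I_m) (c : R) : c <= l i - c ->
  exists s u, c <= u <= l i - c /\ forall s' u', c <= u' <= l i - c ->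
    enorm (g i s - g i (s + u)) <= enorm (g i s' - g i (s' + u')).
Proof.
move=> lc; case: (sys) => l0 per dg T1 inj.
have cF : continuous (fun x : R * R => enorm (g i x.1 - g i (x.1 + x.2))).
  move=> x; apply: continuous_enorm; apply: cvgB.
    apply: (@continuous_comp _ _ _ fst (g i)); [exact: cvg_fst|exact: unit_system_continuous].
  apply: (@continuous_comp _ _ _ (fun y : R * R => y.1 + y.2) (g i)); last exact: unit_system_continuous.
  by apply: cvgD; [exact: cvg_fst|exact: cvg_snd].
have [s [u [_ uin /= hm]]] := rectangle_min (ltW (l0 i)) lc cF.
exists s, u; split=> // s' u' u'in; have [k /andP[k1 k2]] := period_mod 0 s' (l0 i).
rewrite -(periodic_int (per i) k s') -(periodic_int (per i) k (s' + u')) addrAC.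
by apply: hm; rewrite ?k1//= ltW// -[ltRHS]add0r.
Qed.

Lemma unit_system_ne (i : 'I_m) (s u : R) : 0 < u -> u < l i -> g i (s + u) != g i s.
Proof.
move=> u0 ul; case: (sys) => l0 per dg T1 inj.
apply/negP => /eqP /inj[_ [k]] /addrI e.
have k0 : 0 < k by rewrite -(ltr0z R) -(pmulr_lgt0 _ (l0 i)) -e.
have k1 : k < 1 by rewrite -(ltr_int R) -(ltr_pM2r (l0 i)) -e mul1r.
by lia.
Qed.

(** Minimize over the starting point and the arc [u] between [pi] and [l - pi]. At either extreme
    value of [u] the pair is a half turn apart; otherwise it is critical in both variables and hence
    double critical. *)
Lemma unit_system_far_self (i : 'I_m) :
  (forall s t, enorm (T i s - T i t) <= `|s - t|) ->
  (forall s t, g i s != g i t -> dotv (g i t - g i s) (T i s) = 0 ->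
     dotv (g i t - g i s) (T i t) = 0 -> 2 < enorm (g i s - g i t)) ->
  exists2 d, 2 < d & forall s t, pi <= t - s <= l i - pi -> d <= enorm (g i s - g i t).
Proof.
move=> Tl dc; case: (sys) => l0 per dg T1 inj.
have pi0 := pi_gt0 R.
have [lpi|lpi] := leP pi (l i - pi); last first.
  (* The range of arcs is empty, so any number above [2] does. *)
  exists 3; first by rewrite ltr_nat.
  by move=> s t /andP[a b]; have := le_lt_trans (le_trans a b) lpi; rewrite ltxx.
have [s [u [uin hm]]] := unit_system_min_self lpi.
exists (enorm (g i s - g i (s + u))); last first.
  by move=> s' t' h; rewrite -(subrKC s' t') hm.
move/andP: uin => [u1 u2].
have [eu|nu] := eqVneq u pi; first by rewrite eu; exact: half_turn_chord.
have [eu'|nu'] := eqVneq u (l i - pi).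
  have -> : g i s = g i (s + u + pi) by rewrite eu' -addrA subrK per.
  by rewrite enormBC; exact: half_turn_chord.
have du : is_derive u 1 (fun x => g i (s + x)) (T i (s + u)).
  rewrite -[X in is_derive _ _ _ X]scale1r; apply: is_derive_comp.
  by rewrite -[X in is_derive _ _ _ X]add0r; apply: is_derive_radd.
have d2 : dotv (g i (s + u) - g i s) (T i (s + u)) = 0.
  pose r := Num.min (u - pi) (l i - pi - u).
  have r0 : 0 < r by rewrite lt_min !subr_gt0 !lt_def nu u1 eq_sym nu' u2.
  apply: (@sq_enorm_min_critical (fun x => g i (s + x) - g i s) u (T i (s + u)) r) => //.
    by rewrite -[X in is_derive _ _ _ X]subr0; apply: is_derive_sub.
  move=> x; rewrite lt_min ltr_norml => /andP[/andP[a _]].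
  rewrite ltr_norml => /andP[_ b].
  by rewrite enormBC (enormBC (g i (s + x))) hm//; apply/andP; split; lra.
have ds : is_derive s 1 (fun x => g i (x + u)) (T i (s + u)).
  rewrite -[X in is_derive _ _ _ X]scale1r; apply: is_derive_comp.
  by rewrite -[X in is_derive _ _ _ X]addr0; apply: is_derive_radd.
(* Sliding both points together gives the difference of the two orthogonality relations; [d2] is one
   of them. *)
have d1 : dotv (g i (s + u) - g i s) (T i (s + u) - T i s) = 0.
  apply: (@sq_enorm_min_critical (fun x => g i (x + u) - g i x) s _ 1) => //.
  by move=> x _; rewrite enormBC (enormBC (g i (x + u))) hm// u1.
apply: dc => //; last by move: d1; rewrite dotvBr d2 sub0r => /eqP; rewrite oppr_eq0 => /eqP.
by rewrite eq_sym; apply: unit_system_ne; lra.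
Qed.

Lemma unit_system_far_positive (c : R) : 0 < c ->
  exists2 e, 0 < e & forall i j s t, i != j \/ (i = j /\ c <= t - s <= l i - c) ->
    e <= enorm (g i s - g j t).
Proof.
move=> c0; case: (sys) => l0 per dg T1 inj.
have h (ij : 'I_m * 'I_m) : exists e, 0 < e /\ forall s t,
    ij.1 != ij.2 \/ (ij.1 = ij.2 /\ c <= t - s <= l ij.1 - c) ->
    e <= enorm (g ij.1 s - g ij.2 t).
  case: ij => i j /=; have [<-|ij] := eqVneq i j.
    have [lc|lc] := leP c (l i - c); last first.
      exists 1; split=> // s t [//|[_ /andP[a b]]].
      by have := le_lt_trans (le_trans a b) lc; rewrite ltxx.
    have [s [u [/andP[u1 u2] hm]]] := unit_system_min_self lc.
    exists (enorm (g i s - g i (s + u))); split.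
      by rewrite enormBC enorm_gt0 subr_eq0; apply: unit_system_ne; lra.
    by move=> s' t' [//|[_ h]]; rewrite -(subrKC s' t') hm.
  have [s [t hm]] := unit_system_min_apart i j.
  exists (enorm (g i s - g j t)); split=> //.
  rewrite enorm_gt0 subr_eq0; apply/negP => /eqP /inj[/eqP].
  by rewrite (negbTE ij).
have [f hf] := choice h.
have [e e0 he] := finite_positive_min (fun ij => (hf ij).1).
exists e => // i j s t hij; have := (hf (i, j)).2 s t hij.
by apply: le_trans; exact: (he (i, j)).
Qed.

(** Compactness turns the strict inequality for double critical pairs into a uniform margin [e], the
    slack that every later perturbation spends. *)
Lemma unit_system_far :
  (forall i s t, enorm (T i s - T i t) <= `|s - t|) ->
  (forall i j s t, g i s != g j t -> dotv (g j t - g i s) (T i s) = 0 ->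
     dotv (g j t - g i s) (T j t) = 0 -> 2 < enorm (g i s - g j t)) ->
  exists2 e, 0 < e & forall i j s t, i != j \/ (i = j /\ pi <= t - s <= l i - pi) ->
    2 + e <= enorm (g i s - g j t).
Proof.
move=> Tl dc.
have h (ij : 'I_m * 'I_m) : exists e, 0 < e /\ forall s t,
    ij.1 != ij.2 \/ (ij.1 = ij.2 /\ pi <= t - s <= l ij.1 - pi) ->
    2 + e <= enorm (g ij.1 s - g ij.2 t).
  case: ij => i j /=; have [<-|ij] := eqVneq i j.
    have [d d2 hd] := unit_system_far_self (Tl i) (dc i i).
    exists (d - 2); split; first by rewrite subr_gt0.
    by move=> s t [//|[_]] /hd; rewrite subrKC.
  have [d d2 hd] := unit_system_far_apart ij (dc i j).
  exists (d - 2); split; first by rewrite subr_gt0.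
  by move=> s t _; rewrite subrKC.
have [f hf] := choice h.
have [e e0 he] := finite_positive_min (fun ij => (hf ij).1).
exists e => // i j s t hij; have := (hf (i, j)).2 s t hij.
by apply: le_trans; rewrite lerD2l; exact: (he (i, j)).
Qed.

End OneSystem.
End Systems.

(** * Normal injectivity radius *)

Section Thickness.
Variables (R : realType) (n : nat).
Notation V := 'rV[R]_n.

Lemma is_derive_enorm_eps (f : R -> V) (t : R) (d : V) : is_derive t 1 f d ->
  forall e : R, 0 < e -> exists2 r : R, 0 < r &
    forall x, `|x - t| < r -> enorm (f x - f t - (x - t) *: d) <= e * `|x - t|.
Proof.
move=> /is_derive_epsP h e e0.
(* [n + 1] in place of [n] makes the division legitimate also for [n = 0]. *)
have n0 : 0 < (n%:R + 1 : R) by rewrite ltr_wpDl.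
have e'0 : 0 < e / (n%:R + 1) by rewrite divr_gt0.
have [r r0 hr] := h _ e'0; exists r => // x /hr hx.
apply: le_trans (enorm_le_normr _) _.
apply: (@le_trans _ _ (n%:R * (e / (n%:R + 1) * `|x - t|))); first by rewrite ler_wpM2l.
rewrite mulrA ler_wpM2r// mulrA ler_pdivrMr// mulrC ler_pM2l// lerDl//.
Qed.

Lemma segment_min (f : R -> R) (a b : R) : a <= b -> continuous f ->
  exists2 x, a <= x <= b & forall y, a <= y <= b -> f x <= f y.
Proof.
move=> ab cf; have [|x] := @EVT_min _ f a b ab; first exact: continuous_subspaceT.
rewrite in_itv/= => xab h; by exists x => // y yab; apply: h.
Qed.

Lemma segment_max (f : R -> R) (a b : R) : a <= b -> continuous f ->
  exists2 x, a <= x <= b & forall y, a <= y <= b -> f y <= f x.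
Proof.
move=> ab cf; have [|x] := @EVT_max _ f a b ab; first exact: continuous_subspaceT.
rewrite in_itv/= => xab h; by exists x => // y yab; apply: h.
Qed.

(** From local to global, where the local bound only compares points with the centre [c];
    [real_induction] passes through [c] and adds the two halves. *)
Lemma lipschitz_chain (F : R -> V) (S : R -> R) (a b : R) : a <= b ->
  (forall x y, a <= x -> x <= y -> y <= b -> S x <= S y) ->
  (forall c, a <= c <= b -> exists2 r, 0 < r & forall x, a <= x <= b -> `|x - c| < r ->
     enorm (F x - F c) <= `|S x - S c|) ->
  enorm (F b - F a) <= S b - S a.
Proof.
move=> ab Smono loc.
apply: (@real_induction _ (fun x => enorm (F x - F a) <= S x - S a) a b ab).
  by rewrite !subrr enorm0.
move=> c /loc[r r0 hr]; exists r => // t u at_ tc ct cu ub uc Pt.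
have tb : t <= b by lra.
have au : a <= u by lra.
have h1 : enorm (F u - F c) <= S u - S c.
  have := hr u; rewrite au ub ger0_norm ?subr_ge0// => /(_ isT) h.
  rewrite -[leRHS]ger0_norm; first by apply: h; lra.
  by rewrite subr_ge0 Smono//; lra.
have h2 : enorm (F c - F t) <= S c - S t.
  have := hr t; rewrite at_ tb distrC ger0_norm ?subr_ge0// => /(_ isT) h.
  rewrite -[leRHS]ger0_norm; first by rewrite enormBC distrC; apply: h; lra.
  by rewrite subr_ge0 Smono//; lra.
have := enorm_dist (F u) (F c) (F a); have := enorm_dist (F c) (F t) (F a).
lra.
Qed.

Lemma enorm_unit_test (u : V) (c : R) : (forall z, enorm z = 1 -> dotv u z <= c) -> 0 <= c ->
  enorm u <= c.
Proof.
move=> h c0; have [->|u0] := eqVneq u 0; first by rewrite enorm0.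
have e0 : 0 < enorm u by rewrite enorm_gt0.
have := h ((enorm u)^-1 *: u); rewrite enormZ ger0_norm ?invr_ge0 ?enorm_ge0//.
rewrite mulVf ?gt_eqF// => /(_ erefl).
by rewrite dotvZr -enorm_sq expr2 mulKf// gt_eqF.
Qed.

(** Tested against a unit vector [z], the bound is the monotonicity of [S - <f, z>]. *)
Lemma mean_value_enorm (f f' : R -> V) (S S' : R -> R) (a b : R) : a <= b ->
  (forall x, a <= x <= b -> continuous_at x f) ->
  (forall x, a <= x <= b -> continuous_at x S) ->
  (forall x : R, a < x < b -> is_derive x 1 f (f' x)) ->
  (forall x : R, a < x < b -> is_derive x 1 S (S' x)) ->
  (forall x : R, a < x < b -> enorm (f' x) <= S' x) ->
  enorm (f b - f a) <= S b - S a.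
Proof.
move=> ab cf cS df dS fS.
have key z : enorm z = 1 -> dotv (f b - f a) z <= S b - S a.
  move=> z1.
  have : S a - dotv (f a) z <= S b - dotv (f b) z.
    apply: (@derivative_ge0_le _ (fun x => S x - dotv (f x) z)
              (fun x => S' x - dotv (f' x) z)) => //.
    - move=> x xab; apply: cvgB; first exact: cS.
      by apply: continuous_dotv; [exact: cf|exact: cvg_cst].
    - by move=> x xab; apply: is_derive_rsub; [exact: dS|exact/is_derive_dotvc/df].
    - move=> x xab; rewrite subr_ge0; apply: le_trans (dotv_le _ _) _.
      by rewrite z1 mulr1 fS.
  by rewrite dotvBl; lra.
apply: enorm_unit_test => //.
rewrite subr_ge0; apply: (derivative_ge0_le ab cS dS) => x /fS.
by apply: le_trans; exact: enorm_ge0.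
Qed.

(** Covers links and their arclength forms alike, so that the two can be compared in
    [normal_transfer]. *)
Definition regular_system (m : nat) (g dg : 'I_m -> R -> V) (l : 'I_m -> R) : Prop :=
  [/\ forall i, 0 < l i, forall i t, g i (t + l i) = g i t,
      forall i (t : R), is_derive t 1 (g i) (dg i t),
      forall i t, dg i t != 0 &
      forall i j s t, g i s = g j t -> i = j /\ exists k : int, s = t + k%:~R * l i].

Lemma unit_system_regular m (g T : 'I_m -> R -> V) l :
  unit_system g T l -> regular_system g T l.
Proof.
case=> h1 h2 h3 h4 h5; split=> // i t; by rewrite -enorm_gt0 h4.
Qed.

Lemma link_regular m (g : 'I_m -> R -> V) : is_link g ->
  regular_system g (fun i => derive1 (g i)) (fun=> 1).
Proof.
move=> [per [c1 [d0 inj]]]; split=> //.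
- by move=> i t; exact: C1curve_is_derive.
- by move=> i j s t /inj[-> [k ->]]; split=> //; exists k; rewrite mulr1.
Qed.

Lemma regular_system_continuous m (g dg : 'I_m -> R -> V) l : regular_system g dg l ->
  forall i, continuous (g i).
Proof. by case=> _ _ d _ _ i t; exact: is_derive_continuous (d i t). Qed.

(** Continuity of the inverse of an injective continuous map on a compact set, with parameters taken
    modulo the period. *)
Lemma regular_system_separation m (g dg : 'I_m -> R -> V) l : regular_system g dg l ->
  forall i t rho, 0 < rho -> exists2 d, 0 < d &
    forall j t', enorm (g j t' - g i t) < d -> i = j /\ exists k : int, `|t' + k%:~R * l i - t| < rho.
Proof.
move=> sys i t rho rho0; case: (sys) => l0 per dg' dg0 inj.
have cF j : continuous (fun x => enorm (g j x - g i t)).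
  move=> x; apply: continuous_enorm; apply: cvgB; last exact: cvg_cst.
  exact: (regular_system_continuous sys).
have hj (j : 'I_m) : exists d, 0 < d /\
    forall t', enorm (g j t' - g i t) < d -> i = j /\ exists k : int, `|t' + k%:~R * l i - t| < rho.
  have [<-{j}|ij] := eqVneq i j; last first.
    have [x _ hx] := segment_min (ltW (l0 j)) (cF j).
    exists (enorm (g j x - g i t)); split.
      by rewrite enorm_gt0 subr_eq0; apply/negP => /eqP/inj[/eqP]; rewrite eq_sym (negbTE ij).
    move=> t'; have [k /andP[k1 k2]] := period_mod 0 t' (l0 j).
    rewrite -(periodic_int (per j) k t') => lt.
    have hk : 0 <= t' + k%:~R * l j <= l j by rewrite k1 ltW// -[ltRHS]add0r.
    by have := lt_le_trans lt (hx _ hk); rewrite ltxx.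
  have near t' : (exists k : int, `|t' + k%:~R * l i - t| < rho) \/
      exists k : int, t + rho <= t' + k%:~R * l i <= t + l i - rho.
    have [k /andP[k1 k2]] := period_mod t t' (l0 i).
    have [c1|c1] := ltP (t' + k%:~R * l i) (t + rho).
      by left; exists k; rewrite ger0_norm; lra.
    have [c2|c2] := ltP (t + l i - rho) (t' + k%:~R * l i); last first.
      by right; exists k; rewrite c1.
    left; exists (k - 1); rewrite intrD mulrNz mulr1z [(_ + -1) * _]mulrDl mulN1r.
    by rewrite ltr0_norm; lra.
  have [ab|ab] := leP (t + rho) (t + l i - rho); last first.
    exists 1; split=> // t' _; split=> //; case: (near t') => // -[k /andP[a b]].
    by have := lt_le_trans ab (le_trans a b); rewrite ltxx.
  have [x /andP[xa xb] hx] := segment_min ab (cF i).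
  exists (enorm (g i x - g i t)); split.
    rewrite enorm_gt0 subr_eq0; apply/negP => /eqP /inj[_ [k e]].
    have k0 : 0 < k by rewrite -(ltr0z R) -(pmulr_lgt0 _ (l0 i)); lra.
    have k1 : k < 1 by rewrite -(ltr_int R) -(ltr_pM2r (l0 i)) mul1r; lra.
    by lia.
  move=> t' lt; split=> //; case: (near t') => // -[k hk].
  by have := lt_le_trans lt (hx _ hk); rewrite (periodic_int (per i)) ltxx.
have [f hf] := choice hj.
have [e e0 he] := finite_positive_min (fun j => (hf j).1).
by exists e => // j t' lt; apply: (hf j).2; exact: lt_le_trans (he j).
Qed.

(** Tangents at a common point are parallel although no smooth change of parameter is at hand: a
    secant of [h] is also a secant of [g], so its component along [v] is of smaller order than the
    increment of the parameter. *)
Lemma normal_transfer m (g dg h dh : 'I_m -> R -> V) l l' :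
  regular_system g dg l -> regular_system h dh l' ->
  (forall j s, exists i t, h j s = g i t) ->
  forall i t j s (v : V), h j s = g i t -> dotv v (dg i t) = 0 -> dotv v (dh j s) = 0.
Proof.
move=> sg sh sub i t j s v hg vg.
case: (sg) => lg pg dgg g0 ig; case: (sh) => lh ph dhh h0 ih.
apply/eqP; rewrite -normr_eq0 eq_le normr_ge0 andbT.
apply/ler_addgt0Pl => e e0; rewrite addr0.
pose a := enorm (dg i t).
have a0 : 0 < a by rewrite enorm_gt0.
pose b := enorm (dh j s).
have b0 : 0 <= b by exact: enorm_ge0.
have c0 : 0 <= enorm v by exact: enorm_ge0.
set c := enorm v in c0.
(* [a / 2] keeps [|t1 - t|] comparable with [x]; the second bound, like that in [e2], makes its
   share of the error at most [x * (e / 2)]. *)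
pose e1 := Num.min (a / 2) (e * a / (4 * (b + 1) * (c + 1))).
have e10 : 0 < e1.
  by rewrite lt_min divr_gt0//= divr_gt0 ?mulr_gt0//; lra.
have e1a : e1 <= a / 2 by rewrite ge_min lexx.
have e1e : e1 * (4 * (b + 1) * (c + 1)) <= e * a.
  rewrite -ler_pdivlMr; last by rewrite !mulr_gt0//; lra.
  by rewrite ge_min lexx orbT.
pose e2 := Num.min 1 (e / (2 * (c + 1))).
have e20 : 0 < e2 by rewrite lt_min ltr01/= divr_gt0//; lra.
have e21 : e2 <= 1 by rewrite ge_min lexx.
have e2e : e2 * (2 * (c + 1)) <= e.
  rewrite -ler_pdivlMr; last by lra.
  by rewrite ge_min lexx orbT.
have [rho rho0 hrho] := is_derive_enorm_eps (dgg i t) e10.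
have [d d0 hd] := regular_system_separation sg i t rho0.
have [r r0 hr] := is_derive_enorm_eps (dhh j s) e20.
pose x := Num.min r (d / (b + 1)) / 2.
have m0 : 0 < Num.min r (d / (b + 1)) by rewrite lt_min r0 divr_gt0//; lra.
have x0 : 0 < x by rewrite /x; lra.
have xr : x < r.
  by apply: (@lt_le_trans _ _ (Num.min r (d / (b + 1)))); [rewrite /x; lra|rewrite ge_min lexx].
have xd : x * (b + 1) < d.
  rewrite -ltr_pdivlMr; last by lra.
  by apply: (@lt_le_trans _ _ (Num.min r (d / (b + 1)))); [rewrite /x; lra|rewrite ge_min lexx orbT].
have := hr (s + x); rewrite (_ : s + x - s = x); last by ring.
rewrite (gtr0_norm x0) => /(_ xr) hx.
set q := h j (s + x) in hx *.
have hqb : enorm (q - h j s) <= x * (b + 1).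
  have := enormD (q - h j s - x *: dh j s) (x *: dh j s).
  rewrite subrK enormZ (gtr0_norm x0) -/b => k.
  have : e2 * x <= x by rewrite ger_pMl.
  by lra.
have [i' [t' qe]] := sub j (s + x); rewrite -/q in qe.
have [|ii [k hk]] := hd i' t'; first by rewrite -qe -hg; exact: le_lt_trans xd.
subst i'; move: qe; rewrite -(periodic_int (pg i) k) => qe.
set t1 := t' + k%:~R * l i in hk qe.
have ht := hrho _ hk; rewrite -qe -hg in ht.
have tb : `|t1 - t| * a <= 2 * (x * (b + 1)).
  have := enormB (q - h j s) (q - h j s - (t1 - t) *: dg i t).
  rewrite opprB addrC subrK enormZ -/a => k1.
  have : e1 * `|t1 - t| <= a / 2 * `|t1 - t| by rewrite ler_wpM2r.
  lra.
have v1 : `|dotv v (q - h j s)| <= c * (e1 * `|t1 - t|).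
  have -> : dotv v (q - h j s) = dotv v (q - h j s - (t1 - t) *: dg i t).
    by rewrite [RHS]dotvBr dotvZr vg mulr0 subr0.
  by apply: le_trans (dotv_norm_le _ _) _; rewrite ler_wpM2l.
have v2 : `|dotv v (q - h j s - x *: dh j s)| <= c * (e2 * x).
  by apply: le_trans (dotv_norm_le _ _) _; rewrite ler_wpM2l.
have v3 : x * `|dotv v (dh j s)| <= c * (e1 * `|t1 - t|) + c * (e2 * x).
  have -> : x * `|dotv v (dh j s)| = `|dotv v (q - h j s) - dotv v (q - h j s - x *: dh j s)|.
    rewrite [dotv v (_ - x *: _)]dotvBr dotvZr opprB addrC subrK normrM gtr0_norm//.
  by apply: le_trans (ler_normB _ _) _; exact: lerD.
rewrite -(ler_pM2l x0); apply: le_trans v3 _.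
have A1 : c * (e2 * x) <= x * (e / 2).
  have : e2 * c * 2 <= e by nra.
  nra.
have A2 : c * (e1 * `|t1 - t|) <= x * (e / 2).
  rewrite -(ler_pM2r a0).
  have B1 : c * (e1 * `|t1 - t|) * a <= c * e1 * (2 * (x * (b + 1))).
    have : c * e1 * (`|t1 - t| * a) <= c * e1 * (2 * (x * (b + 1))).
      by rewrite ler_wpM2l// mulr_ge0// ltW.
    lra.
  apply: le_trans B1 _.
  have B2 : e1 * (4 * (b + 1) * c) <= e * a.
    apply: le_trans e1e; rewrite ler_pM2l// ler_wpM2l//; first by rewrite mulr_ge0//; lra.
    lra.
  have := ler_wpM2l (ltW x0) B2; lra.
lra.
Qed.

Lemma normal_inj_scale m (a b : 'I_m -> R -> V) (mu r : R) : 0 < mu ->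
  (forall j s, exists i t (c : R), b i t = mu *: a j s /\ derive1 (b i) t = c *: derive1 (a j) s) ->
  normal_inj b (mu * r) -> normal_inj a r.
Proof.
move=> mu0 hab hb p v p' v' [i [t [-> [vt vr]]]] [j [s [-> [v's v'r]]]] e.
have [i1 [t1 [c1 [e1 d1]]]] := hab i t; have [j1 [s1 [c2 [e2 d2]]]] := hab j s.
have [|||E1 E2] := hb (mu *: a i t) (mu *: v) (mu *: a j s) (mu *: v').
- exists i1, t1; split=> //; split; first by rewrite d1 dotvZl dotvZr vt !mulr0.
  by rewrite enormZ gtr0_norm// ltr_pM2l.
- exists j1, s1; split=> //; split; first by rewrite d2 dotvZl dotvZr v's !mulr0.
  by rewrite enormZ gtr0_norm// ltr_pM2l.
- by rewrite -!scalerDr e.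
have mu0' : mu != 0 by rewrite gt_eqF.
by split; apply: (scalerI mu0').
Qed.

Lemma NIR_ge m (g : 'I_m -> R -> V) (r : R) : 0 < r -> normal_inj g r -> (r%:E <= NIR g)%E.
Proof.
move=> r0 h; apply: ereal_sup_ubound; right; exists r => //; split=> //.
Qed.

Lemma NIR_ge0 m (g : 'I_m -> R -> V) : (0 <= NIR g)%E.
Proof. by apply: ereal_sup_ubound; left. Qed.

(** The supremum is attained: two normal vectors shorter than [r] are already shorter than some
    admissible radius. *)
Lemma normal_inj_NIR m (g : 'I_m -> R -> V) (r : R) : NIR g = r%:E -> normal_inj g r.
Proof.
move=> hr p v p' v' [i [t [-> [a b]]]] [j [s [-> [c d]]]] e.
have : ((Num.max (enorm v) (enorm v'))%:E < NIR g)%E by rewrite hr lte_fin gt_max b d.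
move=> /ereal_sup_gt[y [->|[r1 [r10 h] <-]]].
  by rewrite lte_fin gt_max => /andP[]; rewrite ltNge enorm_ge0.
rewrite lte_fin gt_max => /andP[v1 v2].
by apply: h e; [exists i, t|exists j, s].
Qed.

(** The two half-chords of a double critical pair are normal vectors that meet at its midpoint. *)
Lemma NIR_le_half m (g : 'I_m -> R -> V) (p q : V) : double_critical g p q ->
  (NIR g <= (enorm (p - q) / 2)%:E)%E.
Proof.
move=> [pq [[i [s [pe hp]]] [j [t [qe hq]]]]].
apply: ge_ereal_sup => y [->|[r [r0 h] <-]].
  by rewrite lee_fin divr_ge0// enorm_ge0.
rewrite lee_fin leNgt; apply/negP => lt.
have [|||/eqP] := h p (2^-1 *: (q - p)) q (2^-1 *: (p - q)).
- exists i, s; split=> //; split; first by rewrite dotvZl hp mulr0.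
  by rewrite enormZ enormBC ger0_norm ?invr_ge0// mulrC.
- exists j, t; split=> //; split.
    by rewrite dotvZl -opprB dotvNl hq oppr0 mulr0.
  by rewrite enormZ ger0_norm ?invr_ge0// mulrC.
- by apply/rowP => k; rewrite !mxE; lra.
- by rewrite (negbTE pq).
Qed.

End Thickness.

(** * Thickness bounds curvature *)

Section Reparametrization.
Variables (R : realType) (n : nat).
Notation V := 'rV[R]_n.

Lemma NIR_eq_sup_le m (g : 'I_m -> R -> V) :
  (forall p q, double_critical g p q -> ((NIR g) <= (enorm (p - q) / 2)%:E)%E) ->
  (NIR g <= (2%:R)^-1%:E * DCSD g)%E.
Proof.
move=> h.
have h2 : (2%:E * NIR g <= DCSD g)%E.
  apply: le_ereal_inf_tmp => x [p [q [dc ->]]].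
  rewrite -lee_pdivlMl// -EFinM mulrC; exact: h.
by rewrite lee_pdivlMl.
Qed.

Lemma NIR_le_DCSD m (g : 'I_m -> R -> V) : (NIR g <= (2%:R)^-1%:E * DCSD g)%E.
Proof. by apply: NIR_eq_sup_le => p q; exact: NIR_le_half. Qed.

Lemma lt_DCSD m (g : 'I_m -> R -> V) (r : R) : (r%:E < (2%:R)^-1%:E * DCSD g)%E ->
  forall p q, double_critical g p q -> 2 * r < enorm (p - q).
Proof.
move=> h p q dc.
have : (2%:E * r%:E < DCSD g)%E by rewrite -lte_pdivlMl.
move=> /lt_le_trans /(_ (ereal_inf_lbound _)).
by move=> /(_ (enorm (p - q))%:E); rewrite -EFinM lte_fin; apply; exists p, q.
Qed.

(** A farthest pair on one component is critical in both parameters, and its points are distinct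
    because the curve is not constant. It keeps [NIR] finite. *)
Lemma double_critical_exists m (g dg : 'I_m -> R -> V) l (i0 : 'I_m) :
  regular_system g dg l -> exists p q, double_critical g p q.
Proof.
move=> sys; case: (sys) => l0 per dg' dg0 inj.
have cg i := @regular_system_continuous _ _ _ _ _ _ sys i.
have cF : continuous (fun x : R * R => - enorm (g i0 x.1 - g i0 x.2)).
  move=> x; apply: (@continuousN _ _ _ (fun x : R * R => enorm (g i0 x.1 - g i0 x.2))).
  apply: continuous_enorm; apply: cvgB.
    by apply: (@continuous_comp _ _ _ fst (g i0)); [exact: cvg_fst|exact: cg].
  by apply: (@continuous_comp _ _ _ snd (g i0)); [exact: cvg_snd|exact: cg].
have [s [t [_ _ /= hm]]] := rectangle_min (ltW (l0 i0)) (ltW (l0 i0)) cF.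
have {}hm s' t' : enorm (g i0 s' - g i0 t') <= enorm (g i0 s - g i0 t).
  have [k /andP[k1 k2]] := period_mod 0 s' (l0 i0).
  have [k' /andP[k1' k2']] := period_mod 0 t' (l0 i0).
  rewrite -(periodic_int (per i0) k s') -(periodic_int (per i0) k' t') -lerN2.
  by apply: hm; rewrite ?k1 ?k1'/= ltW// -[ltRHS]add0r.
have derive1g x : derive1 (g i0) x = dg i0 x by rewrite (is_derive_derive1 (dg' i0)).
have crit (f : R -> V) (x : R) (d : V) : is_derive x 1 f d ->
    (forall y, enorm (f y) <= enorm (f x)) -> dotv (f x) d = 0.
  move=> df hf; have := is_derive_dotv df df; rewrite (dotvC d) => /is_derive_ropp h2.
  have := local_min_derive0 (@ltr01 R) h2.
  move=> e; suff : - (dotv (f x) d + dotv (f x) d) = 0 by lra.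
  by apply: e => y _; rewrite lerN2 -!enorm_sq ler_pXn2r ?nnegrE ?enorm_ge0.
exists (g i0 s), (g i0 t); split.
  apply/negP => /eqP e.
  have /is_derive_enorm_eps h := dg' i0 s.
  have z x : g i0 x = g i0 s.
    by apply/eqP; rewrite -subr_eq0 -enorm_eq0 eq_le enorm_ge0 andbT;
       apply: le_trans (hm x s) _; rewrite e subrr enorm0.
  have : 0 < enorm (dg i0 s) by rewrite enorm_gt0.
  move=> d0; have d20 : 0 < enorm (dg i0 s) / 2 by lra.
  have [r r0 hr] := h _ d20.
  have := hr (s + r / 2); rewrite (_ : s + r / 2 - s = r / 2); last by ring.
  rewrite z subrr sub0r enormN enormZ gtr0_norm; last by lra.
  have r2 : r / 2 < r by lra.
  by move=> /(_ r2); have := mulr_gt0 r0 d0; lra.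
split.
  exists i0, s; split=> //; rewrite derive1g -opprB dotvNl.
  apply/eqP; rewrite oppr_eq0; apply/eqP.
  apply: (crit (fun x => g i0 x - g i0 t)) => [|y]; last exact: hm.
  by rewrite -[X in is_derive _ _ _ X]subr0; apply: is_derive_sub.
exists i0, t; split=> //; rewrite derive1g.
apply: (crit (fun x => g i0 x - g i0 s)) => [|y]; last by rewrite enormBC (enormBC (g i0 t)).
by rewrite -[X in is_derive _ _ _ X]subr0; apply: is_derive_sub.
Qed.

Lemma NIR_fin m (g : 'I_m -> R -> V) (i0 : 'I_m) : is_link g -> exists2 r, 0 <= r & NIR g = r%:E.
Proof.
move=> lg; have [p [q dc]] := double_critical_exists i0 (link_regular lg).
have := NIR_le_half dc; have := NIR_ge0 g.
by case: (NIR g) => [r|//|//]; rewrite lee_fin => r0 _; exists r.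
Qed.

Lemma unit_lipschitz_continuous (T : R -> V) (k : R) : 0 < k ->
  (forall s t, enorm (T s - T t) <= k * `|s - t|) -> continuous T.
Proof.
move=> k0 h t; apply/cvgrPdist_le => e e0; near=> x.
apply: le_trans (normr_le_enorm _) _; apply: le_trans (h _ _) _.
rewrite -ler_pdivlMl// mulrC; near: x.
by apply: cvgr_dist_le; [exact: cvg_id|rewrite divr_gt0].
Unshelve. all: by end_near. Qed.

(** The Lipschitz constant controls short arcs and compactness the rest. The radius is found for the
    arclength parametrization [h], which [C11] relates to [g] only through the image;
    [normal_transfer] carries it over. *)
Lemma C11_normal_inj m (g : 'I_m -> R -> V) : is_link g -> C11 g ->
  exists2 r, 0 < r & normal_inj g r.
Proof.
move=> lg [l [h [C [l0 [per [c1 [h1 [inj [im Cl]]]]]]]]].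
pose T i := derive1 (h i).
have sys : unit_system h T l.
  by split=> // i t; exact: C1curve_is_derive.
pose k := `|C| + 1.
have k0 : 0 < k by rewrite /k ltr_wpDl.
have Tl i s t : enorm (T i s - T i t) <= k * `|s - t|.
  apply: le_trans (Cl i s t) _; rewrite ler_wpM2r// /k.
  by apply: le_trans (ler_norm _) _; rewrite lerDl.
have pk : 0 < pi / k by rewrite divr_gt0// pi_gt0.
have [e e0 he] := unit_system_far_positive sys pk.
pose r := Num.min (k^-1) (e / 2).
have r0 : 0 < r by rewrite lt_min invr_gt0 k0 divr_gt0.
exists r => //.
have hinj : normal_inj h r.
  apply: (unit_system_normal_inj sys k0 _ Tl).
    by rewrite -ler_pdivlMl// mulr1 ge_min lexx.
  move=> i j s t hij; apply: le_trans (he i j s t hij).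
  by rewrite mulrC -ler_pdivlMr// ge_min lexx orbT.
have im1 i t : exists j s, g i t = h j s.
  have : image_link g (g i t) by exists i, t.
  by rewrite -im => -[j [s ->]]; exists j, s.
have im2 i t : exists j s, h i t = g j s.
  have : image_link h (h i t) by exists i, t.
  by rewrite im => -[j [s ->]]; exists j, s.
have tr p v : normal_pair g r p v -> normal_pair h r p v.
  move=> [i [t [-> [vt vr]]]]; have [j [s e1]] := im1 i t.
  exists j, s; split; first exact: e1.
  split; last exact: vr.
  exact: (normal_transfer (link_regular lg) (unit_system_regular sys) im2 (esym e1) vt).
by move=> p v p' v' /tr hp /tr hp'; exact: hinj.
Qed.

Lemma NIR_gt0 m (g : 'I_m -> R -> V) : is_link g -> C11 g -> (0 < NIR g)%E.
Proof.
move=> lg cg; have [r r0 hr] := C11_normal_inj lg cg.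
by apply: lt_le_trans (NIR_ge r0 hr); rewrite lte_fin.
Qed.

Lemma unit_chord_le (g T : R -> V) : (forall t : R, is_derive t 1 g (T t)) ->
  (forall t, enorm (T t) = 1) -> forall s t, enorm (g s - g t) <= `|s - t|.
Proof.
move=> dg T1.
have main s t : t <= s -> enorm (g s - g t) <= s - t.
  move=> ts; apply: (@mean_value_enorm _ _ g T (fun x => x) (fun=> 1)) => // x _.
  - exact: is_derive_continuous (dg x).
  - exact: cvg_id.
  - by rewrite T1.
move=> s t; case: (leP t s) => [ts|/ltW st]; first by rewrite ger0_norm ?subr_ge0// main.
by rewrite enormBC distrC ger0_norm ?subr_ge0// main.
Qed.

Section Thick.
Variables (m : nat) (g T : 'I_m -> R -> V) (l : 'I_m -> R).
Hypothesis sys : unit_system g T l.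
Hypothesis Tcont : forall i, continuous (T i).
Hypothesis thick : normal_inj g 1.

(** A point of the link nearest to [x] is the foot of a normal no longer than [v], so by injectivity
    that normal is [v] itself. *)
Lemma thick_empty_ball i s (v : V) j t : dotv v (T i s) = 0 -> enorm v < 1 ->
  enorm v <= enorm (g i s + v - g j t).
Proof.
move=> vT v1; case: (sys) => l0 per dg T1 inj.
set x := g i s + v.
have cF k : continuous (fun y => enorm (x - g k y)).
  move=> y; apply: continuous_enorm; apply: cvgB; first exact: cvg_cst.
  exact: (unit_system_continuous sys).
have hmin (k : 'I_m) : exists y, forall z, enorm (x - g k y) <= enorm (x - g k z).
  have [y _ hy] := segment_min (ltW (l0 k)) (cF k).
  exists y => z; have [q /andP[q1 q2]] := period_mod 0 z (l0 k).
  rewrite -(periodic_int (per k) q z); apply: hy.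
  by rewrite q1 ltW// -[ltRHS]add0r.
have [f hf] := choice hmin.
have [k _ hk] := @arg_minP _ _ _ i xpredT (fun k => enorm (x - g k (f k))) isT.
have hall k' z : enorm (x - g k (f k)) <= enorm (x - g k' z).
  by apply: le_trans (hk k' isT) (hf k' z).
apply: le_trans (hall j t).
have wle : enorm (x - g k (f k)) <= enorm v.
  by apply: le_trans (hall i s) _; rewrite /x addrAC subrr add0r.
have d1 i' t' : derive1 (g i') t' = T i' t' by exact: unit_system_derive1 sys _ _.
have [|||_ e] := thick (p := g i s) (v := v) (p' := g k (f k)) (v' := x - g k (f k)).
- by exists i, s; rewrite d1.
- exists k, (f k); split=> //; rewrite d1; split; last exact: le_lt_trans v1.
  have := @sq_enorm_min_critical _ _ (fun y => x - g k y) (f k) (- T k (f k)) 1 ltr01.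
  rewrite dotvNr => h; apply/eqP; rewrite -oppr_eq0; apply/eqP; apply: h.
    by rewrite -sub0r; apply: is_derive_sub.
  by move=> y _; exact: hf.
- by rewrite [RHS]addrC subrK.
- by rewrite {1}e.
Qed.

(** Expand the squared inequality for the empty ball of radius [a < 1] centred at [g i s + a v], and
    let [a] tend to [1]. *)
Lemma thick_normal_part i s j t (v : V) : dotv v (T i s) = 0 -> enorm v = 1 ->
  2 * dotv (g j t - g i s) v <= enorm (g j t - g i s) ^+ 2.
Proof.
move=> vT v1; set d := g j t - g i s; set D := enorm d ^+ 2; set x := dotv d v.
have D0 : 0 <= D by rewrite sqr_ge0.
have key a : 0 <= a -> a < 1 -> 2 * a * x <= D.
  move=> a0 a1.
  have := @thick_empty_ball i s (a *: v) j t.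
  rewrite dotvZl vT mulr0 enormZ v1 mulr1 ger0_norm// => /(_ erefl a1).
  rewrite (_ : g i s + a *: v - g j t = a *: v - d); last by rewrite /d opprB addrCA addrA.
  move=> h; have {h} : a ^+ 2 <= enorm (a *: v - d) ^+ 2 by rewrite ler_pXn2r// nnegrE enorm_ge0.
  rewrite enorm_sq.
  have -> : dotv (a *: v - d) (a *: v - d) = a ^+ 2 * (enorm v ^+ 2) - 2 * a * x + D.
    rewrite /D /x enorm_sq enorm_sq; move: (d) => d'.
    by rewrite !dotvS (dotvC v d'); ring.
  rewrite v1; lra.
rewrite leNgt; apply/negP => lt.
have x0 : 0 < x by lra.
have Dx : D / (2 * x) < 1 by rewrite ltr_pdivrMr; lra.
have Dx0 : 0 <= D / (2 * x) by rewrite divr_ge0//; lra.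
(* Halfway between [1] and the radius [D / (2 x)] beyond which the ball would contain [g j t]. *)
have := key ((1 + D / (2 * x)) / 2).
have e : D / (2 * x) * (2 * x) = D by rewrite divfK//; lra.
set y := D / (2 * x) in Dx Dx0 e *.
move=> k; have : 2 * ((1 + y) / 2) * x <= D by apply: k; lra.
nra.
Qed.

(** The part of the chord normal to [T i s] is at most [D^2 / 2], so the sine of the angle between
    chord and tangent line is at most [D / 2]; the right side is the squared cosine. *)
Lemma thick_tangent_sq i s j t : let d := g j t - g i s in
  0 < enorm d -> 1 - (enorm d / 2) ^+ 2 <= ((enorm d)^-1 * dotv d (T i s)) ^+ 2.
Proof.
move=> d d0; case: (sys) => l0 per dg T1 inj.
set D := enorm d in d0 *.
pose a := dotv d (T i s); pose w := d - a *: T i s.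
have wT : dotv w (T i s) = 0.
  by rewrite /w dotvBl dotvZl -enorm_sq T1 expr1n mulr1 subrr.
have dw : dotv d w = enorm w ^+ 2.
  have -> : dotv d w = dotv (w + a *: T i s) w by rewrite /w subrK.
  by rewrite dotvDl dotvZl (dotvC (T i s)) wT mulr0 addr0 enorm_sq.
have wD : enorm w <= D ^+ 2 / 2.
  have [->|w0] := eqVneq w 0; first by rewrite enorm0; nra.
  have e0 : 0 < enorm w by rewrite enorm_gt0.
  have := @thick_normal_part i s j t ((enorm w)^-1 *: w).
  rewrite dotvZl wT mulr0 enormZ ger0_norm ?invr_ge0 ?enorm_ge0// mulVf ?gt_eqF//.
  move=> /(_ erefl erefl); rewrite -/d dotvZr dw expr2 mulKf ?gt_eqF//.
  by rewrite -/D expr2; lra.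
have pyth : D ^+ 2 = a ^+ 2 + enorm w ^+ 2.
  by rewrite -dw /w dotvBr dotvZr -enorm_sq -/D -/a; ring.
have w2 : enorm w ^+ 2 <= (D ^+ 2 / 2) ^+ 2.
  by rewrite ler_pXn2r// ?nnegrE ?enorm_ge0//; nra.
change (1 - (D / 2) ^+ 2 <= (D^-1 * a) ^+ 2).
rewrite [leRHS]exprMn exprVn [leRHS]mulrC ler_pdivlMr ?exprn_gt0//.
nra.
Qed.

(** Both tangents lie within the angle [asin (D / 2)] of the chord, the signs excluding the opposite
    direction; hence they are within twice that angle of each other, at a distance at most
    [2 sin (asin (D / 2)) = D]. *)
Lemma thick_lipschitz_local i s t : let d := g i t - g i s in
  0 < dotv d (T i s) -> 0 < dotv d (T i t) -> enorm d <= 2 ->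
  enorm (T i t - T i s) <= enorm d.
Proof.
move=> d d1 d2 dle; case: (sys) => l0 per dg T1 inj.
have d0 : 0 < enorm d.
  by rewrite enorm_gt0; apply/negP => /eqP e; rewrite e dotv0l ltxx in d1.
set D := enorm d in d0 dle *.
have Di : 0 < D^-1 by rewrite invr_gt0.
have sq (x y : R) : 0 <= y -> x <= y ^+ 2 -> Num.sqrt x <= y.
  by move=> y0 xy; rewrite -(ger0_norm y0) -sqrtr_sqr ler_wsqrtr.
have h1 : Num.sqrt (1 - (D / 2) ^+ 2) <= dotv (T i s) (D^-1 *: d).
  rewrite dotvC dotvZl; apply: sq; first by rewrite mulr_ge0// ltW.
  exact: (@thick_tangent_sq i s i t d0).
have h2 : Num.sqrt (1 - (D / 2) ^+ 2) <= dotv (D^-1 *: d) (T i t).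
  rewrite dotvZl; apply: sq; first by rewrite mulr_ge0// ltW.
  have e : g i s - g i t = - d by rewrite /d opprB.
  have := @thick_tangent_sq i t i s; rewrite /= e enormN dotvNl mulrN sqrrN; exact.
have D2 : -1 <= D / 2 <= 1 by apply/andP; split; lra.
pose th := asin (D / 2).
have sth : sin th = D / 2 by rewrite asinK// in_itv.
have thp : th <= pi / 2 by exact: asin_lepi2.
have pi0 := pi_gt0 R.
have th0 : 0 <= th.
  rewrite leNgt; apply/negP => lt.
  have : sin th < sin 0.
    rewrite ltr_sin// in_itv/=; first by rewrite thp asin_geNpi2.
    by apply/andP; split; lra.
  by rewrite sin0 sth; lra.
have cth : cos th = Num.sqrt (1 - (D / 2) ^+ 2) by exact: cos_asin.
rewrite -cth in h1 h2.
have v1 : enorm (D^-1 *: d) = 1 by rewrite enormZ gtr0_norm// mulVf ?gt_eqF.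
have := dotv_cos_add (T1 i s) v1 (T1 i t) th0 th0 _ h1 h2.
rewrite -mulr2n cos_mulr2n cos2sin2 sth (dotv_of_dist (T1 i s) (T1 i t)) enormBC => h.
rewrite -(@ler_pXn2r _ 2)// ?nnegrE ?enorm_ge0 ?(ltW d0)//.
have : 1 *+ 2 - (D / 2) ^+ 2 *+ 2 - 1 <= 1 - enorm (T i t - T i s) ^+ 2 / 2.
  by rewrite -mulrnBl h// mulr2n; lra.
by rewrite !mulr2n; lra.
Qed.

Lemma continuous_enorm_eps (f : R -> V) (t : R) : continuous_at t f ->
  forall e : R, 0 < e -> exists2 r : R, 0 < r & forall x, `|x - t| < r -> enorm (f x - f t) <= e.
Proof.
move=> cf e e0.
have cF : continuous_at t (fun x => enorm (f x - f t)).
  by apply: continuous_enorm; apply: cvgB => //; exact: cvg_cst.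
move: cF => /cvgrPdist_le /(_ _ e0)[r /= r0 hr]; exists r => // x xr.
have := hr x; rewrite /= distrC subrr enorm0 sub0r normrN => /(_ xr).
by rewrite ger0_norm ?enorm_ge0.
Qed.

Lemma thick_lipschitz i s t : enorm (T i s - T i t) <= `|s - t|.
Proof.
case: (sys) => l0 per dg T1 inj.
have T1le := unit_chord_le (dg i) (T1 i).
have loc (c : R) : exists2 r, 0 < r & forall x, `|x - c| < r -> enorm (T i x - T i c) <= `|x - c|.
  (* A quarter is small enough for the products of [d] with both end tangents to keep the sign of
     [x - c]. *)
  have e0 : 0 < 1 / 4 :> R by lra.
  have [r1 r10 h1] := is_derive_enorm_eps (dg i c) e0.
  have [r2 r20 h2] := continuous_enorm_eps (@Tcont i c) e0.
  exists (Num.min 1 (Num.min r1 r2)); first by rewrite !lt_min ltr01 r10.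
  move=> x; rewrite !lt_min => /andP[x1 /andP[xr1 xr2]].
  have k1 := h1 _ xr1; have k2 := h2 _ xr2.
  have [->|xc] := eqVneq x c; first by rewrite !subrr enorm0 normr0.
  have xc0 : 0 < `|x - c| by rewrite normr_gt0 subr_eq0.
  set d := g i x - g i c.
  have dn : enorm d <= `|x - c| by exact: T1le.
  have a1 : `|dotv d (T i c) - (x - c)| <= `|x - c| / 4.
    have -> : dotv d (T i c) - (x - c) = dotv (d - (x - c) *: T i c) (T i c).
      by rewrite [RHS]dotvBl dotvZl -enorm_sq T1 expr1n mulr1.
    by apply: le_trans (dotv_norm_le _ _) _; rewrite T1 mulr1; lra.
  have a2 : `|dotv d (T i x) - dotv d (T i c)| <= `|x - c| / 4.
    rewrite -dotvBr; apply: le_trans (dotv_norm_le _ _) _.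
    have := ler_pM (enorm_ge0 d) (enorm_ge0 (T i x - T i c)) dn k2; lra.
  move: a1 a2; rewrite !ler_norml => /andP[a1 a1'] /andP[a2 a2'].
  have dn' := dn; apply: le_trans _ dn'.
  have [cx|cx] := ltP c x.
    rewrite gtr0_norm ?subr_gt0// in a1 a1' a2 a2' dn xc0 x1.
    by apply: thick_lipschitz_local; rewrite -/d; lra.
  have {}cx : x < c by rewrite lt_def eq_sym xc.
  rewrite ltr0_norm ?subr_lt0// in a1 a1' a2 a2' dn xc0 x1.
  have ne : g i c - g i x = - d by rewrite /d opprB.
  have := @thick_lipschitz_local i x c; rewrite /= ne enormN !dotvNl enormBC; apply; lra.
have main a b : a <= b -> enorm (T i b - T i a) <= b - a.
  move=> ab; apply: (@lipschitz_chain _ _ (T i) (fun x => x)) => // c _.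
  by have [r r0 hr] := loc c; exists r => // x _; exact: hr.
case: (leP t s) => [ts|/ltW st]; first by rewrite ger0_norm ?subr_ge0// main.
by rewrite enormBC distrC ger0_norm ?subr_ge0// main.
Qed.

End Thick.

Lemma periodic_derivative (g g' : R -> V) (P : R) : (forall t : R, is_derive t 1 g (g' t)) ->
  (forall t, g (t + P) = g t) -> forall t, g' (t + P) = g' t.
Proof.
move=> dg per t.
have h : is_derive t 1 (fun x => g (x + P)) (1 *: g' (t + P)).
  apply: is_derive_comp; rewrite -[X in is_derive _ _ _ X]addr0.
  exact: is_derive_radd.
rewrite scale1r in h; apply: is_derive_unique h _.
by rewrite (_ : (fun x => _) = g); [exact: dg|apply/funext => x; rewrite per].
Qed.

Lemma periodic_bounds (f : R -> R) (P : R) : 0 < P -> continuous f ->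
  (forall t, f (t + P) = f t) ->
  exists a b, forall t, f a <= f t /\ f t <= f b.
Proof.
move=> P0 cf per.
have [a _ ha] := segment_min (ltW P0) cf; have [b _ hb] := segment_max (ltW P0) cf.
exists a, b => t; have [k /andP[k1 k2]] := period_mod 0 t P0.
have hk : 0 <= t + k%:~R * P <= P by rewrite k1 ltW// -[ltRHS]add0r.
by rewrite -(periodic_int per k t); split; [exact: ha|exact: hb].
Qed.

(** [s] is arclength divided by [r], so that reparametrizing and rescaling by [1 / r] happen in one
    step. The least speed over a period supplies the growth rate for [increasing_inverse]. *)
Lemma arclength_reparam (g g' : R -> V) (P r : R) : 0 < P -> 0 < r ->
  (forall t : R, is_derive t 1 g (g' t)) -> continuous g' -> (forall t, g' t != 0) ->
  (forall t, g (t + P) = g t) ->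
  exists s q : R -> R, [/\ s 0 = 0, cancel s q, cancel q s,
    forall t : R, is_derive t 1 s (enorm (g' t) / r) &
    forall t, s (t + P) = s t + s P] /\
    forall y : R, is_derive y 1 q (r / enorm (g' (q y))).
Proof.
move=> P0 r0 dg cg' g'0 per.
have cn : continuous (fun t => enorm (g' t) / r).
  by move=> t; apply: cvgM; [apply: continuous_enorm; exact: cg'|exact: cvg_cst].
have [s s0 ds] := antiderivative cn.
have pern t : enorm (g' (t + P)) / r = enorm (g' t) / r.
  by rewrite (periodic_derivative dg per).
have [a [amax hab]] := periodic_bounds P0 cn pern.
have c0 : 0 < enorm (g' a) / r by rewrite divr_gt0// enorm_gt0.
have [q [sq qs dq]] := increasing_inverse c0 ds (fun t => (hab t).1).
exists s, q; split; last first.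
  by move=> y; have := dq y; rewrite invf_div.
split=> // t.
have key a' b' : a' <= b' -> s (a' + P) - s a' = s (b' + P) - s b'.
  move=> ab; apply: (@derivative0_const _ (fun x => s (x + P) - s x)) => // x _.
  rewrite -(subrr (enorm (g' x) / r)); apply: is_derive_rsub.
  rewrite -[X in is_derive _ _ _ X]mulr1; apply: (@is_derive_rcomp _ s (fun x => x + P)).
    by rewrite -[X in is_derive _ _ _ X]addr0; exact: is_derive_radd.
  by rewrite -pern.
have : s (t + P) - s t = s (0 + P) - s 0.
  by case: (leP t 0) => [|/ltW] /key ->.
by rewrite add0r s0 subr0; lra.
Qed.

Lemma link_unit_system m (g : 'I_m -> R -> V) (r : R) : is_link g -> 0 < r ->
  exists (c T : 'I_m -> R -> V) (l : 'I_m -> R) (s q : 'I_m -> R -> R),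
  [/\ unit_system c T l, forall i, continuous (T i),
      forall i t, g i t = r *: c i (s i t) &
      forall i t, derive1 (g i) t = enorm (derive1 (g i) t) *: T i (s i t)] /\
  [/\ forall i (t : R), is_derive t 1 (s i) (enorm (derive1 (g i) t) / r),
      forall i, s i 0 = 0, forall i t, s i (t + 1) = s i t + l i,
      forall i, cancel (s i) (q i) & forall i, cancel (q i) (s i)].
Proof.
move=> lg r0; have [_ per dg g'0 inj] := link_regular lg.
have c1 i : continuous (derive1 (g i)) by case: lg => _ [/(_ i)[]].
have h i := arclength_reparam ltr01 r0 (dg i) (c1 i) (g'0 i) (per i).
have {}h (i : 'I_m) : exists sq : (R -> R) * (R -> R), [/\ sq.1 0 = 0, cancel sq.1 sq.2, cancel sq.2 sq.1,
    forall t : R, is_derive t 1 sq.1 (enorm (derive1 (g i) t) / r) &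
    forall t, sq.1 (t + 1) = sq.1 t + sq.1 1] /\
    forall y : R, is_derive y 1 sq.2 (r / enorm (derive1 (g i) (sq.2 y))).
  by have [s [q ?]] := h i; exists (s, q).
have [sq hsq] := choice h.
pose s i := (sq i).1; pose q i := (sq i).2.
have s0 i : s i 0 = 0 by case: (hsq i) => -[].
have sK i : cancel (s i) (q i) by case: (hsq i) => -[].
have qK i : cancel (q i) (s i) by case: (hsq i) => -[].
have ds i (t : R) : is_derive t 1 (s i) (enorm (derive1 (g i) t) / r) by case: (hsq i) => -[].
have sp i t : s i (t + 1) = s i t + s i 1 by case: (hsq i) => -[_ _ _ _ h'] _; exact: h'.
have dq i (y : R) : is_derive y 1 (q i) (r / enorm (derive1 (g i) (q i y))) by case: (hsq i).
have en0 i t : enorm (derive1 (g i) t) != 0 by rewrite enorm_eq0 g'0.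
have r0' : r != 0 by rewrite gt_eqF.
exists (fun i x => r^-1 *: g i (q i x)), (fun i x => (enorm (derive1 (g i) (q i x)))^-1 *: derive1 (g i) (q i x)),
  (fun i => s i 1), s, q.
have qp i x : q i (x + s i 1) = q i x + 1.
  by apply: (can_inj (sK i)); rewrite qK sp qK.
split; last by split.
split.
- split.
  + move=> i.
    have := @derivative_gt0_lt _ (s i) (fun t => enorm (derive1 (g i) t) / r) 0 1 ltr01.
    rewrite s0; apply => x _.
    * exact: is_derive_rcontinuous (ds i x).
    * by rewrite divr_gt0// enorm_gt0.
  + by move=> i x; rewrite qp per.
  + move=> i x.
    have := is_derive_scalel r^-1 (is_derive_comp (dq i x) (dg i (q i x))).
    rewrite scalerA; congr (is_derive _ _ _ (_ *: _)).
    by field; rewrite r0' en0.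
  + by move=> i x; rewrite enormZ ger0_norm ?invr_ge0 ?enorm_ge0// mulVf.
  + move=> i j x y /(scalerI (invr_neq0 r0')) /inj[ij [k e]]; split=> //; subst j; exists k.
    have sk z : s i (z + k%:~R) = s i z + k%:~R * s i 1.
      pose f z := s i z - z * s i 1.
      have fp z' : f (z' + 1) = f z' by rewrite /f sp; ring.
      by have := periodic_int fp k z; rewrite mulr1 /f; lra.
    by rewrite -(qK i x) e mulr1 sk qK.
- move=> i x.
  have cq : continuous_at x (q i) by exact: is_derive_rcontinuous (dq i x).
  have cD : continuous_at x (fun y => derive1 (g i) (q i y)).
    by apply: (@continuous_comp _ _ _ (q i) (derive1 (g i))) => //; exact: c1.
  have cE := continuous_enorm cD.
  exact: (cvgZ (cvgV (en0 i (q i x)) cE) cD).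
- by move=> i t; rewrite scalerA mulfV// scale1r sK.
- by move=> i t; rewrite scalerA sK mulfV// scale1r.
Qed.

End Reparametrization.

(** Completeness of row vectors, for the Banach fixed point theorem in [contraction_solve]. *)
HB.instance Definition _ (R : realType) (n : nat) := Complete.on 'rV[R]_n.

(** * Isotopies from small perturbations *)

Section C1Functions.
Variables (R : realType) (V : normedModType R).

Lemma continuous_const (T W : topologicalType) (c : W) (x : T) : continuous_at x (fun=> c).
Proof. exact: cvg_cst. Qed.

(** Asks for full differentiability, which composes, where [C1map] speaks of directional
    derivatives. *)
Definition C1fun (W : normedModType R) (f : V -> W) : Prop :=
  (forall x, differentiable f x) /\ forall v, continuous (fun x => 'd f x v).

Lemma C1fun_const (W : normedModType R) (c : W) : C1fun (fun=> c).
Proof.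
split=> [x|v x]; first exact: differentiable_cst.
rewrite [X in continuous_at _ X](_ : _ = cst 0); first exact: continuous_const.
by apply/funext => y; exact: (congr1 (@^~ v) (diff_cst c y)).
Qed.

Lemma C1fun_add (W : normedModType R) (f g : V -> W) : C1fun f -> C1fun g ->
  C1fun (fun x => f x + g x).
Proof.
move=> [df cf] [dg cg]; split=> [x|v x]; first exact: differentiableD.
rewrite [X in continuous_at _ X](_ : _ = (fun x => 'd f x v + 'd g x v)); first exact: cvgD (cf v x) (cg v x).
by apply/funext => y; exact: (congr1 (@^~ v) (diffD (df y) (dg y))).
Qed.

Lemma C1fun_sum (W : normedModType R) (I : Type) (r : seq I) (f : I -> V -> W) :
  (forall i, C1fun (f i)) -> C1fun (fun x => \sum_(i <- r) f i x).
Proof.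
move=> h; elim: r => [|i r IH].
  by rewrite (_ : (fun x => _) = fun=> 0); [exact: C1fun_const|apply/funext => x; rewrite big_nil].
rewrite (_ : (fun x => _) = fun x => f i x + \sum_(i <- r) f i x); first exact: C1fun_add.
by apply/funext => x; rewrite big_cons.
Qed.

Lemma C1fun_mul (f g : V -> R) : C1fun f -> C1fun g -> C1fun (fun x => f x * g x).
Proof.
move=> [df cf] [dg cg]; split=> [x|v x]; first exact: differentiableM.
rewrite [X in continuous_at _ X](_ : _ = (fun x => f x * 'd g x v + g x * 'd f x v)); last first.
  by apply/funext => y; exact: (congr1 (@^~ v) (diffM (df y) (dg y))).
by apply: cvgD; apply: cvgM; [exact: differentiable_continuous|exact: cg|exact: differentiable_continuous|exact: cf].
Qed.

Lemma C1fun_scale (f : V -> R) (W : normedModType R) (c : W) : C1fun f -> C1fun (fun x => f x *: c).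
Proof.
move=> [df cf]; split=> [x|v x]; first exact: differentiableZl.
rewrite [X in continuous_at _ X](_ : _ = (fun x => 'd f x v *: c)); last first.
  by apply/funext => y; exact: (congr1 (@^~ v) (diffZl c (df y))).
by apply: cvgZr_tmp; exact: cf.
Qed.

Lemma C1fun_comp (f : V -> R) (p p' : R -> R) : C1fun f ->
  (forall t : R, is_derive t 1 p (p' t)) -> continuous p' -> C1fun (fun x => p (f x)).
Proof.
move=> [df cf] dp cp'.
have dp' t : differentiable p t by apply/derivable1_diffP; case: (dp t).
split=> [x|v x]; first exact: differentiable_comp.
rewrite [X in continuous_at _ X](_ : _ = (fun x => 'd f x v * p' (f x))); last first.
  apply/funext => y; rewrite (congr1 (@^~ v) (diff_comp (df y) (dp' (f y)))) /=.
  by rewrite diff1E// (derive1E p) (@derive_val _ _ _ _ _ _ _ (dp (f y))).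
apply: cvgM; first exact: cf.
apply: (@continuous_comp _ _ _ f p'); last exact: cp'.
exact: differentiable_continuous.
Qed.

Lemma differentiable_epsP (W : normedModType R) (f : V -> W) (x : V) : differentiable f x ->
  forall e : R, 0 < e -> exists2 r : R, 0 < r &
    forall h, `|h| < r -> `|f (h + x) - f x - 'd f x h| <= e * `|h|.
Proof.
move=> /diff_locallyP [_ /eqaddoP h] e e0.
have /nbhs_normP[r /= r0 hr] := h e e0; exists r => // k kr.
have := hr k; rewrite /= sub0r normrN => /(_ kr); rewrite /= opprD addrA.
exact.
Qed.

Lemma C1fun_scalel (W : normedModType R) (k : R) (f : V -> W) : C1fun f -> C1fun (fun x => k *: f x).
Proof.
move=> [df cf]; split=> [x|v x]; first exact: differentiableZ.
rewrite [X in continuous_at _ X](_ : _ = (fun x => k *: 'd f x v)); last first.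
  by apply/funext => y; exact: (congr1 (@^~ v) (diffZ k (df y))).
by apply: cvgZl_tmp; exact: cf.
Qed.

End C1Functions.

(** * Inverting the identity plus a contraction *)

Section Perturbation.
Variables (R : realType) (V : completeNormedModType R).
Variable psi : V -> V.
Hypothesis psiC1 : C1fun psi.
Hypothesis psil : forall x y, `|psi x - psi y| <= 2^-1 * `|x - y|.

Lemma contraction_solve (f : V -> V) (y : V) : (forall x x', `|f x - f x'| <= 2^-1 * `|x - x'|) ->
  exists x, x + f x = y.
Proof.
move=> fl.
have fT : set_fun [set: V] [set: V] (fun x => y - f x) by [].
have [|||p _ pe] := @banach_fixed_point R V setT (mkfun fT).
- exists (2^-1)%:nng => /=; split; first by rewrite invf_lt1// ltr1n.
  move=> [a b] _ /=; rewrite /mkfun opprB addrC subrKA distrC.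
  exact: fl.
- exact: closedT.
- by exists 0.
by exists p; rewrite {1}pe /= subrK.
Qed.

Definition perturb_inv (y : V) : V := projT1 (cid (contraction_solve y psil)).

Lemma perturb_invK y : perturb_inv y + psi (perturb_inv y) = y.
Proof. by rewrite /perturb_inv; case: cid. Qed.

Lemma perturb_expand (f : V -> V) x y : (forall x x', `|f x - f x'| <= 2^-1 * `|x - x'|) ->
  `|x - y| <= 2 * `|(x + f x) - (y + f y)|.
Proof.
move=> fl; have := fl x y; have := ler_normB ((x + f x) - (y + f y)) (f x - f y).
rewrite (_ : _ - (f x - f y) = x - y); last by rewrite opprD addrACA addrK.
lra.
Qed.

Lemma perturb_inv_cancel : cancel (fun x => x + psi x) perturb_inv.
Proof.
move=> x; apply/eqP; rewrite -subr_eq0 -normr_le0.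
by apply: le_trans (perturb_expand _ _ psil) _; rewrite perturb_invK subrr normr0 mulr0.
Qed.

Lemma diff_psi_bound x v : `|'d psi x v| <= 2^-1 * `|v|.
Proof.
have [->|v0] := eqVneq v 0; first by rewrite linear0 !normr0 mulr0.
have nv : 0 < `|v| by rewrite normr_gt0.
apply/ler_addgt0Pl => e e0.
have e'0 : 0 < e / `|v| by rewrite divr_gt0.
have [r r0 hr] := differentiable_epsP (psiC1.1 x) e'0.
pose t := r / 2 / `|v|.
have t0 : 0 < t by rewrite /t !divr_gt0.
have tv : t * `|v| = r / 2 by rewrite /t divfK// gt_eqF.
have := hr (t *: v); rewrite normrZ (gtr0_norm t0) tv => /(_ _).
have rr : r / 2 < r by lra.
move=> /(_ rr); rewrite linearZ/= => h.
have h2 := psil (t *: v + x) x; rewrite addrK normrZ (gtr0_norm t0) in h2.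
have h3 : t * `|'d psi x v| <= e / `|v| * (r / 2) + 2^-1 * (t * `|v|).
  have := ler_normB (psi (t *: v + x) - psi x) (psi (t *: v + x) - psi x - t *: 'd psi x v).
  rewrite opprB addrC subrK normrZ (gtr0_norm t0).
  lra.
rewrite -(ler_pM2l t0); apply: le_trans h3 _.
rewrite mulrDr -tv mulrCA divfK ?gt_eqF//.
lra.
Qed.

(** The inverse of [1 + 'd psi x], by the same fixed point; the [eq_ind] term uses linearity to read
    [diff_psi_bound] as a Lipschitz bound. *)
Definition perturb_dinv (x v : V) : V :=
  projT1 (cid (contraction_solve v (fun a b : V =>
    eq_ind ('d psi x (a - b)) (fun z => `|z| <= 2^-1 * `|a - b|) (diff_psi_bound x (a - b)) _ (linearB ('d psi x) a b)))).

Lemma perturb_dinvK x v : perturb_dinv x v + 'd psi x (perturb_dinv x v) = v.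
Proof. by rewrite /perturb_dinv; case: cid. Qed.

Lemma diff_psi_expand x u : `|u| <= 2 * `|u + 'd psi x u|.
Proof.
have := diff_psi_bound x u; have := ler_normB (u + 'd psi x u) ('d psi x u).
by rewrite addrK; lra.
Qed.

(** With [k] the increment of the inverse, [1 + 'd psi x] maps [k - h *: u] to the linearization
    error of [psi] at [x], which is small against [|k|]; and [|k|] is at most [2 |h| |v|], both
    because [psi] contracts by one half. *)
Lemma perturb_inv_derivative y v :
  (fun h => h^-1 *: ((perturb_inv \o shift y) (h *: v) - perturb_inv y)) @ 0^' -->
  perturb_dinv (perturb_inv y) v.
Proof.
set x := perturb_inv y; set u := perturb_dinv x v.
apply/cvgrPdist_le => e e0.
have e'0 : 0 < e / (4 * (`|v| + 1)) by rewrite divr_gt0// mulr_gt0// ltr_wpDl.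
have [r r0 hr] := differentiable_epsP (psiC1.1 x) e'0.
exists (r / (2 * (`|v| + 1))) => /=; first by rewrite divr_gt0// mulr_gt0// ltr_wpDl.
move=> h /=; rewrite sub0r normrN ltr_pdivlMr ?mulr_gt0 ?ltr_wpDl// => hh h0.
set x' := perturb_inv (h *: v + y); set k := x' - x.
have e1 : k + (psi x' - psi x) = h *: v.
  have a1 := perturb_invK (h *: v + y); have a2 := perturb_invK y.
  rewrite -/x' in a1; rewrite -/x in a2.
  by rewrite /k addrACA -opprD a1 a2 addrK.
have k1 : `|k| <= 2 * (`|h| * `|v|).
  rewrite -normrZ -e1.
  apply: le_trans (perturb_expand x' x psil) _.
  by rewrite opprD addrACA.
have kr : `|k| < r.
  apply: le_lt_trans k1 _; apply: le_lt_trans hh.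
  rewrite mulrCA ler_wpM2l// mulrDr mulr1.
  lra.
have := hr k kr; rewrite {1}/k subrK => h2.
have e2 : (k - h *: u) + 'd psi x (k - h *: u) = - (psi x' - psi x - 'd psi x k).
  have -> : 'd psi x (k - h *: u) = 'd psi x k - h *: 'd psi x u by rewrite linearB linearZ.
  by rewrite addrACA -opprD -scalerDr perturb_dinvK -e1 opprD addrACA subrr add0r [RHS]opprB.
have h3 : `|k - h *: u| <= 2 * (e / (4 * (`|v| + 1)) * `|k|).
  apply: le_trans (diff_psi_expand x _) _; rewrite e2 normrN.
  by rewrite ler_wpM2l.
have -> : u - h^-1 *: (x' - x) = - (h^-1 *: (k - h *: u)).
  by rewrite [in RHS]scalerBr scalerA mulVf// scale1r opprB.
rewrite normrN normrZ normfV mulrC ler_pdivrMr ?normr_gt0//.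
apply: le_trans h3 _.
have b : 0 < 4 * (`|v| + 1) by rewrite mulr_gt0// ltr_wpDl.
have : e / (4 * (`|v| + 1)) * `|k| <= e / (4 * (`|v| + 1)) * (2 * (`|h| * (`|v| + 1))).
  rewrite ler_wpM2l ?(ltW e'0)//; apply: le_trans k1 _; rewrite ler_wpM2l// ler_wpM2l//.
  by rewrite lerDl.
have -> : e / (4 * (`|v| + 1)) * (2 * (`|h| * (`|v| + 1))) = e * `|h| / 2.
  by field; rewrite gt_eqF// ltr_wpDl.
lra.
Qed.

Lemma perturb_inv_continuous : continuous perturb_inv.
Proof.
move=> y; apply/cvgrPdist_le => e e0; near=> z.
apply: le_trans (perturb_expand _ _ psil) _; rewrite !perturb_invK -ler_pdivlMl//.
near: z; apply: cvgr_dist_le; first exact: cvg_id.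
by rewrite mulr_gt0// invr_gt0.
Unshelve. all: by end_near. Qed.

Lemma perturb_dinv_continuous v : continuous (fun y => perturb_dinv (perturb_inv y) v).
Proof.
move=> y; apply/cvgrPdist_le => e e0.
set u := perturb_dinv (perturb_inv y) v.
have c : continuous_at y (fun z => 'd psi (perturb_inv z) u).
  apply: (@continuous_comp _ _ _ perturb_inv (fun x => 'd psi x u)).
    exact: perturb_inv_continuous.
  exact: psiC1.2.
have e20 : 0 < 2^-1 * e by rewrite mulr_gt0// invr_gt0.
move: c => /cvgrPdist_le/(_ _ e20) c.
apply: filterS c => z hz.
set x' := perturb_inv z; set u' := perturb_dinv x' v.
apply: le_trans (diff_psi_expand x' _) _; rewrite -ler_pdivlMl//.
have a1 := perturb_dinvK (perturb_inv y) v; have a2 := perturb_dinvK x' v.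
rewrite -/u in a1; rewrite -/u' in a2.
rewrite linearB/= addrACA -opprD a2 -{}a1 opprD addrACA subrr add0r.
by rewrite distrC; exact: hz.
Qed.

End Perturbation.

(** * Ambient diffeomorphisms and the isotopy *)

Section Diffeo.
Variables (R : realType) (n : nat).
Notation V := 'rV[R]_n.

Lemma C1fun_coord (i : 'I_n) : C1fun (fun x : V => x 0 i).
Proof.
split=> [x|v x]; first exact: differentiable_coord.
rewrite [X in continuous_at _ X](_ : _ = cst (v 0 i)); first exact: continuous_const.
apply/funext => y.
have @f : {linear V -> R}.
  by exists (fun N : V => N 0 i); do 2![eexists]; do ?[constructor];
     rewrite ?mxE// => ? *; rewrite ?mxE//; move=> ?; rewrite !mxE.
by rewrite (_ : (fun x : V => x 0 i) = f)// diff_lin//; exact: coord_continuous.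
Qed.

Lemma C1fun_dotv (c : V) : C1fun (fun x : V => dotv x c).
Proof.
rewrite (_ : (fun x => _) = fun x : V => \sum_i x 0 i * c 0 i); last by apply/funext => x; rewrite dotvE.
by apply: C1fun_sum => i; apply: C1fun_mul; [exact: C1fun_coord|exact: C1fun_const].
Qed.

Lemma C1fun_sqdist (c : V) : C1fun (fun x : V => dotv (x - c) (x - c)).
Proof.
rewrite (_ : (fun x => _) = fun x : V => \sum_i (x 0 i + (- c) 0 i) * (x 0 i + (- c) 0 i)); last first.
  by apply/funext => x; rewrite dotvE; apply: eq_bigr => i _; rewrite !mxE.
apply: C1fun_sum => i.
by apply: C1fun_mul; apply: C1fun_add; [exact: C1fun_coord|exact: C1fun_const|exact: C1fun_coord|exact: C1fun_const].
Qed.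

Lemma C1fun_rowP (f : V -> V) : (forall i, C1fun (fun x => f x 0 i)) -> C1fun f.
Proof.
move=> h; rewrite (_ : f = fun x => \sum_i f x 0 i *: delta_mx 0 i).
  by apply: C1fun_sum => i; exact: C1fun_scale.
by apply/funext => x; exact: row_sum_delta.
Qed.

Lemma perturb_C1diffeo (psi : V -> V) (psiC1 : C1fun psi)
    (psil : forall x y, `|psi x - psi y| <= 2^-1 * `|x - y|) :
  C1diffeo (fun x => x + psi x).
Proof.
exists (perturb_inv psil); split; first exact: perturb_inv_cancel.
split; first by move=> y; exact: perturb_invK.
split.
- have [d c] : C1fun (fun x => x + psi x).
    exact: (C1fun_add (C1fun_rowP (f := fun x => x) C1fun_coord) psiC1).
  split=> [x v|v]; first exact: diff_derivable.
  rewrite [X in continuous X](_ : _ = fun x => 'd (fun x => x + psi x) x v); first exact: c.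
  by apply/funext => x; rewrite deriveE.
- split=> [y v|v].
    by apply/cvg_ex; exists (perturb_dinv psiC1 psil (perturb_inv psil y) v); exact: perturb_inv_derivative.
  rewrite [X in continuous X](_ : _ = fun y => perturb_dinv psiC1 psil (perturb_inv psil y) v).
    exact: perturb_dinv_continuous.
  by apply/funext => y; apply: cvg_lim => //; exact: perturb_inv_derivative.
Qed.


Lemma perturb_isotopy m (g h : 'I_m -> R -> V) (psi : V -> V) : C1fun psi ->
  (forall x y, `|psi x - psi y| <= 2^-1 * `|x - y|) ->
  (forall i t, h i t = g i t + psi (g i t)) -> same_link_class g h.
Proof.
move=> psiC1 psil hg.
(* [same_link_class] asks for a diffeomorphism at every real time, so the factor must stay in
   [[0, 1]] for all [t], besides being [0] at [0] and [1] at [1]. *)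
pose cl (t : R) : R := sin (t * (pi / 2)) * sin (t * (pi / 2)).
have cl01 t : 0 <= cl t <= 1.
  rewrite /cl -expr2 sqr_ge0/= sin2cos2 gerBl sqr_ge0//.
have ccl : continuous cl.
  move=> t; have c : continuous_at t (fun t : R => sin (t * (pi / 2))).
    apply: (@continuous_comp _ _ _ (fun t : R => t * (pi / 2)) sin); last exact: continuous_sin.
    by apply: cvgM; [exact: cvg_id|exact: cvg_cst].
  exact: (cvgM c c).
have cpsi : continuous psi by move=> x; exact: differentiable_continuous (psiC1.1 x).
exists (fun t x => x + cl t *: psi x); split.
  move=> t; apply: (@perturb_C1diffeo (fun x => cl t *: psi x)).
    exact: C1fun_scalel.
  move=> x y; rewrite -scalerBr normrZ; have /andP[a b] := cl01 t.
  rewrite (ger0_norm a); apply: le_trans (psil x y).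
  by rewrite ler_piMl.
split.
  move=> [t x]; apply: cvgD; first exact: cvg_snd.
  apply: cvgZ.
    by apply: (@continuous_comp _ _ _ fst cl); [exact: cvg_fst|exact: ccl].
  by apply: (@continuous_comp _ _ _ snd psi); [exact: cvg_snd|exact: cpsi].
split.
  by move=> x; rewrite /cl !mul0r sin0 mul0r scale0r addr0.
have cl1 : cl 1 = 1 by rewrite /cl !mul1r sin_pihalf mul1r.
apply/seteqP; split=> [y [x [i [t ->]] <-]|y [i [t ->]]].
  by exists i, t; rewrite cl1 scale1r hg.
by exists (g i t); [exists i, t|rewrite cl1 scale1r hg].
Qed.

End Diffeo.

(** * Extending a variation of one component to the ambient space *)

Section Extension.
Variables (R : realType) (n : nat).
Notation V := 'rV[R]_n.

Lemma bounded_derivative_enorm (f f' : R -> V) (K : R) :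
  (forall t : R, is_derive t 1 f (f' t)) -> (forall t, enorm (f' t) <= K) ->
  forall s t, enorm (f s - f t) <= K * `|s - t|.
Proof.
move=> df fK.
have main s t : t <= s -> enorm (f s - f t) <= K * (s - t).
  move=> ts; rewrite mulrBr.
  apply: (@mean_value_enorm _ _ f f' (fun x => K * x) (fun=> K)) => // x _.
  - exact: is_derive_continuous (df x).
  - by apply: cvgM; [exact: cvg_cst|exact: cvg_id].
  - have := is_derive_rmul (is_derive_rconst K x) (is_derive_rid x); by rewrite mul0r add0r mulr1.
move=> s t; case: (leP t s) => [ts|/ltW st]; first by rewrite ger0_norm ?subr_ge0// main.
by rewrite enormBC distrC ger0_norm ?subr_ge0// main.
Qed.

Lemma bounded_derivative_lipschitz (f f' : R -> R) (K : R) :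
  (forall t : R, is_derive t 1 f (f' t)) -> (forall t, `|f' t| <= K) ->
  forall s t, `|f s - f t| <= K * `|s - t|.
Proof.
move=> df fK.
have main s t : t <= s -> `|f s - f t| <= K * (s - t).
  rewrite le_eqVlt => /predU1P[->|ts]; first by rewrite !subrr normr0 mulr0.
  have [c _ ->] := derivative_mvt ts (fun x _ => is_derive_rcontinuous (df x)) (fun x _ => df x).
  by rewrite normrM (gtr0_norm (x := s - t)) ?subr_gt0// ler_pM2r ?subr_gt0.
move=> s t; case: (leP t s) => [ts|/ltW st]; first by rewrite (ger0_norm (x := s - t)) ?subr_ge0// main.
by rewrite distrC (distrC s) (ger0_norm (x := t - s)) ?subr_ge0// main.
Qed.

(** The squared positive part: a [C^1] cutoff, as smooth as [C1diffeo] asks for. *)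
Definition possq : R -> R := glue_at 0 (fun=> 0) (fun x => x * x).
Definition possq' : R -> R := glue_at 0 (fun=> 0) (fun x => 2 * x).

Lemma possq_derive (x : R) : is_derive x 1 possq (possq' x).
Proof.
apply: is_derive_glue; rewrite ?mulr0// => _.
apply: (is_derive_eq (is_derive_rmul (is_derive_rid x) (is_derive_rid x))).
ring.
Qed.

Lemma possq'_continuous : continuous possq'.
Proof.
move=> x; apply: continuous_glue; rewrite ?mulr0// => _; first exact: cvg_cst.
by apply: cvgM; [exact: cvg_cst|exact: cvg_id].
Qed.

Lemma possq_ge0 x : 0 <= possq x.
Proof. by rewrite /possq /glue_at; case: ifP => // _; rewrite -expr2 sqr_ge0. Qed.

Lemma possq_gt0 x : 0 < x -> 0 < possq x.
Proof. by move=> x0; rewrite /possq /glue_at ifF ?mulr_gt0//; apply/negbTE; rewrite -ltNge. Qed.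

Lemma possq_le0 x : x <= 0 -> possq x = 0.
Proof. by move=> x0; rewrite /possq /glue_at x0. Qed.

Definition bump (rho : R) (c y : V) : R := possq (rho ^+ 2 - dotv (y - c) (y - c)).

Lemma bump_ge0 rho c y : 0 <= bump rho c y.
Proof. exact: possq_ge0. Qed.

Lemma bump_gt0 rho c y : 0 < rho -> enorm (y - c) < rho -> 0 < bump rho c y.
Proof.
move=> r0 h; apply: possq_gt0; rewrite subr_gt0 -enorm_sq ltr_pXn2r// nnegrE ?enorm_ge0//.
exact: ltW.
Qed.

Lemma bump_supp rho c y : 0 < rho -> bump rho c y != 0 -> enorm (y - c) < rho.
Proof.
move=> r0; apply: contraNT; rewrite -leNgt => h; apply/eqP/possq_le0.
by rewrite subr_le0 -enorm_sq ler_pXn2r// nnegrE ?enorm_ge0// ltW.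
Qed.

Lemma bump_le rho c y : bump rho c y <= rho ^+ 4.
Proof.
rewrite /bump /possq /glue_at; case: ifP => [_|/negbT]; first by rewrite exprn_even_ge0.
rewrite -ltNge => h; have := dotvv_ge0 (y - c).
move: (dotv _ _) h => d h d0.
have -> : rho ^+ 4 = rho ^+ 2 * rho ^+ 2 by rewrite -exprD.
by apply: ler_pM; lra.
Qed.

Lemma bump_lipschitz rho c y z : 0 < rho ->
  `|bump rho c y - bump rho c z| <= 4 * rho ^+ 3 * enorm (y - z).
Proof.
move=> r0; pose B x := possq (rho ^+ 2 - x * x).
pose B' x := possq' (rho ^+ 2 - x * x) * - (2 * x).
have dB (x : R) : is_derive x 1 B (B' x).
  apply: is_derive_rcomp; last exact: possq_derive.
  have := is_derive_rsub (is_derive_rconst (rho ^+ 2) x) (is_derive_rmul (is_derive_rid x) (is_derive_rid x)).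
  by move=> h; apply: is_derive_eq h _; ring.
have B'le x : `|B' x| <= 4 * rho ^+ 3.
  rewrite /B' /possq' /glue_at; case: ifP => [_|/negbT].
    by rewrite mul0r normr0 mulr_ge0// exprn_ge0// ltW.
  rewrite -ltNge => h; rewrite normrM normrN (normrM 2 x) (gtr0_norm (x := 2))//.
  rewrite gtr0_norm ?mulr_gt0//.
  have xr : `|x| <= rho.
    rewrite -(@ler_pXn2r _ 2)// ?nnegrE ?(ltW r0)// real_normK ?num_real// expr2; lra.
  have n0 : 0 <= `|x| by [].
  have : (rho ^+ 2 - x * x) * `|x| <= rho ^+ 2 * rho.
    apply: ler_pM => //; first by lra.
    by rewrite gerBl -expr2 sqr_ge0.
  by rewrite (exprSr rho 2); lra.
have e w : bump rho c w = B (enorm (w - c)) by rewrite /bump /B -expr2 enorm_sq.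
rewrite !e; apply: le_trans (bounded_derivative_lipschitz dB B'le _ _) _.
rewrite ler_wpM2l//; first by rewrite mulr_ge0// exprn_ge0// ltW.
rewrite ler_norml; apply/andP; split.
  rewrite lerNl opprB; apply: le_trans (enorm_lerB _ _) _.
  by rewrite opprB addrA subrK enormBC.
apply: le_trans (enorm_lerB _ _) _.
by rewrite opprB addrA subrK.
Qed.

Lemma C1fun_bump rho c : C1fun (bump rho c).
Proof.
apply: (@C1fun_comp _ _ (fun y => dotv (y - c) (y - c)) (fun x => possq (rho ^+ 2 - x))
   (fun x => possq' (rho ^+ 2 - x) * - 1)).
- exact: C1fun_sqdist.
- move=> t; apply: is_derive_rcomp; last exact: possq_derive.
  have := is_derive_rsub (is_derive_rconst (rho ^+ 2) t) (is_derive_rid t).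
  by rewrite sub0r.
- move=> t; apply: cvgM; last exact: cvg_cst.
  apply: (@continuous_comp _ _ _ (fun x => rho ^+ 2 - x) possq'); last exact: possq'_continuous.
  by apply: cvgB; [exact: cvg_cst|exact: cvg_id].
Qed.

Lemma is_derive_bump rho c (g T : R -> V) (t : R) : is_derive t 1 g (T t) ->
  is_derive t 1 (fun x => bump rho c (g x))
    (possq' (rho ^+ 2 - dotv (g t - c) (g t - c)) * - (2 * dotv (g t - c) (T t))).
Proof.
move=> dg; apply: is_derive_rcomp; last exact: possq_derive.
have d : is_derive t 1 (fun x => g x - c) (T t).
  by rewrite -[T t]subr0; exact: is_derive_sub.
apply: (is_derive_eq (is_derive_rsub (is_derive_rconst (rho ^+ 2) t) (is_derive_dotv d d))).
by rewrite (dotvC (T t)); ring.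
Qed.

Lemma is_derive_rsum (I : Type) (r : seq I) (f f' : I -> R -> R) (t : R) :
  (forall i, is_derive t 1 (f i) (f' i t)) ->
  is_derive t 1 (fun x => \sum_(i <- r) f i x) (\sum_(i <- r) f' i t).
Proof.
move=> h; elim: r => [|i r IH].
  rewrite big_nil (_ : (fun x => _) = fun=> 0); first exact: is_derive_rconst.
  by apply/funext => x; rewrite big_nil.
rewrite big_cons (_ : (fun x => _) = fun x => f i x + \sum_(i <- r) f i x).
  exact: is_derive_radd.
by apply/funext => x; rewrite big_cons.
Qed.

Lemma continuous_rsum (T : topologicalType) (I : Type) (r : seq I) (f : I -> T -> R) (t : T) :
  (forall i, continuous_at t (f i)) -> continuous_at t (fun x => \sum_(i <- r) f i x).
Proof.
move=> h; elim: r => [|i r IH].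
  rewrite (_ : (fun x => _) = fun=> 0); first exact: cvg_cst.
  by apply/funext => x; rewrite big_nil.
rewrite (_ : (fun x => _) = fun x => f i x + \sum_(i <- r) f i x); first exact: (cvgD (h i) IH).
by apply/funext => x; rewrite big_cons.
Qed.

Lemma continuous_scale (T : topologicalType) (a : T -> R) (f : T -> V) (t : T) :
  continuous_at t a -> continuous_at t f -> continuous_at t (fun x => a x *: f x).
Proof. exact: cvgZ. Qed.

Lemma continuous_vadd (T : topologicalType) (f g : T -> V) (t : T) :
  continuous_at t f -> continuous_at t g -> continuous_at t (fun x => f x + g x).
Proof. exact: cvgD. Qed.

Lemma continuous_vsub (T : topologicalType) (f g : T -> V) (t : T) :
  continuous_at t f -> continuous_at t g -> continuous_at t (fun x => f x - g x).
Proof. exact: cvgB. Qed.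

Variables (m : nat) (g T : 'I_m -> R -> V) (l : 'I_m -> R).
Hypothesis sys : unit_system g T l.
Hypothesis Tl : forall i s t, enorm (T i s - T i t) <= `|s - t|.

Lemma unit_system_isolation : exists2 rho, 0 < rho & forall i j s t,
  enorm (g j t - g i s) < rho -> i = j /\ exists k : int, `|t + k%:~R * l i - s| < 1.
Proof.
case: (sys) => l0 per dg T1 inj.
have [rho rho0 h] := unit_system_far_positive sys (@ltr01 R).
exists rho => // i j s t lt.
have [ij|ij] := eqVneq i j; last first.
  by have := h i j s t (or_introl ij); rewrite enormBC leNgt lt.
subst j; split=> //.
have [k /andP[k1 k2]] := period_mod s t (l0 i).
have [c1|c1] := ltP (t + k%:~R * l i) (s + 1).
  by exists k; rewrite ger0_norm; lra.
have [c2|c2] := ltP (s + l i - 1) (t + k%:~R * l i).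
  exists (k - 1); rewrite intrD mulrNz mulr1z [(_ + -1) * _]mulrDl mulN1r.
  by rewrite ltr0_norm; lra.
have hr : 1 <= (t + k%:~R * l i) - s <= l i - 1 by apply/andP; split; lra.
have := h i i s (t + k%:~R * l i) (or_intror (conj erefl hr)).
by rewrite enormBC (periodic_int (per i)) leNgt lt.
Qed.

Lemma unit_system_T_continuous i : continuous (T i).
Proof.
apply: (@unit_lipschitz_continuous _ _ _ 1) => // s t.
by rewrite mul1r.
Qed.

(* tau inverts the orthogonal projection of the curve to its tangent line at s0 *)
Lemma local_graph_parameter i s0 : exists tau tau' : R -> R,
  [/\ forall x : R, is_derive x 1 tau (tau' x), continuous tau', forall x, `|tau' x| <= 2 &
      forall s, `|s - s0| <= 1 -> tau (dotv (g i s - g i s0) (T i s0)) = s].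
Proof.
case: (sys) => l0 per dg T1 inj.
(* Clamps the parameter to [[s0 - 1, s0 + 1]], where the tangent has component at least one half
   along [T i s0]; the projection so continued increases on the whole line and can be inverted
   globally. *)
pose cl : R -> R := glue_at (s0 - 1) (fun=> s0 - 1) (glue_at (s0 + 1) (fun x => x) (fun=> s0 + 1)).
have e1 : s0 - 1 <= s0 + 1 by lra.
have ccl : continuous cl.
  move=> x; apply: continuous_glue => [|_|_]; first by rewrite /glue_at e1.
    exact: cvg_cst.
  by apply: continuous_glue => [//|_|_]; [exact: cvg_id|exact: cvg_cst].
have cl1 x : `|cl x - s0| <= 1.
  rewrite /cl /glue_at; case: ifP => [_|/negbT]; first by rewrite addrAC subrr sub0r normrN normr1.
  rewrite -ltNge => a; case: ifP => [b|_]; last by rewrite addrAC subrr add0r normr1.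
  by rewrite ler_norml; apply/andP; split; lra.
have clid x : `|x - s0| <= 1 -> cl x = x.
  rewrite ler_norml => /andP[a b]; rewrite /cl /glue_at; case: ifP => c; first by lra.
  by rewrite ifT//; lra.
pose lam' s := dotv (T i (cl s)) (T i s0).
have lam'ge s : 2^-1 <= lam' s.
  rewrite /lam' dotv_of_dist//.
  have : enorm (T i (cl s) - T i s0) ^+ 2 <= 1.
    by rewrite expr_le1// ?enorm_ge0//; exact: le_trans (Tl _ _ _) (cl1 s).
  lra.
have clam' : continuous lam'.
  move=> x; apply: continuous_dotv; last exact: cvg_cst.
  by apply: (@continuous_comp _ _ _ cl (T i)); [exact: ccl|exact: unit_system_T_continuous].
have [F F0 dF] := antiderivative clam'.
pose lam s := F s - F s0.
have dlam (s : R) : is_derive s 1 lam (lam' s).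
  by rewrite -[lam' s]subr0; apply: is_derive_rsub; exact: dF.
have h20 : 0 < 2^-1 :> R by rewrite invr_gt0.
have [q [sq qs dq]] := increasing_inverse h20 dlam lam'ge.
have lp s : 0 < lam' s by exact: lt_le_trans (lam'ge s).
exists q, (fun y => (lam' (q y))^-1); split=> //.
- move=> x; apply: cvgV; first by rewrite gt_eqF.
  apply: (@continuous_comp _ _ _ q lam'); last exact: clam'.
  exact: is_derive_rcontinuous (dq x).
- move=> x; rewrite ger0_norm ?invr_ge0 ?(ltW (lp _))//.
  by rewrite -[leRHS]invrK lef_pV2 ?posrE.
- move=> s hs; rewrite -[RHS]sq; congr q.
  pose f x := lam x - dotv (g i x - g i s0) (T i s0).
  have df (x : R) : `|x - s0| <= 1 -> is_derive x 1 f (0 : R).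
    move=> hx; have e : (0 : R) = lam' x - dotv (T i x) (T i s0) by rewrite /lam' clid// subrr.
    rewrite e; apply: is_derive_rsub; apply: is_derive_dotvc.
    by rewrite -[T i x]subr0; apply: is_derive_sub.
  have f0 : f s0 = 0 by rewrite /f /lam !subrr dotv0l subrr.
  suff : f s = 0 by rewrite /f => /eqP; rewrite subr_eq0 => /eqP.
  rewrite -f0; move: hs; rewrite ler_norml => /andP[h1 h2].
  have [s0s|/ltW ss0] := leP s0 s.
    apply/esym/(derivative0_const s0s) => x /andP[a b]; apply: df.
    by rewrite ler_norml; apply/andP; split; lra.
  apply: (derivative0_const ss0) => x /andP[a b]; apply: df.
  by rewrite ler_norml; apply/andP; split; lra.
Qed.

(** Around each of [N] points of the component, [E = D / Phi] is extended so as to depend only on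
    the projection to the tangent line, through [local_graph_parameter]; the extensions are summed
    with bumps as weights. On the curve the weights add up to [Phi], which gives back [D], and the
    radius [rho] keeps each bump away from other strands. *)
Lemma perturbation_extension (i0 : 'I_m) : exists2 e0 : R, 0 < e0 &
  forall D D' : R -> V, (forall t : R, is_derive t 1 D (D' t)) -> continuous D' ->
  (forall t, D (t + l i0) = D t) -> (forall t, enorm (D t) <= e0) -> (forall t, enorm (D' t) <= e0) ->
  exists psi : V -> V, [/\ C1fun psi, forall x y, `|psi x - psi y| <= 2^-1 * `|x - y|,
    forall s, psi (g i0 s) = D s & forall j s, j != i0 -> psi (g j s) = 0].
Proof.
case: (sys) => l0 per dg T1 inj.
have [rho rho0 iso] := unit_system_isolation.
set L := l i0; have L0 : 0 < L by exact: l0.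
pose N := (Num.truncn (L / rho)).+1.
have N0 : 0 < N%:R :> R by rewrite ltr0n.
pose w := L / N%:R.
have w0 : 0 < w by rewrite divr_gt0.
have wr : w < rho.
  by rewrite /w ltr_pdivrMr// mulrC -ltr_pdivrMr// truncnS_gt.
have wN : w * N%:R = L by rewrite /w divfK// gt_eqF.
pose sk (k : 'I_N) : R := k%:R * w.
pose c k := g i0 (sk k).
have tk (k : 'I_N) : exists tt : (R -> R) * (R -> R),
  [/\ forall x : R, is_derive x 1 tt.1 (tt.2 x), continuous tt.2, forall x, `|tt.2 x| <= 2 &
      forall s, `|s - sk k| <= 1 -> tt.1 (dotv (g i0 s - c k) (T i0 (sk k))) = s].
  by have [t [t' h]] := local_graph_parameter i0 (sk k); exists (t, t').
have [tt htt] := choice tk.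
pose Phi s := \sum_(k < N) bump rho (c k) (g i0 s).
pose Phi' s := \sum_(k < N) possq' (rho ^+ 2 - dotv (g i0 s - c k) (g i0 s - c k)) * - (2 * dotv (g i0 s - c k) (T i0 s)).
have dPhi (s : R) : is_derive s 1 Phi (Phi' s).
  by apply: (is_derive_rsum _ (f' := fun k s => _)) => k; apply: is_derive_bump.
have cg := unit_system_continuous sys (i := i0).
have cPhi' : continuous Phi'.
  move=> s; apply: continuous_rsum => k.
  have cd : continuous_at s (fun s => g i0 s - c k) by apply: continuous_vsub; [exact: cg|exact: cvg_cst].
  apply: cvgM.
    apply: (@continuous_comp _ _ _ (fun s => rho ^+ 2 - dotv (g i0 s - c k) (g i0 s - c k)) possq').
      by apply: cvgB; [exact: cvg_cst|exact: (continuous_dotv cd cd)].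
    exact: possq'_continuous.
  apply: cvgN; apply: cvgM; first exact: cvg_cst.
  exact: (continuous_dotv cd (@unit_system_T_continuous i0 s)).
(* The centres are spaced by [w < rho], so every point of the component lies in one of the balls. *)
have Phi0 s : 0 < Phi s.
  have [q /andP[q1 q2]] := period_mod 0 s L0.
  set s' := s + q%:~R * L in q1 q2; rewrite add0r in q2.
  have gs : g i0 s = g i0 s' by rewrite /s' (periodic_int (per i0)).
  have sw0 : 0 <= s' / w by rewrite divr_ge0// ltW.
  have /andP[t1 t2] := truncn_itv sw0.
  have kN : (Num.truncn (s' / w) < N)%N.
    by rewrite -(ltr_nat R); apply: le_lt_trans t1 _; rewrite ltr_pdivrMr// mulrC wN.
  pose k := Ordinal kN.
  have hk : enorm (g i0 s - c k) < rho.
    rewrite gs; apply: le_lt_trans (unit_chord_le (dg i0) (T1 i0) _ _) _.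
    apply: le_lt_trans wr; rewrite /sk /=.
    move: t1 t2; rewrite ler_pdivlMr// ltr_pdivrMr// -natr1 [(_ + 1) * w]mulrDl mul1r => t1 t2.
    by rewrite ger0_norm; lra.
  rewrite /Phi (bigD1 k)//= ltr_pwDl//; first exact: bump_gt0.
  by apply: sumr_ge0 => j _; exact: bump_ge0.
have Phip s : Phi (s + L) = Phi s by rewrite /Phi /L per.
have Phi'p s : Phi' (s + L) = Phi' s by rewrite /Phi' /L per (unit_system_periodicT sys).
pose Xi s := (Phi s)^-1.
pose Xi' s := - (Phi s) ^- 2 * Phi' s.
have dXi (s : R) : is_derive s 1 Xi (Xi' s) by apply: is_deriveV; rewrite gt_eqF.
have cPhi : continuous Phi by move=> s; exact: is_derive_rcontinuous (dPhi s).
have cXi : continuous Xi by move=> s; exact: is_derive_rcontinuous (dXi s).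
have cXi' : continuous Xi'.
  move=> s; apply: cvgM; last exact: cPhi'.
  apply: cvgN; apply: cvgV; first by rewrite expf_neq0// gt_eqF.
  by apply: cvgM; exact: cPhi.
have nb (f : R -> R) : continuous f -> (forall s, f (s + L) = f s) -> exists2 M, 0 <= M & forall s, `|f s| <= M.
  move=> cf pf; have cn : continuous (fun s => `|f s|) by move=> s; apply: cvg_norm; exact: cf.
  have pn s : `|f (s + L)| = `|f s| by rewrite pf.
  have [a [b hab]] := periodic_bounds L0 cn pn.
  by exists `|f b| => // s; case: (hab s).
have [M1 M10 hM1] : exists2 M, 0 <= M & forall s, `|Xi s| <= M.
  by apply: nb => // s; rewrite /Xi Phip.
have [M2 M20 hM2] : exists2 M, 0 <= M & forall s, `|Xi' s| <= M.
  by apply: nb => // s; rewrite /Xi' Phip Phi'p.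
pose C0 := N%:R * (4 * rho ^+ 3 * M1 + rho ^+ 4 * (2 * (M1 + M2))).
have C00 : 0 <= C0.
  have r3 : 0 <= rho ^+ 3 by rewrite exprn_ge0// ltW.
  have r4 : 0 <= rho ^+ 4 by rewrite exprn_ge0// ltW.
  rewrite /C0; apply: mulr_ge0; first exact: ltW.
  apply: addr_ge0; first by apply: mulr_ge0 => //; exact: mulr_ge0.
  apply: mulr_ge0 => //; apply: mulr_ge0 => //; exact: addr_ge0.
have n0 : 0 <= n%:R :> R by [].
(* In [enorm] the map [psi] is Lipschitz with constant [C0 e0]; passing to the sup norm costs the
   factor [n], and the product must not exceed one half. *)
pose e0 := (2 * (C0 * n%:R + 1))^-1.
have Cn : 0 <= C0 * n%:R by rewrite mulr_ge0.
have e00 : 0 < e0 by rewrite invr_gt0 mulr_gt0// ltr_wpDl.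
have Ce0 : C0 * e0 * n%:R <= 2^-1.
  have ee : e0 * (2 * (C0 * n%:R + 1)) = 1.
    by rewrite mulVf// gt_eqF// mulr_gt0// ltr_wpDl.
  lra.
exists e0 => // D D' dD cD' pD De D'e.
pose E s := Xi s *: D s.
pose E' s := Xi' s *: D s + Xi s *: D' s.
have dE (s : R) : is_derive s 1 E (E' s) by apply: is_derive_scale; exact: dD.
have cD : continuous D by move=> s; exact: is_derive_continuous (dD s).
have cE' : continuous E'.
  move=> s; apply: continuous_vadd; apply: continuous_scale.
  - exact: cXi'.
  - exact: cD.
  - exact: cXi.
  - exact: cD'.
have Ele s : enorm (E s) <= M1 * e0 by rewrite /E enormZ ler_pM ?enorm_ge0.
have E'le s : enorm (E' s) <= (M1 + M2) * e0.
  rewrite /E'; apply: le_trans (enormD _ _) _; rewrite !enormZ addrC mulrDl.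
  by apply: lerD; rewrite ler_pM ?enorm_ge0.
pose F k y := E ((tt k).1 (dotv (y - c k) (T i0 (sk k)))).
pose psi y := \sum_(k < N) bump rho (c k) y *: F k y.
have Fle k y : enorm (F k y) <= M1 * e0 by exact: Ele.
have Flip k y z : enorm (F k y - F k z) <= 2 * ((M1 + M2) * e0) * enorm (y - z).
  case: (htt k) => dt _ bt _.
  apply: le_trans (bounded_derivative_enorm dE E'le _ _) _.
  have K0 : 0 <= (M1 + M2) * e0 by apply: mulr_ge0; [exact: addr_ge0|exact: ltW].
  rewrite (_ : 2 * _ * _ = (M1 + M2) * e0 * (2 * enorm (y - z))); last by ring.
  apply: ler_wpM2l => //.
  apply: le_trans (bounded_derivative_lipschitz dt bt _ _) _.
  rewrite ler_wpM2l// -dotvBl opprB addrA subrK.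
  by apply: le_trans (dotv_norm_le _ _) _; rewrite T1 mulr1.
exists psi; split.
- apply: C1fun_rowP => i.
  rewrite (_ : (fun x => _) = fun x => \sum_(k < N) bump rho (c k) x * (F k x) 0 i); last first.
    by apply/funext => x; rewrite summxE; apply: eq_bigr => k _; rewrite mxE.
  apply: C1fun_sum => k; apply: C1fun_mul; first exact: C1fun_bump.
  case: (htt k) => dt ct bt _.
  apply: (@C1fun_comp _ _ (fun y => dotv (y - c k) (T i0 (sk k))) (fun x => (E ((tt k).1 x)) 0 i)
    (fun x => (E' ((tt k).1 x)) 0 i * (tt k).2 x)).
  + rewrite (_ : (fun y => _) = fun y => dotv y (T i0 (sk k)) + - dotv (c k) (T i0 (sk k))).
      by apply: C1fun_add; [exact: C1fun_dotv|exact: C1fun_const].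
    by apply/funext => y; rewrite dotvBl.
  + move=> t; apply: (@is_derive_rcomp _ (fun x => E x 0 i)).
    by have /is_derive_rowP := dE ((tt k).1 t); apply.
  + move=> t; apply: cvgM; last exact: ct.
    apply: (@continuous_comp _ _ _ (tt k).1 (fun x => E' x 0 i)).
      exact: is_derive_rcontinuous (dt t).
    by have /continuous_rowP := cE' ((tt k).1 t); apply.
- move=> y z.
  have step k : enorm (bump rho (c k) y *: F k y - bump rho (c k) z *: F k z)
      <= (4 * rho ^+ 3 * M1 + rho ^+ 4 * (2 * (M1 + M2))) * e0 * enorm (y - z).
    have -> : bump rho (c k) y *: F k y - bump rho (c k) z *: F k z =
        (bump rho (c k) y - bump rho (c k) z) *: F k y + bump rho (c k) z *: (F k y - F k z).
      by rewrite scalerBl scalerBr addrA subrK.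
    apply: le_trans (enormD _ _) _; rewrite (enormZ _ (F k y)) (enormZ _ (F k y - F k z)).
    have h1 : `|bump rho (c k) y - bump rho (c k) z| * enorm (F k y) <= 4 * rho ^+ 3 * enorm (y - z) * (M1 * e0).
      by rewrite ler_pM ?enorm_ge0// bump_lipschitz.
    have h2 : `|bump rho (c k) z| * enorm (F k y - F k z) <= rho ^+ 4 * (2 * ((M1 + M2) * e0) * enorm (y - z)).
      by rewrite ler_pM ?enorm_ge0// ger0_norm ?bump_ge0// bump_le.
    lra.
  apply: le_trans (normr_le_enorm _) _.
  apply: (@le_trans _ _ (C0 * e0 * enorm (y - z))).
    rewrite /psi -sumrB.
    have sumle (r : seq 'I_N) : enorm (\sum_(k <- r) (bump rho (c k) y *: F k y - bump rho (c k) z *: F k z))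
        <= (size r)%:R * ((4 * rho ^+ 3 * M1 + rho ^+ 4 * (2 * (M1 + M2))) * e0 * enorm (y - z)).
      elim: r => [|k r IH]; first by rewrite big_nil enorm0 mul0r.
      rewrite big_cons /= -natr1 mulrDl mul1r addrC; apply: le_trans (enormD _ _) _.
      by apply: lerD; [exact: IH|exact: step].
    apply: le_trans (sumle _) _.
    have -> : size (index_enum 'I_N) = N by rewrite /index_enum unlock -enumT size_enum_ord.
    by rewrite /C0 !mulrA.
  apply: (@le_trans _ _ (C0 * e0 * (n%:R * `|y - z|))).
    by rewrite ler_wpM2l ?enorm_le_normr// mulr_ge0// ltW.
  by rewrite mulrA ler_wpM2r.
- move=> s; rewrite /psi.
  have term k : bump rho (c k) (g i0 s) *: F k (g i0 s) = bump rho (c k) (g i0 s) *: E s.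
    have [->|b0] := eqVneq (bump rho (c k) (g i0 s)) 0; first by rewrite !scale0r.
    congr (_ *: _); have hb := bump_supp rho0 b0.
    have [_ [q hq]] := iso i0 i0 (sk k) s hb.
    case: (htt k) => _ _ _ inv.
    rewrite /F -(periodic_int (per i0) q s) inv; last exact: ltW.
    have Ep t : E (t + L) = E t by rewrite /E /Xi Phip pD.
    by rewrite (periodic_int Ep).
  under eq_bigr do rewrite term.
  by rewrite -scaler_suml -/(Phi s) /E scalerA mulfV ?scale1r// gt_eqF.
- move=> j s ji; rewrite /psi big1// => k _.
  have [->|b0] := eqVneq (bump rho (c k) (g j s)) 0; first by rewrite scale0r.
  have [e _] := iso i0 j (sk k) s (bump_supp rho0 b0).
  by rewrite e eqxx in ji.
Qed.

End Extension.

Lemma C1fun_dilate (R : realType) (V W : normedModType R) (k : R) (f : V -> W) :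
  C1fun f -> C1fun (fun x => f (k *: x)).
Proof.
move=> [df cf].
pose sc := ( *:%R k : {linear V -> V}).
have csc : continuous sc by exact: scaler_continuous.
have dsc x : differentiable sc x by exact: linear_differentiable.
split=> [x|v]; first exact: (differentiable_comp (dsc x) (df (k *: x))).
rewrite (_ : (fun x => _) = fun x => 'd f (k *: x) (k *: v)).
  move=> x; apply: (@continuous_comp _ _ _ sc (fun x => 'd f x (k *: v))); first exact: csc.
  exact: cf.
apply/funext => x.
transitivity ('d f (k *: x) ('d sc x v)); first exact: (congr1 (@^~ v) (diff_comp (dsc x) (df (k *: x)))).
by congr ('d f (k *: x) _); exact: (congr1 (@^~ v) (diff_lin x csc)).
Qed.

(** * Competitors of a relative minimum *)

Section Core.
Variables (R : realType) (n : nat).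
Notation V := 'rV[R]_n.

(* [c] is [g] rescaled by [1/r] and parametrized by arclength, with unit tangent [T]
   and lengths [l]; [s] is the arclength function and [q] its inverse. *)
Record unit_form m (g : 'I_m -> R -> V) (r : R) (c T : 'I_m -> R -> V) (l : 'I_m -> R)
  (s q : 'I_m -> R -> R) : Prop := UnitForm {
  uf_sys : unit_system c T l;
  uf_cont : forall i, continuous (T i);
  uf_eq : forall i t, g i t = r *: c i (s i t);
  uf_der : forall i t, derive1 (g i) t = enorm (derive1 (g i) t) *: T i (s i t);
  uf_ds : forall i (t : R), is_derive t 1 (s i) (enorm (derive1 (g i) t) / r);
  uf_s0 : forall i, s i 0 = 0;
  uf_per : forall i t, s i (t + 1) = s i t + l i;
  uf_sK : forall i, cancel (s i) (q i);
  uf_qK : forall i, cancel (q i) (s i) }.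

Lemma link_unit_form m (g : 'I_m -> R -> V) (r : R) : is_link g -> 0 < r ->
  exists (c T : 'I_m -> R -> V) (l : 'I_m -> R) (s q : 'I_m -> R -> R), unit_form g r c T l s q.
Proof.
move=> lg r0; have [c [T [l [s [q [[? ? ? ?] [? ? ? ? ?]]]]]]] := link_unit_system lg r0.
by exists c, T, l, s, q.
Qed.

Lemma unit_form_length m (g : 'I_m -> R -> V) (r : R) c T l s q : is_link g -> 0 < r ->
  unit_form g r c T l s q -> link_length g = (r * \sum_(i < m) l i)%:E.
Proof.
move=> lg r0 uf; rewrite /link_length mulr_sumr -sumEFin; apply: eq_bigr => i _.
have c1 : continuous (fun t => enorm (derive1 (g i) t)).
  by move=> t; apply: continuous_enorm; case: lg => _ [/(_ i)[_ h] _]; exact: h.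
have dF (t : R) : is_derive t 1 (fun t => r * s i t) (enorm (derive1 (g i) t)).
  have := is_derive_rmul (is_derive_rconst r t) (uf_ds uf i t).
  by rewrite mul0r add0r mulrCA mulfV ?mulr1 // gt_eqF.
rewrite (integral_derivative ltr01 dF c1); congr (_%:E).
by have := uf_per uf i 0; rewrite add0r (uf_s0 uf) add0r => ->; rewrite mulr0 subr0.
Qed.

Lemma unit_form_normal_inj m (g : 'I_m -> R -> V) (r : R) c T l s q : is_link g -> 0 < r ->
  unit_form g r c T l s q -> normal_inj c 1 -> normal_inj g r.
Proof.
move=> lg r0 uf ni; have [_ _ dg g'0 _] := link_regular lg.
have r0' : r != 0 by rewrite gt_eqF.
apply: (@normal_inj_scale _ _ _ g c r^-1); first by rewrite invr_gt0.
  move=> j t; exists j, (s j t), (enorm (derive1 (g j) t))^-1.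
  rewrite (uf_eq uf) scalerA mulVf// scale1r (unit_system_derive1 (uf_sys uf)); split=> //.
  by rewrite {2}(uf_der uf) scalerA mulVf ?scale1r// enorm_eq0 g'0.
by rewrite mulVf.
Qed.

Lemma normal_inj_unit_form m (g : 'I_m -> R -> V) (r : R) c T l s q : is_link g -> 0 < r ->
  unit_form g r c T l s q -> normal_inj g r -> normal_inj c 1.
Proof.
move=> lg r0 uf ni; have [_ _ dg g'0 _] := link_regular lg.
apply: (@normal_inj_scale _ _ _ c g r) => //; last by rewrite mulr1.
move=> j t; exists j, (q j t), (enorm (derive1 (g j) (q j t))).
rewrite (uf_eq uf) (uf_qK uf) (unit_system_derive1 (uf_sys uf)); split=> //.
by rewrite {1}(uf_der uf) (uf_qK uf).
Qed.

Variables (m : nat) (g : 'I_m -> R -> V) (r : R) (c T : 'I_m -> R -> V) (l : 'I_m -> R)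
  (s q : 'I_m -> R -> R) (e : R).
Hypotheses (lg : is_link g) (r0 : 0 < r) (uf : unit_form g r c T l s q).
Hypothesis Tl : forall i s t, enorm (T i s - T i t) <= `|s - t|.
Hypotheses (e0 : 0 < e) (far : forall i j s t, i != j \/ (i = j /\ pi <= t - s <= l i - pi) ->
  2 + e <= enorm (c i s - c j t)).

(** Moving one end by at most [d] brings the pair back into the range of [far], and a unit-speed
    curve moves no farther than its parameter. *)
Lemma far_margin (i : 'I_m) (a b d : R) : 0 <= d -> 2 * pi <= l i -> pi - d <= b - a -> b - a <= l i - pi + d ->
  2 + e - d <= enorm (c i a - c i b).
Proof.
move=> d0 lpi h1 h2.
have [_ _ dc T1 _] := uf_sys uf.
have [b' [hb hb']] : exists b', pi <= b' - a <= l i - pi /\ `|b' - b| <= d.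
  case: (ltP (b - a) pi) => hp; first by exists (a + pi); rewrite ler_norml; split; lra.
  case: (ltP (l i - pi) (b - a)) => hq; first by exists (a + (l i - pi)); rewrite ler_norml; split; lra.
  by exists b; rewrite subrr normr0; split; lra.
have h := far (or_intror (conj (erefl i) hb)).
have h' : enorm (c i b' - c i b) <= d := le_trans (unit_chord_le (dc i) (T1 i) b' b) hb'.
have : enorm (c i a - c i b') <= enorm (c i a - c i b) + enorm (c i b' - c i b).
  by rewrite (enormBC (c i b')); have := enormD (c i a - c i b) (c i b - c i b'); rewrite addrA subrK.
lra.
Qed.

(** After rescaling, the competitor has arclength [S] and unit tangent along [T + D'], so its
    tangent is 1-Lipschitz and only far pairs matter. Changing the parameter costs [4 d] of the
    margin [e] and the displacement [2 d], which [8 d <= e] covers. *)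
Lemma competitor_thick (h : 'I_m -> R -> V) (i0 : 'I_m) (D D' : R -> V) (S : R -> R) (d : R) :
  is_link h -> (forall t, h i0 t = g i0 t + r *: D (s i0 t)) -> (forall j, j != i0 -> h j = g j) ->
  (forall t, derive1 (h i0) t = enorm (derive1 (g i0) t) *: (T i0 (s i0 t) + D' (s i0 t))) ->
  (forall t : R, is_derive t 1 S (enorm (T i0 t + D' t))) ->
  (forall x y, enorm ((enorm (T i0 x + D' x))^-1 *: (T i0 x + D' x) - (enorm (T i0 y + D' y))^-1 *: (T i0 y + D' y))
     <= `|S x - S y|) ->
  (forall t, enorm (D t) <= d) -> (forall t, enorm (D' t) <= d) -> d <= 2^-1 -> 8 * d <= e ->
  S (l i0) - S 0 < l i0 ->
  normal_inj h r /\ link_length h = (r * (\sum_(i < m | i != i0) l i + (S (l i0) - S 0)))%:E.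
Proof.
move=> lh hi0 hj h' dS US De D'e d2 d8 Slt.
have [c2 [T2 [l2 [s2 [q2 uf2]]]]] := link_unit_form lh r0.
have r0' : r != 0 by rewrite gt_eqF.
have [l0 per dc T1 _] := uf_sys uf; have [l20 per2 dc2 T21 _] := uf_sys uf2.
have [_ _ _ g'0 _] := link_regular lg; have [_ _ _ h'0 _] := link_regular lh.
have d0 : 0 <= d := le_trans (enorm_ge0 _) (De 0).
have eq_der (f f1 f2 : R -> R) (t : R) : (forall t : R, is_derive t 1 f1 (f t)) ->
    (forall t : R, is_derive t 1 f2 (f t)) -> f1 0 = f2 0 -> f1 t = f2 t.
  move=> h1 h2 z; apply/eqP; rewrite -subr_eq0; apply/eqP.
  have k (x : R) : is_derive x 1 (fun x => f1 x - f2 x) (0 : R).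
    by have := is_derive_rsub (h1 x) (h2 x); rewrite subrr.
  case: (leP 0 t) => [t0|/ltW t0].
    by rewrite -(@derivative0_const _ (fun x => f1 x - f2 x) 0 t t0 (fun x _ => k x)) z subrr.
  by rewrite (@derivative0_const _ (fun x => f1 x - f2 x) t 0 t0 (fun x _ => k x)) z subrr.
have s2j j t : j != i0 -> s2 j t = s j t.
  move=> ji; apply: (eq_der (fun t => enorm (derive1 (h j) t) / r)).
  - exact: (uf_ds uf2).
  - by rewrite hj//; exact: (uf_ds uf).
  - by rewrite (uf_s0 uf2) (uf_s0 uf).
have s2i t : s2 i0 t = S (s i0 t) - S 0.
  apply: (eq_der (fun t => enorm (derive1 (h i0) t) / r) (s2 i0) (fun t => S (s i0 t) - S 0)).
  - exact: (uf_ds uf2).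
  - move=> x; have := is_derive_rsub (is_derive_rcomp (uf_ds uf i0 x) (dS (s i0 x))) (is_derive_rconst (S 0) x).
    by rewrite subr0 h' enormZ ger0_norm ?enorm_ge0// [in X in X -> _]mulrCA mulrA.
  - by rewrite (uf_s0 uf2) (uf_s0 uf) subrr.
have l2j j : j != i0 -> l2 j = l j.
  move=> ji; have := uf_per uf2 j 0; rewrite !s2j// (uf_per uf); lra.
have l2i : l2 i0 = S (l i0) - S 0.
  have := uf_per uf2 i0 0; have := uf_per uf i0 0; rewrite !s2i (uf_s0 uf) subrr add0r.
  by rewrite add0r => -> ->; rewrite add0r.
have c2j j t : j != i0 -> c2 j (s2 j t) = c j (s j t).
  move=> ji; have := uf_eq uf2 j t; rewrite hj// (uf_eq uf) => /(scalerI r0') -> //.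
have c2i t : c2 i0 (s2 i0 t) = c i0 (s i0 t) + D (s i0 t).
  by have := uf_eq uf2 i0 t; rewrite hi0 (uf_eq uf) -scalerDr => /(scalerI r0') ->.
have T2E j t : T2 j (s2 j t) = (enorm (derive1 (h j) t))^-1 *: derive1 (h j) t.
  by rewrite {2}(uf_der uf2) scalerA mulVf ?scale1r// enorm_eq0 h'0.
have TE j t : T j (s j t) = (enorm (derive1 (g j) t))^-1 *: derive1 (g j) t.
  by rewrite {2}(uf_der uf) scalerA mulVf ?scale1r// enorm_eq0 g'0.
have T2i t : T2 i0 (s2 i0 t) = (enorm (T i0 (s i0 t) + D' (s i0 t)))^-1 *: (T i0 (s i0 t) + D' (s i0 t)).
  rewrite T2E h' enormZ (ger0_norm (enorm_ge0 _)) scalerA; congr (_ *: _).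
  by rewrite invfM mulrAC mulVf ?mul1r// enorm_eq0 g'0.
have T2l i x y : enorm (T2 i x - T2 i y) <= `|x - y|.
  rewrite -(uf_qK uf2 i x) -(uf_qK uf2 i y); move: (q2 i x) (q2 i y) => {}x {}y.
  have [->|ii] := eqVneq i i0; last first.
    have T2j t : T2 i (s2 i t) = T i (s i t) by rewrite T2E hj// TE.
    by rewrite (T2j x) (T2j y) (s2j _ x ii) (s2j _ y ii).
  rewrite !T2i !s2i opprB addrA subrK; exact: US.
have Sinc x y : x <= y -> S y - S x <= (1 + d) * (y - x).
  move=> xy.
  have := @derivative_ge0_le _ (fun t => (1 + d) * t - S t) (fun t => (1 + d) - enorm (T i0 t + D' t)) x y xy.
  have dd (t : R) : is_derive t 1 (fun t => (1 + d) * t - S t) ((1 + d) - enorm (T i0 t + D' t)).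
    apply: is_derive_rsub => //.
    by have := is_derive_rmul (is_derive_rconst (1 + d) t) (is_derive_rid t); rewrite mul0r add0r mulr1.
  move=> k; suff : (1 + d) * x - S x <= (1 + d) * y - S y by lra.
  apply: k => [t _|t _].
  - exact: is_derive_rcontinuous (dd t).
  - by rewrite subr_ge0; apply: le_trans (enormD _ _) _; rewrite T1 lerD2l.
have Smono x y : S x <= S y -> x <= y.
  rewrite leNgt => sxy; rewrite leNgt; apply: contra sxy => yx.
  apply: (@derivative_gt0_lt _ S (fun t => enorm (T i0 t + D' t)) y x yx) => t _ //.
    exact: is_derive_rcontinuous (dS t).
  have := enorm_lerB (T i0 t) (- D' t); rewrite opprK enormN T1 => k.
  apply: lt_le_trans k; have := D'e t; lra.
have cpi : pi <= 4 :> R.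
  by have /andP[_ ] := @pihalf_02 R; lra.
(* Stretching by at most [1 + d] adds at most [4 d] to an arc no longer than [4]; longer arcs exceed
   [pi] anyway. *)
have arc x y : pi <= S y - S x -> pi - 4 * d <= y - x.
  move=> hs; have pi0 := @pi_gt0 R; have xy : x <= y by apply: Smono; lra.
  have := Sinc _ _ xy; case: (leP (y - x) 4) => [h4|]; last lra.
  have : d * (y - x) <= d * 4 by rewrite ler_wpM2l.
  lra.
have Sper t : S (t + l i0) = S t + (S (l i0) - S 0).
  have hq := uf_per uf2 i0 (q i0 t).
  by move: hq; rewrite !s2i (uf_per uf) (uf_qK uf) l2i; lra.
split.
  apply: (unit_form_normal_inj lh r0 uf2).
  apply: (@unit_system_normal_inj _ _ _ _ _ _ (uf_sys uf2) 1 1 ltr01); rewrite ?mulr1//.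
    by move=> i x y; rewrite mul1r.
  move=> i j x y; rewrite divr1 -(uf_qK uf2 i x) -(uf_qK uf2 j y).
  move: (q2 i x) (q2 j y) => {}x {}y hxy.
  have [ij|ij] := eqVneq i j.
    subst j; have {}hxy : pi <= s2 i y - s2 i x <= l2 i - pi by case: hxy => [|[]//]; rewrite eqxx.
    have [ii|ii] := eqVneq i i0; last first.
      rewrite !c2j//; rewrite !s2j// l2j// in hxy.
      by have := far (or_intror (conj (erefl i) hxy)); lra.
    subst i; rewrite !c2i; move: hxy; rewrite !s2i l2i.
    move: (s i0 x) (s i0 y) => {}x {}y /andP[hx hy].
    have hx' : pi <= S y - S x by lra.
    have hy' : pi <= S (x + l i0) - S y by rewrite Sper; lra.
    have a1 := arc _ _ hx'; have a2 := arc _ _ hy'.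
    have lpi : 2 * pi <= l i0 by lra.
    have fm : 2 + e - 4 * d <= enorm (c i0 x - c i0 y) by apply: far_margin => //; lra.
    have -> : c i0 x + D x - (c i0 y + D y) = (c i0 x - c i0 y) - (D y - D x).
      by apply/rowP => k; rewrite !mxE; ring.
    have := enorm_lerB (c i0 x - c i0 y) (D y - D x); have := enormB (D y) (D x).
    have := De x; have := De y; lra.
  have hf := far (or_introl ij) => /= {hxy}.
  have near k z : enorm (c2 k (s2 k z) - c k (s k z)) <= d.
    have [->|kk] := eqVneq k i0; first by rewrite c2i addrAC subrr add0r.
    by rewrite c2j// subrr enorm0.
  have n1 := near i x; have n2 := near j y; have := hf (s i x) (s j y).
  have -> : c2 i (s2 i x) - c2 j (s2 j y) = (c i (s i x) - c j (s j y)) -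
     ((c2 j (s2 j y) - c j (s j y)) - (c2 i (s2 i x) - c i (s i x))).
    by apply/rowP => k; rewrite !mxE; ring.
  have := enorm_lerB (c i (s i x) - c j (s j y)) ((c2 j (s2 j y) - c j (s j y)) - (c2 i (s2 i x) - c i (s i x))).
  have := enormB (c2 j (s2 j y) - c j (s j y)) (c2 i (s2 i x) - c i (s i x)).
  lra.
rewrite (unit_form_length lh r0 uf2) (bigD1 i0)//= l2i addrC; congr ((_ * (_ + _))%:E).
by apply: eq_bigr => j ji; exact: l2j.
Qed.

Hypotheses (min_g : rel_min_ropelength g) (NIRg : NIR g = r%:E).

(** This is the property called [length_critical] below, for one component: a shorter competitor of
    at least the same thickness, close to [g] and isotopic to it, would have smaller ropelength. *)
Lemma core_variation (i0 : 'I_m) : exists2 d : R, 0 < d &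
  forall (D D' : R -> V) (S : R -> R),
  (forall t : R, is_derive t 1 D (D' t)) -> continuous D' -> (forall t, D (t + l i0) = D t) ->
  (forall t, enorm (D t) <= d) -> (forall t, enorm (D' t) <= d) ->
  (forall t : R, is_derive t 1 S (enorm (T i0 t + D' t))) ->
  (forall x y, enorm ((enorm (T i0 x + D' x))^-1 *: (T i0 x + D' x) - (enorm (T i0 y + D' y))^-1 *: (T i0 y + D' y))
     <= `|S x - S y|) ->
  l i0 <= S (l i0) - S 0.
Proof.
have [eps [eps0 min]] := min_g.
have [l0 per dc T1 inj] := uf_sys uf.
have [gper [gC1 [g'0 ginj]]] := lg.
have dg i t : is_derive (t : R) 1 (g i) (derive1 (g i) t) by apply: C1curve_is_derive; exact: gC1.
have cg' i : continuous (derive1 (g i)) by case: (gC1 i).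
have [e1 e10 ext] := perturbation_extension (uf_sys uf) Tl i0.
have cn : continuous (fun t => enorm (derive1 (g i0) t)).
  by move=> t; apply: continuous_enorm; exact: cg'.
have pn t : enorm (derive1 (g i0) (t + 1)) = enorm (derive1 (g i0) t).
  by rewrite (periodic_derivative (dg i0) (gper i0)).
have [t1 [t2 hM]] := periodic_bounds ltr01 cn pn.
set M := enorm (derive1 (g i0) t2) in hM.
have M0 : 0 <= M by exact: enorm_ge0.
have [d [d0 d1 d2 d3 [d4 d5]]] : exists d, [/\ 0 < d, d <= e1, d <= 2^-1, 8 * d <= e & r * d < eps /\ M * d < eps].
  exists (Num.min (Num.min e1 2^-1) (Num.min (e / 8) (Num.min (eps / (2 * r)) (eps / (2 * (M + 1)))))).
  have M1 : 0 < 2 * (M + 1) by rewrite mulr_gt0// ltr_wpDl.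
  have r2 : 0 < 2 * r by rewrite mulr_gt0.
  set d := Num.min _ _; have : d <= d by []. 
  rewrite {2}/d !le_min => /andP[/andP[a1 a2] /andP[a3 /andP[a4 a5]]].
  have d0 : 0 < d by rewrite /d !lt_min e10 invr_gt0 ltr0n /= !divr_gt0.
  rewrite ler_pdivlMr // in a3; rewrite ler_pdivlMr // in a4; rewrite ler_pdivlMr // in a5.
  by split=> //; [lra|split; nra].
exists d => // D D' S dD cD' pD De D'e dS US; rewrite leNgt; apply/negP => Slt.
have [psi [psiC1 psil psi0 psij]] := ext D D' dD cD' pD (fun t => le_trans (De t) d1) (fun t => le_trans (D'e t) d1).
have r0' : r != 0 by rewrite gt_eqF.
(* The extension lives at the scale of [c]; conjugating it by the dilation brings it to the scale of
   [g] with the same Lipschitz constant. *)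
pose psir x := r *: psi (r^-1 *: x).
have psirC1 : C1fun psir.
  by apply: C1fun_scalel; exact: C1fun_dilate.
have psirl x y : `|psir x - psir y| <= 2^-1 * `|x - y|.
  rewrite /psir -scalerBr normrZ (gtr0_norm r0).
  apply: (@le_trans _ _ (r * (2^-1 * `|r^-1 *: x - r^-1 *: y|))); first by rewrite ler_pM2l.
  by rewrite -scalerBr normrZ gtr0_norm ?invr_gt0// mulrCA (mulrA r) mulfV// mul1r.
pose h i t := g i t + psir (g i t).
have psirj j t : j != i0 -> psir (g j t) = 0.
  by move=> ji; rewrite /psir (uf_eq uf) scalerA mulVf// scale1r psij// scaler0.
have psiri t : psir (g i0 t) = r *: D (s i0 t).
  by rewrite /psir (uf_eq uf) scalerA mulVf// scale1r psi0.
have hj j : j != i0 -> h j = g j by move=> ji; apply/funext => t; rewrite /h psirj// addr0.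
have hi t : h i0 t = g i0 t + r *: D (s i0 t) by rewrite /h psiri.
have dhi t : is_derive (t : R) 1 (h i0) (enorm (derive1 (g i0) t) *: (T i0 (s i0 t) + D' (s i0 t))).
  rewrite (_ : h i0 = fun t => g i0 t + r *: D (s i0 t)); last exact/funext.
  have := is_derive_add (dg i0 t) (is_derive_scalel r (is_derive_comp (uf_ds uf i0 t) (dD (s i0 t)))).
  by rewrite {1}(uf_der uf) scalerA mulrCA mulfV// mulr1 scalerDr.
have h' : derive1 (h i0) = fun t => enorm (derive1 (g i0) t) *: (T i0 (s i0 t) + D' (s i0 t)).
  exact: is_derive_derive1.
have cs t : continuous_at t (s i0) by exact: is_derive_rcontinuous (uf_ds uf i0 t).
have lh : is_link h.
  split; [|split; [|split]].
  - by move=> i t; rewrite /h gper.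
  - move=> i; have [->|ii] := eqVneq i i0; last by rewrite hj.
    apply: C1curveI dhi _ => t; apply: continuous_scale; first exact: cn.
    apply: continuous_vadd.
      by apply: (@continuous_comp _ _ _ (s i0) (T i0)); [exact: cs|exact: (uf_cont uf)].
    by apply: (@continuous_comp _ _ _ (s i0) D'); [exact: cs|exact: cD'].
  - move=> i t; have [->|ii] := eqVneq i i0; last by rewrite hj.
    rewrite h' scaler_eq0 enorm_eq0 (negbTE (g'0 _ _)) /= -enorm_eq0 gt_eqF//.
    have := enorm_lerB (T i0 (s i0 t)) (- D' (s i0 t)); rewrite opprK enormN T1.
    have := D'e (s i0 t); lra.
  - move=> i j x y hxy; apply: ginj; exact: (can_inj (perturb_inv_cancel psirl)) hxy.
have cls : same_link_class g h by exact: (perturb_isotopy psirC1 psirl).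
have close i t : enorm (h i t - g i t) < eps /\ enorm (derive1 (h i) t - derive1 (g i) t) < eps.
  have [->|ii] := eqVneq i i0; last by rewrite hj// !subrr enorm0.
  split.
    rewrite hi addrAC subrr add0r enormZ (gtr0_norm r0); apply: le_lt_trans d4.
    by rewrite ler_pM2l.
  rewrite h' [in X in _ - X](uf_der uf) -scalerBr addrAC subrr add0r enormZ ger0_norm ?enorm_ge0//.
  by apply: le_lt_trans d5; rewrite ler_pM ?enorm_ge0//; case: (hM t).
have [ni len] := competitor_thick lh hi hj (fun t => congr1 (@^~ t) h') dS US De D'e d2 d3 Slt.
have := min h lh cls close.
have [r' r'0 hr'] := NIR_fin i0 lh.
have rr' : r <= r' by rewrite -lee_fin -hr'; exact: NIR_ge.
have r'1 : 0 < r' := lt_le_trans r0 rr'.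
rewrite /ropelength NIRg hr' r0 r'1 len (unit_form_length lg r0 uf) -!EFinM lee_fin (bigD1 i0)//=.
set A := \sum_(i < m | i != i0) l i.
have A0 : 0 <= A by apply: sumr_ge0 => i _; exact: ltW (l0 i).
have S0 : 0 <= S (l i0) - S 0.
  rewrite subr_ge0; apply: (@derivative_ge0_le _ S (fun t => enorm (T i0 t + D' t))) => [|t _|t _].
  - exact: ltW (l0 i0).
  - exact: is_derive_rcontinuous (dS t).
  - exact: enorm_ge0.
rewrite mulrAC mulfV// mul1r leNgt => /negP; apply.
apply: (@le_lt_trans _ _ (A + (S (l i0) - S 0))).
  by rewrite ler_pdivrMr// mulrC ler_wpM2l// addr_ge0.
by rewrite [ltRHS]addrC ltrD2l.
Qed.

End Core.

(** * Variations supported on an arc *)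

Section LocalVariation.
Variables (R : realType) (n : nat).
Notation V := 'rV[R]_n.

Lemma increment_unique (f1 f2 f : R -> R) (x y : R) : x <= y ->
  (forall t, x <= t <= y -> is_derive t 1 f1 (f t)) ->
  (forall t, x <= t <= y -> is_derive t 1 f2 (f t)) -> f1 y - f1 x = f2 y - f2 x.
Proof.
move=> xy h1 h2.
have k t : x <= t <= y -> is_derive t 1 (fun t => f1 t - f2 t) (0 : R).
  by move=> ht; have := is_derive_rsub (h1 t ht) (h2 t ht); rewrite subrr.
by have /= := derivative0_const xy k; lra.
Qed.

Lemma continuous_local (W : normedModType R) (f g : R -> W) (t r : R) : 0 < r ->
  (forall x, `|x - t| < r -> f x = g x) -> continuous_at t f -> continuous_at t g.
Proof.
move=> r0 fg cf.
have e : \forall x \near t, f x = g x.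
  by apply/nbhs_normP; exists r => //= x; rewrite /= distrC => /fg.
rewrite /continuous_at -(fg t) ?subrr ?normr0//.
by apply: cvg_trans cf; exact: near_eq_cvg.
Qed.

Lemma is_derive_shift (W : normedModType R) (f : R -> W) (a t : R) (d : W) :
  is_derive (t + a) 1 f d -> is_derive t 1 (fun x => f (x + a)) d.
Proof.
move=> /is_derive_epsP h; apply/is_derive_epsP => e /h[r r0 hr]; exists r => // x xt.
by have := hr (x + a); rewrite opprD addrACA subrr addr0 => /(_ xt).
Qed.

Definition periodize (W : Type) (l : R) (F : R -> W) (x : R) : W :=
  F (x - (Num.floor (x / l))%:~R * l).

Lemma periodize_periodic (W : Type) (l : R) (F : R -> W) (x : R) : 0 < l ->
  periodize l F (x + l) = periodize l F x.
Proof.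
move=> l0; rewrite /periodize mulrDl divff ?gt_eqF// floorDrz ?floor1 ?int_num1//.
by rewrite intrD mulrDl mul1r opprD addrACA subrr addr0.
Qed.

Lemma periodize_itv (l x : R) : 0 < l ->
  0 <= x - (Num.floor (x / l))%:~R * l < l.
Proof.
move=> l0; have /andP[] := floor_itv (x / l).
rewrite ler_pdivlMr// ltr_pdivrMr// intrD mulrDl mul1r => a b; apply/andP; split; lra.
Qed.

Lemma periodize_base (W : Type) (l : R) (F : R -> W) (x : R) : 0 <= x < l -> periodize l F x = F x.
Proof.
move=> /andP[x0 xl]; have l0 := le_lt_trans x0 xl.
rewrite /periodize (_ : Num.floor _ = 0) ?mul0r ?subr0//.
by apply: floor_def; rewrite ler_pdivlMr// ltr_pdivrMr// add0r mul0r mul1r x0.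
Qed.

(** [F] takes one value off [[0, d]] and [d < l], so the jump of the floor function is invisible:
    near any [x] a single translate of [F] serves on both sides. *)
Lemma periodize_local (l d x : R) : 0 < d -> d < l -> exists (k : int) (r : R), 0 < r /\
  forall (W : Type) (z : W) (F : R -> W), (forall x, x <= 0 -> F x = z) -> (forall x, d <= x -> F x = z) ->
  forall y, `|y - x| < r -> periodize l F y = F (y - k%:~R * l).
Proof.
move=> d0 dl; have l0 := lt_trans d0 dl; have /andP[] := periodize_itv x l0.
set k := Num.floor (x / l) => y0 yl.
exists k, (Num.min (l - d) (l - (x - k%:~R * l))); split.
  by rewrite lt_min !subr_gt0 dl.
move=> W z F F0 Fd y; rewrite lt_min !ltr_distl => /andP[/andP[a1 a2] /andP[a3 a4]].
case: (leP 0 (y - k%:~R * l)) => h.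
  rewrite /periodize (_ : Num.floor _ = k)//; apply: floor_def.
  by rewrite ler_pdivlMr// ltr_pdivrMr// intrD mulrDl mul1r; apply/andP; split; lra.
have e : Num.floor (y / l) = (k - 1)%R.
  apply: floor_def; rewrite subrK ler_pdivlMr// ltr_pdivrMr// intrB mulrBl mul1r.
  by apply/andP; split; lra.
rewrite /periodize e intrB mulrBl mul1r (F0 (y - k%:~R * l) (ltW h)) Fd//; lra.
Qed.

Definition dir (u : V) : V := (enorm u)^-1 *: u.

Lemma dir_unit (u : V) : enorm u = 1 -> dir u = u.
Proof. by move=> u1; rewrite /dir u1 invr1 scale1r. Qed.

Lemma dirZ (a : R) (u : V) : 0 < a -> dir (a *: u) = dir u.
Proof.
move=> a0; rewrite /dir enormZ gtr0_norm// scalerA invfM mulrAC mulVf ?mul1r//.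
by rewrite gt_eqF.
Qed.

(* First-order optimality of a closed unit-speed curve with tangent [T] and length [l]:
   perturbing it by [D] without raising the curvature above [1] does not shorten it. *)
Definition length_critical (T : R -> V) (l : R) : Prop := exists2 d : R, 0 < d &
  forall (D D' : R -> V) (S : R -> R),
  (forall t : R, is_derive t 1 D (D' t)) -> continuous D' -> (forall t, D (t + l) = D t) ->
  (forall t, enorm (D t) <= d) -> (forall t, enorm (D' t) <= d) ->
  (forall t : R, is_derive t 1 S (enorm (T t + D' t))) ->
  (forall x y, enorm (dir (T x + D' x) - dir (T y + D' y)) <= `|S x - S y|) ->
  l <= S l - S 0.

Lemma lipschitz_concat (G : R -> V) (S : R -> R) (c : R) :
  (forall x y, x <= y -> y <= c -> enorm (G y - G x) <= S y - S x) ->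
  (forall x y, c <= x -> x <= y -> enorm (G y - G x) <= S y - S x) ->
  forall x y, x <= y -> enorm (G y - G x) <= S y - S x.
Proof.
move=> h1 h2 x y xy.
case: (leP y c) => [yc|/ltW cy]; first exact: h1.
case: (leP c x) => [cx|/ltW xc]; first exact: h2.
by have := h1 x c xc (lexx c); have := h2 c y (lexx c) cy; have := enorm_dist (G y) (G c) (G x); lra.
Qed.

(** Extended by zero and made periodic, [E] becomes a variation of the closed curve that changes the
    length only over the arc; its Lipschitz condition is checked on three pieces and chained. *)
Lemma local_variation (T : R -> V) (l : R) : 0 < l -> (forall t, T (t + l) = T t) ->
  (forall t, enorm (T t) = 1) -> (forall s t, enorm (T s - T t) <= `|s - t|) ->
  length_critical T l -> exists2 d : R, 0 < d &
  forall (s0 e : R) (E E' : R -> V) (S0 : R -> R), 0 < e -> e < l ->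
  (forall t : R, is_derive t 1 E (E' t)) -> continuous E' ->
  E 0 = 0 -> E' 0 = 0 -> E e = 0 -> E' e = 0 ->
  (forall t, 0 <= t <= e -> enorm (E t) <= d) -> (forall t, 0 <= t <= e -> enorm (E' t) <= d) ->
  (forall t, 0 <= t <= e -> is_derive t 1 S0 (enorm (T (s0 + t) + E' t))) ->
  (forall x y, 0 <= x -> x <= y -> y <= e ->
     enorm (dir (T (s0 + y) + E' y) - dir (T (s0 + x) + E' x)) <= S0 y - S0 x) ->
  e <= S0 e - S0 0.
Proof.
move=> l0 Tp T1 Tl [d d0 crit]; exists d => // s0 e E E' S0 e0 el dE cE' E0 E'0 Ee E'e Ed E'd dS0 US0.
have cT : continuous T by apply: (@unit_lipschitz_continuous _ _ _ 1) => // s t; rewrite mul1r.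
pose F := glue_at e (glue_at 0 (fun=> 0) E) (fun=> 0).
pose F' := glue_at e (glue_at 0 (fun=> 0) E') (fun=> 0).
have FE t : 0 <= t <= e -> F t = E t.
  move=> /andP[t0 te]; rewrite /F /glue_at te; case: ifP => // t0'.
  by have -> : t = 0 by lra.
have F'E t : 0 <= t <= e -> F' t = E' t.
  move=> /andP[t0 te]; rewrite /F' /glue_at te; case: ifP => // t0'.
  by have -> : t = 0 by lra.
have F0 t : t <= 0 -> F t = 0 by move=> t0; rewrite /F /glue_at t0 (le_trans t0 (ltW e0)).
have F'0 t : t <= 0 -> F' t = 0 by move=> t0; rewrite /F' /glue_at t0 (le_trans t0 (ltW e0)).
have Fe t : e <= t -> F t = 0.
  rewrite le_eqVlt => /predU1P[<-|et]; first by rewrite FE ?lexx ?ltW.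
  by rewrite /F /glue_at ifF//; apply/negbTE; rewrite -ltNge.
have F'e t : e <= t -> F' t = 0.
  rewrite le_eqVlt => /predU1P[<-|et]; first by rewrite F'E ?lexx ?ltW.
  by rewrite /F' /glue_at ifF//; apply/negbTE; rewrite -ltNge.
have glee : glue_at 0 (fun=> 0) E e = 0 by rewrite /glue_at leNgt e0.
have glee' : glue_at 0 (fun=> 0) E' e = 0 by rewrite /glue_at leNgt e0.
have dF (t : R) : is_derive t 1 F (F' t).
  by apply: is_derive_glue => // _; apply: is_derive_glue.
have cF' : continuous F'.
  move=> t; apply: continuous_glue => // _; last exact: cvg_cst.
  by apply: continuous_glue => // _; exact: cvg_cst.
have Fd t : enorm (F t) <= d.
  case: (leP t 0) => [t0|t0]; first by rewrite F0// enorm0 ltW.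
  case: (leP e t) => [te|te]; first by rewrite Fe// enorm0 ltW.
  by rewrite FE ?Ed// !ltW.
have F'd t : enorm (F' t) <= d.
  case: (leP t 0) => [t0|t0]; first by rewrite F'0// enorm0 ltW.
  case: (leP e t) => [te|te]; first by rewrite F'e// enorm0 ltW.
  by rewrite F'E ?E'd// !ltW.
pose Y t := T (s0 + t) + F' t.
have cY : continuous (fun t => enorm (Y t)).
  move=> t; apply: continuous_enorm; apply: continuous_vadd; last exact: cF'.
  apply: (@continuous_comp _ _ _ (fun t => s0 + t) T); last exact: cT.
  by apply: cvgD; [exact: cvg_cst|exact: cvg_id].
have [Sb _ dSb] := antiderivative cY.
have Yout t : t <= 0 \/ e <= t -> Y t = T (s0 + t).
  by case=> h; [rewrite /Y F'0//|rewrite /Y F'e//]; rewrite addr0.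
have Sbout x y : x <= y -> y <= 0 \/ e <= x -> Sb y - Sb x = y - x.
  move=> xy h; apply: (@increment_unique Sb id (fun=> 1)) => // t /andP[xt ty].
  have := dSb t; rewrite Yout ?T1//; case: h => h; [left|right]; lra.
have SbS x y : 0 <= x -> x <= y -> y <= e -> Sb y - Sb x = S0 y - S0 x.
  move=> x0 xy ye; apply: (@increment_unique Sb S0 (fun t => enorm (Y t))) => // t /andP[xt ty].
  by rewrite /Y F'E; [apply: dS0|]; apply/andP; split; lra.
have Gl : forall x y, x <= y -> enorm (dir (Y y) - dir (Y x)) <= Sb y - Sb x.
  apply: (@lipschitz_concat (fun x => dir (Y x)) Sb 0) => [x y xy y0|].
    rewrite (Sbout _ _ xy (or_introl y0)) (Yout x) ?(Yout y); try (left; lra).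
    rewrite !dir_unit ?T1//; apply: le_trans (Tl _ _) _.
    by rewrite opprD addrACA subrr add0r ger0_norm// subr_ge0.
  have far x y : e <= x -> x <= y -> enorm (dir (Y y) - dir (Y x)) <= Sb y - Sb x.
    move=> ex xy; rewrite (Sbout _ _ xy (or_intror ex)) (Yout x) ?(Yout y); try (right; lra).
    rewrite !dir_unit ?T1//; apply: le_trans (Tl _ _) _.
    by rewrite opprD addrACA subrr add0r ger0_norm// subr_ge0.
  have mid x y : 0 <= x -> x <= y -> y <= e -> enorm (dir (Y y) - dir (Y x)) <= Sb y - Sb x.
    move=> x0 xy ye; rewrite SbS// /Y !F'E; [exact: US0| |]; apply/andP; split; lra.
  move=> x y x0 xy; case: (leP y e) => [ye|/ltW ey]; first exact: mid.
  case: (leP e x) => [ex|/ltW xe]; first exact: far.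
  have := mid x e x0 xe (lexx e); have := far e y (lexx e) ey.
  by have := enorm_dist (dir (Y y)) (dir (Y e)) (dir (Y x)); lra.
pose D t := periodize l F (t - s0); pose D' t := periodize l F' (t - s0).
have loc (c : R) : exists (k : int) (r : R), [/\ 0 < r,
    forall t, `|t - c| < r -> D t = F (t + (- s0 - k%:~R * l)) &
    forall t, `|t - c| < r -> D' t = F' (t + (- s0 - k%:~R * l))].
  have [k [r [r0 h]]] := periodize_local (c - s0) e0 el; exists k, r; split=> // t tc.
    by rewrite /D (h _ 0) ?addrA// opprB addrA subrK.
  by rewrite /D' (h _ 0) ?addrA// opprB addrA subrK.
have dD (t : R) : is_derive t 1 D (D' t).
  have [k [r [r0 h h']]] := loc t.
  apply: (@is_derive_local _ _ (fun x => F (x + (- s0 - k%:~R * l))) _ _ r _ r0) => [x xt|].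
    by rewrite h.
  by rewrite h' ?subrr ?normr0//; apply: is_derive_shift.
have cD' : continuous D'.
  move=> t; have [k [r [r0 h h']]] := loc t.
  apply: (@continuous_local V (fun x => F' (x + (- s0 - k%:~R * l))) D' t r r0) => [x xt|].
    by rewrite h'.
  apply: (@continuous_comp _ _ _ (fun x => x + (- s0 - k%:~R * l)) F'); last exact: cF'.
  by apply: cvgD; [exact: cvg_id|exact: cvg_cst].
have cTD : continuous (fun t => enorm (T t + D' t)).
  by move=> t; apply: continuous_enorm; apply: continuous_vadd; [exact: cT|exact: cD'].
have [S _ dS] := antiderivative cTD.
have TDk k t : D' t = F' (t + (- s0 - k%:~R * l)) -> T t + D' t = Y (t + (- s0 - k%:~R * l)).
  move=> ->; rewrite /Y; congr (_ + _).
  rewrite -(periodic_int Tp (- k)) mulrNz; congr T; ring.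
have Smono x y : x <= y -> S x <= S y.
  move=> xy; apply: (derivative_ge0_le xy) (fun t _ => dS t) _ => t _.
    exact: is_derive_rcontinuous (dS t).
  exact: enorm_ge0.
have US x y : x <= y -> enorm (dir (T y + D' y) - dir (T x + D' x)) <= S y - S x.
  move=> xy; apply: (@lipschitz_chain _ _ (fun x => dir (T x + D' x)) S x y xy) => [a b _ ab _|c _].
    exact: Smono.
  have [k [r [r0 _ h']]] := loc c; exists r => // t _ tc.
  set a := - s0 - k%:~R * l in h'.
  have near u v w : `|u - c| < r -> `|v - c| < r -> u <= w <= v -> `|w - c| < r.
    by rewrite !ltr_norml => /andP[u1 u2] /andP[v1 v2] /andP[w1 w2]; apply/andP; split; lra.
  have cc : `|c - c| < r by rewrite subrr normr0.
  have inc u v : `|u - c| < r -> `|v - c| < r -> u <= v -> S v - S u = Sb (v + a) - Sb (u + a).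
    move=> uc vc uv; apply: (@increment_unique S (fun t => Sb (t + a)) (fun t => enorm (T t + D' t))) => // w hw.
    by rewrite (TDk k w (h' w (near u v w uc vc hw))); apply: is_derive_shift.
  rewrite (TDk k t (h' t tc)) (TDk k c (h' c cc)) -/a.
  case: (leP c t) => [ct|/ltW tc'].
    by rewrite inc// ger0_norm; [apply: Gl; lra|apply: le_trans (Gl _ _ _); [exact: enorm_ge0|lra]].
  rewrite enormBC distrC inc// ger0_norm; first by apply: Gl; lra.
  by apply: le_trans (Gl _ _ _); [exact: enorm_ge0|lra].
have := crit D D' S dD cD' _ _ _ dS _.
have -> : S l - S 0 = Sb l - Sb 0.
  have D'p t : D' (t + l) = D' t by rewrite /D' addrAC periodize_periodic.
  (* The speed is periodic, so the period may start at [s0], where the arc begins. *)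
  have e1 : S l - S 0 = S (s0 + l) - S s0.
    have dG (t : R) : is_derive t 1 (fun t => S (t + l) - S t) (0 : R).
      have h := dS (t + l); rewrite Tp D'p in h.
      by have := is_derive_rsub (is_derive_shift h) (dS t); rewrite subrr.
    rewrite -{1}[l]add0r addrC; case: (leP 0 s0) => [h|/ltW h].
      by have /= := derivative0_const h (fun t _ => dG t); rewrite add0r; lra.
    by have /= := derivative0_const h (fun t _ => dG t); rewrite add0r; lra.
  rewrite e1; have := @increment_unique (fun t => S (t + s0)) Sb (fun t => enorm (Y t)) 0 l (ltW l0).
  rewrite /= add0r [s0 + l]addrC => h; apply: h => t /andP[t0 tl] //.
  apply: is_derive_shift; have := dS (t + s0).
  congr (is_derive _ _ _ (enorm _)); rewrite /Y [t + s0]addrC; congr (_ + _).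
  rewrite /D' addrAC subrr add0r; move: tl; rewrite le_eqVlt => /predU1P[->|tl].
    have -> : periodize l F' l = periodize l F' 0 by rewrite -[RHS](periodize_periodic _ _ l0) add0r.
    by rewrite periodize_base ?lexx// F'0// F'e// ltW.
  by rewrite periodize_base// t0.
have : Sb l - Sb 0 = (S0 e - S0 0) + (l - e).
  have h1 := SbS 0 e (lexx 0) (ltW e0) (lexx e); have h2 := Sbout e l (ltW el) (or_intror (lexx e)); lra.
move=> -> h; suff : l <= S0 e - S0 0 + (l - e) by lra.
apply: h.
- by move=> t; rewrite /D addrAC periodize_periodic.
- by move=> t; exact: Fd.
- by move=> t; exact: F'd.
- move=> x y; case: (leP y x) => [yx|/ltW xy].
    by rewrite ger0_norm ?subr_ge0 ?Smono// US.
  by rewrite enormBC distrC ger0_norm ?subr_ge0 ?Smono// US.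
Qed.

End LocalVariation.

(** * Short pieces are Dubins minimizers *)

Section Dubins.
Variables (R : realType) (n : nat).
Notation V := 'rV[R]_n.

Lemma sin_le_id (x : R) : 0 <= x -> sin x <= x.
Proof.
move=> x0.
have := @derivative_ge0_le _ (fun x => x - sin x) (fun x => 1 - cos x) 0 x x0.
have d (t : R) : is_derive t 1 (fun x => x - sin x) (1 - cos t).
  exact: is_derive_rsub (is_derive_rid t) (is_derive_sin t).
rewrite sin0 subrr => h; suff : 0 <= x - sin x by lra.
apply: h => [t _|t _]; first exact: is_derive_rcontinuous (d t).
by have := cos_le1 t; lra.
Qed.

Lemma cos_ge_quadratic (x : R) : 0 <= x -> 1 - x ^+ 2 / 2 <= cos x.
Proof.
move=> x0.
have := @derivative_ge0_le _ (fun x => cos x + x * x / 2) (fun x => - sin x + x) 0 x x0.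
have d (t : R) : is_derive t 1 (fun x => cos x + x * x / 2) (- sin t + t).
  apply: is_derive_radd.
  have := is_derive_rmul (is_derive_rmul (is_derive_rid t) (is_derive_rid t)) (is_derive_rconst 2^-1 t).
  by congr is_derive; rewrite mulr0 addr0; field.
rewrite cos0 mulr0 mul0r addr0 => h; suff : 1 <= cos x + x * x / 2 by rewrite expr2; lra.
apply: h => [t _|t /andP[t0 _]]; first exact: is_derive_rcontinuous (d t).
by have := sin_le_id (ltW t0); lra.
Qed.

Lemma unit_dotv_itv (u v : V) : enorm u = 1 -> enorm v = 1 -> -1 <= dotv u v <= 1.
Proof.
by move=> u1 v1; have := dotv_norm_le u v; rewrite u1 v1 mulr1 ler_norml.
Qed.

Lemma angle_ge_dist (u v : V) : enorm u = 1 -> enorm v = 1 -> enorm (u - v) <= angle u v.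
Proof.
move=> u1 v1; rewrite /angle u1 v1 mulr1 divr1.
have /acos_def[/andP[a0 _] ca] := unit_dotv_itv u1 v1.
have := cos_ge_quadratic a0; rewrite ca [X in _ <= X -> _](dotv_of_dist u1 v1).
move: (acos _) a0 {ca} => a a0 h.
by rewrite -(@ler_pXn2r _ 2)// ?nnegrE ?enorm_ge0//; lra.
Qed.

Lemma angle_le_of_cos (u v : V) (x : R) : enorm u = 1 -> enorm v = 1 -> 0 <= x <= pi ->
  cos x <= dotv u v -> angle u v <= x.
Proof.
move=> u1 v1 xp h; rewrite /angle u1 v1 mulr1 divr1.
have /acos_def[ap ca] := unit_dotv_itv u1 v1.
rewrite leNgt; apply/negP => lt; have : cos (acos (dotv u v)) < cos x by rewrite ltr_cos ?in_itv/=.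
by rewrite ca ltNge h.
Qed.

Lemma lipschitz_gen_curvature (g T : R -> V) (L s : R) : (forall t : R, is_derive t 1 g (T t)) ->
  (forall t, enorm (T t) = 1) -> (forall s t, enorm (T s - T t) <= `|s - t|) ->
  (gen_curvature g L s <= 1%:E)%E.
Proof.
move=> dg T1 Tl; rewrite /gen_curvature (is_derive_derive1 dg).
apply: ge_ereal_inf; eexists; first by exists 1 => //=; exact: ltr01.
apply: ge_ereal_sup => x [t [u [_ [_ [tu [ts [us ->]]]]]]].
rewrite lee_fin ler_pdivrMr ?normr_gt0 ?subr_eq0 1?eq_sym// mul1r.
have tupi : `|u - t| <= pi.
  have h2 := @pi_ge2 R; rewrite ler_norml; move: ts us; rewrite !ltr_norml.
  by move=> /andP[? ?] /andP[? ?]; apply/andP; split; lra.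
apply: angle_le_of_cos => //; first by rewrite normr_ge0.
have := @lipschitz_cone _ _ T 1 ltr01 T1 _ t u; rewrite !mul1r distrC => /(_ _ tupi) h.
rewrite cos_norm -cosN opprB; apply: h => ? ?; rewrite mul1r; exact: Tl.
Qed.

(** A limsup at most [1] gives, for every [e' > 0], a bound [1 + e'] near each point. It is applied
    between [x] and the centre [c] only, chained over [[a, b]], and [e'] is sent to [0]. *)
Lemma gen_curvature_lipschitz (g : R -> V) (L a b : R) :
  (forall s, 0 <= s <= L -> enorm (derive1 g s) = 1) ->
  (forall s, 0 <= s <= L -> (gen_curvature g L s <= 1%:E)%E) ->
  0 <= a -> a <= b -> b <= L -> enorm (derive1 g b - derive1 g a) <= b - a.
Proof.
move=> g1 gc a0 ab bL; apply/ler_addgt0Pr => e e0.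
have [e' e'0 he'] : exists2 e', 0 < e' & e' * (b - a) <= e.
  exists (e / (b - a + 1)); first by rewrite divr_gt0//; lra.
  by rewrite mulrAC ler_pdivrMr; [nra|lra].
suff : enorm (derive1 g b - derive1 g a) <= (1 + e') * b - (1 + e') * a by lra.
apply: (@lipschitz_chain _ _ (derive1 g) (fun x => (1 + e') * x)) => // [x y ax xy yb|c /andP[ac cb]].
  by rewrite ler_pM2l//; lra.
have cL : 0 <= c <= L by apply/andP; split; lra.
have : (gen_curvature g L c < (1 + e')%:E)%E.
  by apply: le_lt_trans (gc c cL) _; rewrite lte_fin; lra.
move=> /ereal_inf_lt[y [d /= d0 <-] hd]; exists d => // x /andP[ax xb] xc.
have xL : 0 <= x <= L by apply/andP; split; lra.
have [->|xnc] := eqVneq x c; first by rewrite !subrr enorm0 normr0.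
apply: le_trans (angle_ge_dist (g1 x xL) (g1 c cL)) _.
rewrite -mulrBr normrM (gtr0_norm (x := 1 + e')); last by lra.
rewrite -ler_pdivrMr ?normr_gt0 ?subr_eq0// -lee_fin ltW//.
apply: le_lt_trans _ hd; apply: ereal_sup_ubound.
by exists x, c; rewrite subrr normr0 (distrC c); do 5 split => //.
Qed.

(** A shorter curve [b] with the same end data, run over [[0, e]] through a reparametrization [phi],
    differs from [g] by a small variation [E]. Its direction is [b'] at [phi] and its arclength is
    [phi], so the curvature condition is that of [b], and criticality forbids the gain in length. *)
Lemma critical_short_dubins (g T : R -> V) (l : R) : 0 < l -> (forall t, g (t + l) = g t) ->
  (forall t : R, is_derive t 1 g (T t)) -> (forall t, enorm (T t) = 1) ->
  (forall s t, enorm (T s - T t) <= `|s - t|) -> length_critical T l ->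
  exists2 e : R, 0 < e & forall s0,
    dubins_minimizer (g s0) (g (s0 + e)) (T s0) (T (s0 + e)) e (fun x => g (s0 + x)).
Proof.
move=> l0 gp dg T1 Tl crit.
have cT : continuous T by apply: (@unit_lipschitz_continuous _ _ _ 1) => // s t; rewrite mul1r.
have Tp := periodic_derivative dg gp.
have [d d0 var] := local_variation l0 Tp T1 Tl crit.
(* [4^-1] keeps [phi'] at least one half. In the bound for [E'] the term [2 k] and the two tangent
   drifts, each at most [e <= d / 4], add up to less than [d]. *)
pose k := Num.min 4^-1 (d / 8).
have k0 : 0 < k by rewrite /k lt_min divr_gt0// invr_gt0 ltr0n.
have [k4 k8] : k <= 4^-1 /\ k <= d / 8.
  by have : k <= k by []; rewrite {2}/k le_min => /andP[].
have /is_derive_epsP hsin := is_derive_sin (0 : R); have [rs rs0 hs] := hsin k k0.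
pose e := Num.min (Num.min (rs / 2) 1) (Num.min (l / 2) (d / 4)).
have e0 : 0 < e by rewrite /e !lt_min !divr_gt0 ?ltr01.
have : e <= e by []; rewrite {2}/e !le_min => /andP[/andP[ers e1] /andP[el ed]].
have sine : (1 - k) * e <= sin e.
  have := hs e; rewrite subr0 gtr0_norm// sin0 cos0 !subr0 [_ *: 1]mulr1 ler_norml.
  by move=> h; have /h /andP[] : e < rs; lra.
exists e => // s0.
have dgs (t : R) : is_derive t 1 (fun x => g (s0 + x)) (T (s0 + t)).
  have := is_derive_comp (is_derive_radd (is_derive_rconst s0 t) (is_derive_rid t)) (dg (s0 + t)).
  by rewrite add0r scale1r.
have cTs : continuous (fun t => T (s0 + t)).
  move=> t; apply: (@continuous_comp _ _ _ (fun t => s0 + t) T); last exact: cT.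
  by apply: cvgD; [exact: cvg_cst|exact: cvg_id].
have Tsl s t : enorm (T (s0 + s) - T (s0 + t)) <= `|s - t|.
  by apply: le_trans (Tl _ _) _; rewrite opprD addrACA subrr add0r.
split.
  split; first exact: ltW.
  split; first exact: C1curveI dgs cTs.
  rewrite (is_derive_derive1 dgs) addr0; do 5 split => //.
  by move=> s _; apply: lipschitz_gen_curvature dgs _ Tsl.
move=> L' b [L'0 [bC1 [b1 [b_0 [b_L [b'0 [b'L bcurv]]]]]]]; rewrite leNgt; apply/negP => L'e.
have bl := gen_curvature_lipschitz b1 bcurv.
have db (t : R) : is_derive t 1 b (derive1 b t) by exact: C1curve_is_derive.
(* Both curves have the same chord, which is at least [sin e]; so [L'] is close to [e] and [phi']
   will be close to [1]. *)
have hL' : (1 - k) * e <= L'.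
  apply: le_trans sine _.
  have h1 : sin e <= enorm (g (s0 + e) - g s0).
    have := @chord_forward _ _ g T 1 s0 e ltr01 dg T1; rewrite !mul1r divr1.
    move=> h; apply: (@le_trans _ _ (dotv (g (s0 + e) - g s0) (T s0))).
      by apply: h => [s t||]; [rewrite mul1r|exact: ltW|have := @pi_ge2 R; lra].
    by apply: le_trans (dotv_le _ _) _; rewrite T1 mulr1.
  apply: le_trans h1 _; rewrite -b_0 -b_L -[leRHS]subr0.
  apply: (@mean_value_enorm _ _ b (derive1 b) id (fun=> 1)) => // [t _|t _|t /andP[t0 tL]].
  - exact: is_derive_continuous (db t).
  - exact: cvg_id.
  - by rewrite b1// !ltW.
pose h := (e - L') / e.
have he : h * e = e - L' by rewrite /h divfK// gt_eqF.
have h0 : 0 < h by rewrite divr_gt0// subr_gt0.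
have hk : h <= k by rewrite ler_pdivrMr//; lra.
(* The identity minus [e - L'] times a cubic smoothstep: [phi] maps [[0, e]] onto [[0, L']] with
   [phi' = 1] at both ends, so that [E] and [E'] vanish there. *)
pose phi x := x - h * (3 * e^-1 * (x * x) - 2 * e^-1 ^+ 2 * (x * (x * x))).
pose phi' x := 1 - h * (6 * e^-1 * x - 6 * e^-1 ^+ 2 * (x * x)).
have ie : e * e^-1 = 1 by rewrite mulfV// gt_eqF.
have dphi (t : R) : is_derive t 1 phi (phi' t).
  have i := is_derive_rid t; have i2 := is_derive_rmul i i; have i3 := is_derive_rmul i i2.
  have c c := is_derive_rconst c t.
  have := is_derive_rsub i (is_derive_rmul (c h) (is_derive_rsub (is_derive_rmul (c (3 * e^-1)) i2)
    (is_derive_rmul (c (2 * e^-1 ^+ 2)) i3))).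
  by congr is_derive; rewrite /phi'; ring.
have phi0 : phi 0 = 0 by rewrite /phi !(mulr0, subr0).
have phie : phi e = L'.
  rewrite /phi (_ : 3 * _ * _ - _ = e); first by rewrite he; ring.
  by field; rewrite gt_eqF.
have phi'0 : phi' 0 = 1 by rewrite /phi' !(mulr0, subr0).
have phi'e : phi' e = 1.
  by rewrite /phi'; field; rewrite gt_eqF.
have phi'b t : 0 <= t <= e -> 1 - 2 * k <= phi' t <= 1.
  move=> /andP[t0 te]; pose y := t / e.
  have y0 : 0 <= y by rewrite divr_ge0// ltW.
  have y1 : y <= 1 by rewrite ler_pdivrMr// mul1r.
  have -> : phi' t = 1 - h * (6 * y - 6 * (y * y)) by rewrite /phi' /y; ring.
  have q0 : 0 <= 6 * y - 6 * (y * y) by nra.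
  have q1 : 6 * y - 6 * (y * y) <= 2 by have := sqr_ge0 (2 * y - 1); nra.
  have p1 : 0 <= h * (6 * y - 6 * (y * y)) by rewrite mulr_ge0// ltW.
  have p2 : h * (6 * y - 6 * (y * y)) <= k * 2 by rewrite ler_pM// ltW.
  by apply/andP; split; lra.
have phimono x y : 0 <= x -> x <= y -> y <= e -> phi x <= phi y.
  move=> x0 xy ye; apply: (derivative_ge0_le xy) (fun t _ => dphi t) _ => t /andP[xt ty].
    exact: is_derive_rcontinuous (dphi t).
  by have /phi'b : 0 <= t <= e; [apply/andP; split; lra|lra].
have phib t : 0 <= t <= e -> 0 <= phi t <= L'.
  by move=> /andP[t0 te]; rewrite -{1}phi0 -phie !phimono.
have phile t : 0 <= t <= e -> phi t <= t.
  move=> /andP[t0 te]; have := @derivative_ge0_le _ (fun x => x - phi x) (fun x => 1 - phi' x) 0 t t0.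
  have dd (x : R) : is_derive x 1 (fun x => x - phi x) (1 - phi' x) by exact: is_derive_rsub.
  rewrite phi0 subrr => m; suff : 0 <= t - phi t by lra.
  apply: m => [x _|x /andP[x0 xt]]; first exact: is_derive_rcontinuous (dd x).
  by have /phi'b : 0 <= x <= e; [apply/andP; split; lra|lra].
pose E t := b (phi t) - g (s0 + t).
pose E' t := phi' t *: derive1 b (phi t) - T (s0 + t).
have dE (t : R) : is_derive t 1 E (E' t).
  by apply: is_derive_sub; apply: is_derive_comp.
have cphi' : continuous phi'.
  move=> t; apply: cvgB; first exact: cvg_cst.
  apply: cvgM; first exact: cvg_cst.
  apply: cvgB; apply: cvgM; try exact: cvg_cst; try exact: cvg_id.
  by apply: cvgM; exact: cvg_id.
have cE' : continuous E'.
  move=> t; apply: continuous_vsub; last exact: cTs.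
  apply: continuous_scale; first exact: cphi'.
  apply: (@continuous_comp _ _ _ phi (derive1 b)); first exact: is_derive_rcontinuous (dphi t).
  exact: (bC1.2).
have E'd t : 0 <= t <= e -> enorm (E' t) <= d.
  move=> te; have /andP[p1 p2] := phi'b t te; have /andP[q1 q2] := phib t te; have q3 := phile t te.
  have -> : E' t = (phi' t - 1) *: derive1 b (phi t) + (derive1 b (phi t) - derive1 b 0) + (T (s0 + 0) - T (s0 + t)).
    by rewrite /E' b'0 addr0; apply/rowP => j; rewrite !mxE; ring.
  have n1 : enorm ((phi' t - 1) *: derive1 b (phi t)) <= 2 * k.
    rewrite enormZ b1 ?q1// mulr1 ler_norml; apply/andP; split; lra.
  have n2 : enorm (derive1 b (phi t) - derive1 b 0) <= phi t by have := bl 0 (phi t) (lexx 0) q1 q2; rewrite subr0.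
  have n3 : enorm (T (s0 + 0) - T (s0 + t)) <= t.
    apply: le_trans (Tsl _ _) _; rewrite sub0r normrN ger0_norm//; by case/andP: te.
  have m1 := enormD ((phi' t - 1) *: derive1 b (phi t) + (derive1 b (phi t) - derive1 b 0)) (T (s0 + 0) - T (s0 + t)).
  have m2 := enormD ((phi' t - 1) *: derive1 b (phi t)) (derive1 b (phi t) - derive1 b 0).
  case/andP: te => t0 te; lra.
have E0 : E 0 = 0 by rewrite /E phi0 b_0 addr0 subrr.
have Ed t : 0 <= t <= e -> enorm (E t) <= d.
  move=> /andP[t0 te]; rewrite -[E t]subr0 -E0.
  apply: (@le_trans _ _ (d * t - d * 0)); last by rewrite mulr0 subr0 ler_piMr ?(le_trans te e1)// ltW.
  have ddt (x : R) : is_derive x 1 (fun t => d * t) d.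
    by have := is_derive_rmul (is_derive_rconst d x) (is_derive_rid x); rewrite mul0r add0r mulr1.
  apply: (@mean_value_enorm _ _ E E' (fun t => d * t) (fun=> d)) => // [x _|x _|x /andP[x0 xt]].
  - exact: is_derive_continuous (dE x).
  - exact: is_derive_rcontinuous (ddt x).
  - by apply: E'd; apply/andP; split; lra.
have TE t : T (s0 + t) + E' t = phi' t *: derive1 b (phi t) by rewrite addrC subrK.
suff : e <= phi e - phi 0 by rewrite phie phi0; lra.
apply: (var s0 e E E' phi e0) => //.
- lra.
- by rewrite /E' phi'0 phi0 b'0 scale1r addr0 subrr.
- by rewrite /E phie b_L subrr.
- by rewrite /E' phi'e phie b'L scale1r subrr.
- move=> t te; rewrite TE enormZ b1 ?phib// mulr1 ger0_norm//.
  by have /andP[p1 p2] := phi'b t te; lra.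
- move=> x y x0 xy ye; have xe : 0 <= x <= e by apply/andP; split; lra.
  have ye' : 0 <= y <= e by apply/andP; split; lra.
  have /andP[px _] := phi'b x xe; have /andP[py _] := phi'b y ye'.
  rewrite !TE !dirZ ?dir_unit ?b1 ?phib//; try lra.
  have /andP[qx _] := phib x xe; have /andP[_ qy] := phib y ye'.
  by apply: bl => //; exact: phimono.
Qed.

End Dubins.

(** * Curves with positive torsion *)

Section SmoothCase.
Variables (R : realType) (n : nat).
Notation V := 'rV[R]_n.

Lemma derive1_val (f : R -> V) (t : R) (d : V) : is_derive t 1 f d -> derive1 f t = d.
Proof. by move=> h; rewrite derive1E; exact: derive_val. Qed.

Lemma is_derive_dir (Y : R -> V) (Y1 : V) (x : R) : is_derive x 1 Y Y1 -> Y x != 0 ->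
  is_derive x 1 (fun t => dir (Y t))
    ((enorm (Y x))^-1 *: (Y1 - (dotv (Y x) Y1 / enorm (Y x) ^+ 2) *: Y x)).
Proof.
move=> dY Y0; have e0 : enorm (Y x) != 0 by rewrite enorm_eq0.
have dE : is_derive x 1 (fun t => (enorm (Y t))^-1) (- (enorm (Y x)) ^- 2 * (dotv (Y x) Y1 / enorm (Y x))).
  by have dY' := is_derive_enorm dY Y0; apply: is_deriveV.
have := is_derive_scale dE dY.
congr is_derive; rewrite scalerBr scalerA addrC; congr (_ + _).
rewrite -scaleNr; congr (_ *: _); by field.
Qed.

(** The derivative of [dir Y] is the part of [Y1] orthogonal to [Y], divided by [|Y|]; it has to
    stay below the speed [|Y|] of [S]. *)
Lemma piece_lipschitz (Y Y1 : R -> V) (S : R -> R) (p q : R) : p <= q ->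
  (forall x, p <= x <= q -> is_derive x 1 Y (Y1 x)) ->
  (forall x, p <= x <= q -> is_derive x 1 S (enorm (Y x))) ->
  (forall x, p <= x <= q -> Y x != 0) ->
  (forall x, p <= x <= q -> enorm (Y1 x) <= enorm (Y x) ^+ 2) ->
  enorm (dir (Y q) - dir (Y p)) <= S q - S p.
Proof.
move=> pq dY dS Y0 hY; have oc x : p < x < q -> p <= x <= q by case/andP=> /ltW -> /ltW ->.
apply: (@mean_value_enorm _ _ (fun x => dir (Y x)) _ S (fun x => enorm (Y x)) p q pq) => [x h|x h|x /oc h|x /oc h|x /oc h].
- exact: is_derive_continuous (is_derive_dir (dY x h) (Y0 x h)).
- exact: is_derive_rcontinuous (dS x h).
- exact: is_derive_dir (dY x h) (Y0 x h).
- exact: dS.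
have e0 : 0 < enorm (Y x) by rewrite enorm_gt0 Y0.
have e0' : enorm (Y x) != 0 by rewrite gt_eqF.
rewrite enormZ gtr0_norm ?invr_gt0// ler_pdivrMl// -expr2.
apply: le_trans (hY x h).
rewrite -(@ler_pXn2r _ 2)// ?nnegrE ?enorm_ge0// [leLHS]enorm_sq [leRHS]enorm_sq.
set b := dotv (Y x) (Y1 x) / _; rewrite !dotvS (dotvC (Y1 x) (Y x)).
have hb : b * (b * dotv (Y x) (Y x)) = b * dotv (Y x) (Y1 x).
  by congr (_ * _); rewrite /b -enorm_sq divfK// expf_neq0.
have : 0 <= b * dotv (Y x) (Y1 x) by rewrite /b mulrAC -expr2 divr_ge0 ?sqr_ge0.
lra.
Qed.

(** After squaring, the first-order terms are [2 e <N, Z1>] on the left and [4 e <T, Z>] on the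
    right; the reserve [k] between them absorbs [e^2 |Z1|^2]. *)
Lemma variation_curvature (T N Z Z1 : V) (k e : R) : enorm T = 1 -> enorm N = 1 -> 0 <= e ->
  dotv N Z1 - 2 * dotv T Z <= - k -> e * enorm Z1 ^+ 2 <= 2 * k -> 2 * e * enorm Z <= 1 ->
  enorm (N + e *: Z1) <= enorm (T + e *: Z) ^+ 2.
Proof.
move=> T1 N1 e0 h1 h2 h3.
rewrite -(@ler_pXn2r _ 2)// ?nnegrE ?enorm_ge0 ?exprn_ge0 ?enorm_ge0//.
rewrite !enorm_sq !dotvS (dotvC Z1 N) (dotvC Z T) -!enorm_sq T1 N1 !expr1n.
set a := dotv N Z1 in h1 *; set b := dotv T Z in h1 *.
have hb : - enorm Z <= b.
  by have := dotv_norm_le T Z; rewrite T1 mul1r ler_norml => /andP[].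
have z0 := enorm_ge0 Z; have z1 := sqr_ge0 (enorm Z).
have b0 : 0 <= 1 + 2 * e * b.
  have : 2 * e * - enorm Z <= 2 * e * b by rewrite ler_wpM2l// mulr_ge0.
  lra.
apply: (@le_trans _ _ ((1 + 2 * e * b) ^+ 2)).
  have m1 : e * (e * enorm Z1 ^+ 2) <= e * (2 * k) by rewrite ler_wpM2l.
  have m2 : e * (a - 2 * b) <= e * - k by rewrite ler_wpM2l.
  have m3 : 0 <= (e * b) ^+ 2 by rewrite sqr_ge0.
  by rewrite expr2; move: m3; rewrite expr2; lra.
have m4 : 0 <= e * (e * enorm Z ^+ 2) by rewrite !mulr_ge0.
by rewrite ler_pXn2r ?nnegrE//; lra.
Qed.

Lemma variation_speed (T Z : V) (e : R) : enorm T = 1 ->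
  enorm (T + e *: Z) <= 1 + e * dotv T Z + e ^+ 2 * enorm Z ^+ 2 / 2.
Proof.
move=> T1; set c := enorm _; have c0 : 0 <= c by exact: enorm_ge0.
have : c ^+ 2 = 1 + 2 * (e * dotv T Z) + e ^+ 2 * enorm Z ^+ 2.
  rewrite /c enorm_sq !dotvS (dotvC Z T) -!enorm_sq T1; ring.
by have := sqr_ge0 (c - 1); rewrite !expr2; lra.
Qed.

(** [N1 + T] is the torsion vector [N' + kappa T] at curvature [1]. *)
Definition smooth_at (T : R -> V) (s : R) : Prop :=
  exists (N N1 N2 : R -> V) (r : R), 0 < r /\ forall x, `|x - s| < r ->
    [/\ is_derive x 1 T (N x), is_derive x 1 N (N1 x), is_derive x 1 N1 (N2 x),
        continuous_at x N2 & enorm (N x) = 1 /\ N1 x + T x != 0].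

(** Uniqueness of derivatives identifies the local data with the iterated [derive1] of [T], which
    are global functions. *)
Lemma smooth_everywhere (T : R -> V) : (forall s, smooth_at T s) -> exists N N1 N2 : R -> V,
  [/\ forall x : R, is_derive x 1 T (N x), forall x : R, is_derive x 1 N (N1 x),
      forall x : R, is_derive x 1 N1 (N2 x), continuous N2 &
      forall x, enorm (N x) = 1 /\ N1 x + T x != 0].
Proof.
move=> h; have sub s (x y r : R) : `|x - s| < r -> `|y - x| < r - `|x - s| -> `|y - s| < r.
  by move=> _ hy; have := ler_distD x y s; lra.
have e1 (s : R) (N N1 N2 : R -> V) (r : R) : 0 < r -> (forall x : R, `|x - s| < r ->
    [/\ is_derive x 1 T (N x), is_derive x 1 N (N1 x), is_derive x 1 N1 (N2 x),
        continuous_at x N2 & enorm (N x) = 1 /\ N1 x + T x != 0]) ->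
  [/\ forall x, `|x - s| < r -> derive1 T x = N x,
      forall x, `|x - s| < r -> derive1 (derive1 T) x = N1 x &
      forall x, `|x - s| < r -> derive1 (derive1 (derive1 T)) x = N2 x].
  move=> r0 hx.
  have a1 x : `|x - s| < r -> derive1 T x = N x by move=> /hx[? _ _ _ _]; exact: derive1_val.
  have a2 x : `|x - s| < r -> derive1 (derive1 T) x = N1 x.
    move=> xs; have [_ d _ _ _] := hx x xs; apply: derive1_val.
    apply: (is_derive_local (r := r - `|x - s|)) d; first by rewrite subr_gt0.
    by move=> y /(sub _ _ _ _ xs) /a1.
  split=> // x xs; have [_ _ d _ _] := hx x xs; apply: derive1_val.
  apply: (is_derive_local (r := r - `|x - s|)) d; first by rewrite subr_gt0.
  by move=> y /(sub _ _ _ _ xs) /a2.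
have ss (s r : R) : 0 < r -> `|s - s| < r by rewrite subrr normr0.
exists (derive1 T), (derive1 (derive1 T)), (derive1 (derive1 (derive1 T))).
split=> s; have [N [N1 [N2 [r [r0 hr]]]]] := h s; have [a1 a2 a3] := e1 s N N1 N2 r r0 hr;
  have [d1 d2 d3 c [u v]] := hr s (ss s r r0).
- by rewrite a1 ?ss.
- rewrite a2 ?ss//; apply: (is_derive_local r0) d2 => x /a1 //.
- rewrite a3 ?ss//; apply: (is_derive_local r0) d3 => x /a2 //.
- apply: (@continuous_local _ V N2 _ s r r0) => // x /a3 //.
- by rewrite a1 ?a2 ?ss.
Qed.

Lemma unit_derivative_orth (f : R -> V) (d : V) (t : R) : (forall x, enorm (f x) = 1) ->
  is_derive t 1 f d -> dotv (f t) d = 0.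
Proof.
move=> f1 df; have := is_derive_dotv df df.
rewrite (_ : (fun x => _) = fun=> 1); last by apply/funext => x; rewrite -enorm_sq f1 expr1n.
by move=> /is_derive_unique /(_ (is_derive_rconst 1 t)); rewrite dotvC; lra.
Qed.

Lemma smooth_not_critical (g T : R -> V) (l : R) : 0 < l -> (forall t, g (t + l) = g t) ->
  (forall t : R, is_derive t 1 g (T t)) -> (forall t, enorm (T t) = 1) ->
  (forall s, smooth_at T s) -> ~ length_critical T l.
Proof.
move=> l0 gp dg T1 /smooth_everywhere[N [N1 [N2 [dT dN dN1 cN2 h]]]] [d d0 crit].
have Tp := periodic_derivative dg gp; have Np := periodic_derivative dT Tp.
have N1p := periodic_derivative dN Np; have N2p := periodic_derivative dN1 N1p.
have Nu x : enorm (N x) = 1 by case: (h x).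
have cg x : continuous_at x g := is_derive_continuous (dg x).
have cT x : continuous_at x T := is_derive_continuous (dT x).
have cN x : continuous_at x N := is_derive_continuous (dN x).
have cN1 x : continuous_at x N1 := is_derive_continuous (dN1 x).
have TN x : dotv (T x) (N x) = 0 := unit_derivative_orth T1 (dT x).
have NN1 x : dotv (N x) (N1 x) = 0 := unit_derivative_orth Nu (dN x).
have dconst0 (f f1 f2 f3 : R -> V) x : (forall x, dotv (f x) (f2 x) = 0) -> is_derive (x : R) 1 f (f1 x) ->
    is_derive x 1 f2 (f3 x) -> dotv (f1 x) (f2 x) + dotv (f x) (f3 x) = 0.
  move=> z d1 d2; have := is_derive_dotv d1 d2.
  rewrite (_ : (fun x => _) = fun=> 0); last exact/funext.
  by move=> /is_derive_unique /(_ (is_derive_rconst 0 x)).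
have TN1 x : dotv (T x) (N1 x) = -1.
  by have := dconst0 _ _ _ _ x TN (dT x) (dN x); rewrite -enorm_sq Nu expr1n; lra.
have NN2 x : dotv (N x) (N2 x) = - dotv (N1 x) (N1 x).
  by have := dconst0 _ _ _ _ x NN1 (dN x) (dN1 x); lra.
pose tau x := enorm (N1 x + T x).
have tauE x : tau x ^+ 2 = dotv (N1 x) (N1 x) - 1.
  by rewrite /tau enorm_sq !dotvS (dotvC (N1 x)) TN1 -(enorm_sq (T x)) T1 expr1n; ring.
have ctau : continuous tau.
  by move=> x; apply: continuous_enorm; apply: continuous_vadd; [exact: cN1|exact: cT].
have taup x : tau (x + l) = tau x by rewrite /tau N1p Tp.
have [x0 [x1 htau]] := periodic_bounds l0 ctau taup.
set c := tau x0 in htau.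
have c0 : 0 < c by rewrite /c /tau enorm_gt0; case: (h x0).
have htau2 x : c ^+ 2 <= tau x ^+ 2.
  by rewrite ler_pXn2r ?nnegrE ?enorm_ge0//; case: (htau x).
have c20 : 0 < c ^+ 2 by rewrite exprn_gt0.
(* Shortening needs [<T, Z> = k - 1] negative, and the curvature needs
   [<N, Z1> - 2 <T, Z> = 1 - tau^2 - k] negative. So [k] must lie between [1 - c^2] and [1]; this is
   the midpoint. *)
pose k := 1 - c ^+ 2 / 2.
pose Z x := N1 x + k *: T x; pose Z1 x := N2 x + k *: N x; pose W x := N x + k *: g x.
have cZ x : continuous_at x Z.
  by apply: continuous_vadd; [exact: cN1|apply: continuous_scale; [exact: cvg_cst|exact: cT]].
have cZ1 x : continuous_at x Z1.
  by apply: continuous_vadd; [exact: cN2|apply: continuous_scale; [exact: cvg_cst|exact: cN]].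
have cW x : continuous_at x W.
  by apply: continuous_vadd; [exact: cN|apply: continuous_scale; [exact: cvg_cst|exact: cg]].
have bd (F : R -> V) : (forall x, continuous_at x F) -> (forall x, F (x + l) = F x) ->
    exists2 M, 0 <= M & forall x, enorm (F x) <= M.
  move=> cF Fp; have [] := @periodic_bounds _ (fun x => enorm (F x)) l l0 (fun x => continuous_enorm (cF x)).
    by move=> x; rewrite Fp.
  by move=> a [b hb]; exists (enorm (F b)) => [|x]; [exact: enorm_ge0|case: (hb x)].
have [M1 M10 hM1] : exists2 M, 0 <= M & forall x, enorm (Z x) <= M.
  by apply: bd => // x; rewrite /Z N1p Tp.
have [M2 M20 hM2] : exists2 M, 0 <= M & forall x, enorm (Z1 x) <= M.
  by apply: bd => // x; rewrite /Z1 N2p Np.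
have [M3 M30 hM3] : exists2 M, 0 <= M & forall x, enorm (W x) <= M.
  by apply: bd => // x; rewrite /W Np gp.
have TZ x : dotv (T x) (Z x) = - (c ^+ 2 / 2).
  by rewrite /Z !dotvS TN1 -(enorm_sq (T x)) T1 /k; ring.
have NZ x : dotv (N x) (Z1 x) - 2 * dotv (T x) (Z x) <= - (c ^+ 2 / 2).
  rewrite TZ /Z1 !dotvS NN2 -(enorm_sq (N x)) Nu /k expr1n mulr1.
  by have := htau2 x; rewrite tauE; lra.
pose M := M1 + M2 + M3 + 1.
have M_0 : 1 <= M by rewrite /M; lra.
have [e [e0 ed eM ec]] : exists e, [/\ 0 < e, e * M <= d, e * M <= 4^-1 & 2 * (e * M ^+ 2) <= c ^+ 2 / 2].
  exists (Num.min (Num.min (d / M) (4^-1 / M)) (c ^+ 2 / 2 / (2 * M ^+ 2))).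
  have M0 : 0 < M by lra.
  have M2' : 0 < 2 * M ^+ 2 by rewrite mulr_gt0 ?exprn_gt0.
  set e := Num.min _ _; have : e <= e by [].
  rewrite {2}/e !le_min !ler_pdivlMr// => /andP[/andP[a1 a2] a3].
  have e0 : 0 < e by rewrite /e !lt_min !divr_gt0 ?invr_gt0.
  by split=> //; lra.
have eMl x : x <= M -> e * x <= e * M by move=> xM; rewrite ler_pM2l.
have m1 : M1 <= M by rewrite /M; lra.
have m2 : M2 <= M by rewrite /M; lra.
have m3 : M3 <= M by rewrite /M; lra.
have dY (x : R) : is_derive x 1 (fun x => T x + e *: Z x) (N x + e *: Z1 x).
  by do 2 (apply: is_derive_add => //; apply: is_derive_scalel).
have cY : continuous (fun x => enorm (T x + e *: Z x)).
  by move=> x; apply: continuous_enorm; exact: is_derive_continuous (dY x).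
have [S _ dS] := antiderivative cY.
have eZ x : enorm (e *: Z x) <= 4^-1.
  by rewrite enormZ gtr0_norm//; have := eMl _ (le_trans (hM1 x) m1); lra.
have Y0 x : T x + e *: Z x != 0.
  rewrite -enorm_eq0 gt_eqF//; have := enorm_lerB (T x) (- (e *: Z x)).
  by rewrite opprK enormN T1; have := eZ x; lra.
have Y1 x : enorm (N x + e *: Z1 x) <= enorm (T x + e *: Z x) ^+ 2.
  apply: (@variation_curvature _ _ _ _ (c ^+ 2 / 2)) => //; first exact: ltW.
    have : e * enorm (Z1 x) ^+ 2 <= e * M ^+ 2.
      by rewrite ler_pM2l// ler_pXn2r ?nnegrE ?enorm_ge0//; have := hM2 x; lra.
    have : 0 <= e * M ^+ 2 by rewrite mulr_ge0 ?sqr_ge0// ltW.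
    lra.
  by have := eMl _ (le_trans (hM1 x) m1); lra.
have Sl x y : x <= y -> enorm (dir (T y + e *: Z y) - dir (T x + e *: Z x)) <= S y - S x.
  move=> xy; apply: (@piece_lipschitz (fun x => T x + e *: Z x) (fun x => N x + e *: Z1 x) S x y xy) => z _ //.
have Sx x y : x <= y -> S x <= S y.
  by move=> xy; have := le_trans (enorm_ge0 _) (Sl x y xy); rewrite subr_ge0.
have := crit (fun x => e *: W x) (fun x => e *: Z x) S.
have : S l - S 0 < l.
  have sp x : enorm (T x + e *: Z x) <= 1 - e * (c ^+ 2 / 4).
    apply: le_trans (variation_speed _ _ (T1 x)) _; rewrite TZ.
    have : e ^+ 2 * enorm (Z x) ^+ 2 <= e * (e * M ^+ 2).
      rewrite expr2 -mulrA ler_pM2l// ler_pM2l// ler_pXn2r ?nnegrE ?enorm_ge0//; have := hM1 x; lra.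
    have : e * (2 * (e * M ^+ 2)) <= e * (c ^+ 2 / 2) by rewrite ler_pM2l.
    have : 0 <= e * c ^+ 2 by rewrite mulr_ge0// ltW.
    lra.
  have := @derivative_ge0_le _ (fun x => (1 - e * (c ^+ 2 / 4)) * x - S x)
    (fun x => 1 - e * (c ^+ 2 / 4) - enorm (T x + e *: Z x)) 0 l (ltW l0).
  have dd (x : R) : is_derive x 1 (fun x => (1 - e * (c ^+ 2 / 4)) * x - S x)
     (1 - e * (c ^+ 2 / 4) - enorm (T x + e *: Z x)).
    apply: is_derive_rsub => //.
    by have := is_derive_rmul (is_derive_rconst (1 - e * (c ^+ 2 / 4)) x) (is_derive_rid x); rewrite mul0r add0r mulr1.
  move=> /(_ (fun x _ => is_derive_rcontinuous (dd x)) (fun x _ => dd x)) hS.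
  have {}hS : (1 - e * (c ^+ 2 / 4)) * 0 - S 0 <= (1 - e * (c ^+ 2 / 4)) * l - S l.
    by apply: hS => x _; rewrite subr_ge0.
  have : 0 < e * (c ^+ 2 / 4) * l by rewrite !mulr_gt0// divr_gt0.
  lra.
move=> Slt hl; suff : l <= S l - S 0 by lra.
apply: hl => //.
- by move=> x; apply: continuous_scale; [exact: cvg_cst|exact: cZ].
- by move=> x; rewrite /W Np gp.
- by move=> x; rewrite enormZ gtr0_norm//; have := eMl _ (le_trans (hM3 x) m3); lra.
- by move=> x; rewrite enormZ gtr0_norm//; have := eMl _ (le_trans (hM1 x) m1); lra.
- move=> x y; case: (leP y x) => [yx|/ltW xy].
    by rewrite ger0_norm ?subr_ge0 ?Sx// Sl.
  by rewrite enormBC distrC ger0_norm ?subr_ge0 ?Sx// Sl.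
Qed.

End SmoothCase.

(** * Variation of an arc *)

Section ArcVariation.
Variables (R : realType) (n : nat).
Notation V := 'rV[R]_n.

(** The tangent of a unit circle; [rotv v (- u)] is then its normal. *)
Definition rotv (u v : V) (x : R) : V := cos x *: u + sin x *: v.

Definition orthopair (u v : V) : Prop := [/\ enorm u = 1, enorm v = 1 & dotv u v = 0].

Lemma orthopair_turn u v : orthopair u v -> orthopair v (- u).
Proof. by case=> u1 v1 uv; split=> //; rewrite ?enormN// dotvNr dotvC uv oppr0. Qed.

Lemma rotv_turn2 u v x : rotv (- u) (- v) x = - rotv u v x.
Proof. by rewrite /rotv !scalerN opprD. Qed.

Lemma rotv_derive u v (x : R) : is_derive x 1 (rotv u v) (rotv v (- u) x).
Proof.
have := is_derive_add (is_derive_scale (is_derive_cos x) (is_derive_const u x))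
  (is_derive_scale (is_derive_sin x) (is_derive_const v x)).
by congr is_derive; rewrite /rotv !scaler0 !addr0 scaleNr scalerN addrC.
Qed.

Lemma rotv_dotv u v x : orthopair u v -> dotv (rotv u v x) (rotv v (- u) x) = 0.
Proof.
case=> u1 v1 uv; rewrite /rotv !dotvS (dotvC v u) uv -!enorm_sq u1 v1; ring.
Qed.

Lemma rotv_sq u v x : orthopair u v -> dotv (rotv u v x) (rotv u v x) = 1.
Proof.
case=> u1 v1 uv; rewrite /rotv !dotvS (dotvC v u) uv -!enorm_sq u1 v1.
by rewrite expr1n -[RHS](cos2Dsin2 x); ring.
Qed.

Lemma rotv_unit u v x : orthopair u v -> enorm (rotv u v x) = 1.
Proof. by move=> o; apply/eqP; rewrite -(@eqrXn2 _ 2)// ?enorm_ge0// enorm_sq rotv_sq// expr1n. Qed.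

Lemma rotv_lip u v x y : orthopair u v -> enorm (rotv u v x - rotv u v y) <= `|x - y|.
Proof.
move=> o; rewrite -[leRHS]mul1r; apply: bounded_derivative_enorm => [t|t].
  exact: rotv_derive.
by rewrite rotv_unit//; exact: orthopair_turn.
Qed.

Lemma small_choice (A b : R) : 0 <= A -> 0 < b -> exists2 e : R, 0 < e & forall a, a <= A -> e * a < b.
Proof.
move=> A0 b0; have A1 : 0 < A + 1 by rewrite ltr_wpDl.
exists (b / (A + 1)); first by rewrite divr_gt0.
by move=> a aA; rewrite mulrAC ltr_pdivrMr// ltr_pM2l//; lra.
Qed.

(** On a compact piece the strict first-order condition has a uniform reserve, which absorbs the
    second-order terms for small [e]; on a straight piece the bound [|e Z1| <= |T + e Z|^2] holds
    for small [e] without any condition. *)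
Lemma piece_variation (T N Z Z1 : R -> V) (p q : R) : p <= q ->
  (forall t : R, is_derive t 1 T (N t)) -> (forall t : R, is_derive t 1 Z (Z1 t)) ->
  continuous N -> continuous Z1 -> (forall t, p <= t <= q -> enorm (T t) = 1) ->
  (forall t, p <= t <= q -> N t = 0) \/
  (forall t, p <= t <= q -> enorm (N t) = 1 /\ dotv (N t) (Z1 t) - 2 * dotv (T t) (Z t) < 0) ->
  exists2 e0 : R, 0 < e0 & forall (e : R) (S : R -> R), 0 < e -> e <= e0 ->
    (forall t, p <= t <= q -> is_derive t 1 S (enorm (T t + e *: Z t))) ->
    forall x y, p <= x -> x <= y -> y <= q ->
      enorm (dir (T y + e *: Z y) - dir (T x + e *: Z x)) <= S y - S x.
Proof.
move=> pq dT dZ cN cZ1 T1 hN.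
have cT x : continuous_at x T := is_derive_continuous (dT x).
have cZ x : continuous_at x Z := is_derive_continuous (dZ x).
have [a _ ha] := segment_max pq (fun x => continuous_enorm (cZ x)).
have [b _ hb] := segment_max pq (fun x => continuous_enorm (@cZ1 x)).
have [k k0 hk] : exists2 k, 0 < k & (forall t, p <= t <= q -> N t = 0) \/
    (forall t, p <= t <= q -> enorm (N t) = 1 /\ dotv (N t) (Z1 t) - 2 * dotv (T t) (Z t) <= - k).
  case: hN => hN; first by exists 1 => //; left.
  have cq : continuous (fun t => dotv (N t) (Z1 t) - 2 * dotv (T t) (Z t)).
    move=> t; apply: cvgB; first exact: (continuous_dotv (@cN t) (@cZ1 t)).
    by apply: cvgM; [exact: cvg_cst|exact: (continuous_dotv (cT t) (cZ t))].
  have [c hc hmax] := segment_max pq cq.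
  exists (- (dotv (N c) (Z1 c) - 2 * dotv (T c) (Z c))); first by rewrite oppr_gt0; case: (hN c hc).
  by right => t ht; rewrite opprK; split; [case: (hN t ht)|exact: hmax].
set A := enorm (Z a) in ha; set B := enorm (Z1 b) in hb.
have A0 : 0 <= A := enorm_ge0 _. have B0 : 0 <= B := enorm_ge0 _.
have [||e0 e00 he0] := @small_choice (A + B + B ^+ 2) (Num.min 4^-1 k).
- by rewrite !addr_ge0 ?sqr_ge0.
- by rewrite lt_min k0 invr_gt0 ltr0n.
have B20 := sqr_ge0 B.
have [eA eB eBB] : [/\ e0 * A < 4^-1, e0 * B < 4^-1 & e0 * B ^+ 2 < k].
  have hh x : x <= A + B + B ^+ 2 -> e0 * x < 4^-1 /\ e0 * x < k.
    by move=> /he0; rewrite lt_min => /andP[].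
  split; [apply: (hh A _).1|apply: (hh B _).1|apply: (hh (B ^+ 2) _).2]; lra.
exists e0 => // e S e_0 ee0 dS x y px xy yq.
have eM c d : 0 <= c -> c <= d -> e * c <= e0 * d by move=> c0 cd; rewrite ler_pM// ltW.
have eZ t : p <= t <= q -> e * enorm (Z t) <= 4^-1.
  by move=> /ha h; apply: le_trans (ltW eA); rewrite eM ?enorm_ge0.
have ex t : x <= t <= y -> p <= t <= q by case/andP=> ? ?; apply/andP; split; lra.
apply: (@piece_lipschitz _ _ (fun t => T t + e *: Z t) (fun t => N t + e *: Z1 t)) => // t /ex ht.
- exact: dS.
- rewrite -enorm_eq0 gt_eqF//; have := enorm_lerB (T t) (- (e *: Z t)).
  by rewrite opprK enormN T1// enormZ gtr0_norm//; have := eZ t ht; lra.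
have eB' : e * enorm (Z1 t) <= 4^-1 by apply: le_trans (ltW eB); rewrite eM ?enorm_ge0 ?hb.
case: hk => hk.
  rewrite hk// add0r enormZ gtr0_norm//.
  have : 2^-1 <= enorm (T t + e *: Z t).
    have := enorm_lerB (T t) (- (e *: Z t)).
    by rewrite opprK enormN T1// enormZ gtr0_norm//; have := eZ t ht; lra.
  set c := enorm (T t + _) => hc; have : 2^-1 ^+ 2 <= c ^+ 2 by rewrite ler_pXn2r ?nnegrE ?enorm_ge0.
  by rewrite expr2; lra.
have [N1 nz] := hk t ht.
apply: (@variation_curvature _ _ _ _ _ _ k) => //; try exact: ltW; try exact: T1.
  have : e * enorm (Z1 t) ^+ 2 <= e0 * B ^+ 2.
    by rewrite eM ?sqr_ge0// ler_pXn2r ?nnegrE ?enorm_ge0 ?hb.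
  lra.
by have := eZ t ht; lra.
Qed.

Lemma piece_length (S S' : R -> R) (c p q : R) : p <= q ->
  (forall t, p <= t <= q -> is_derive t 1 S (S' t)) ->
  (forall t, p <= t <= q -> S' t <= c) -> S q - S p <= c * (q - p).
Proof.
move=> pq dS hS; have oc x : p < x < q -> p <= x <= q by case/andP=> /ltW -> /ltW ->.
have dd t : p <= t <= q -> is_derive t 1 (fun t => c * t - S t) (c - S' t).
  move=> ht; apply: is_derive_rsub; last exact: dS.
  by have := is_derive_rmul (is_derive_rconst c t) (is_derive_rid t); rewrite mul0r add0r mulr1.
have := derivative_ge0_le pq (fun x hx => is_derive_rcontinuous (dd x hx)) (fun x hx => dd x (oc x hx)).
move=> h; have : c * p - S p <= c * q - S q by apply: h => x /oc hx; rewrite subr_ge0 hS.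
lra.
Qed.

Lemma bounded_increment (f f' : R -> V) (c p q : R) : p <= q ->
  (forall x : R, is_derive x 1 f (f' x)) -> (forall x, p <= x <= q -> enorm (f' x) <= c) ->
  enorm (f q - f p) <= c * (q - p).
Proof.
move=> pq df hf.
have dc (x : R) : is_derive x 1 (fun x => c * x) c.
  by have := is_derive_rmul (is_derive_rconst c x) (is_derive_rid x); rewrite mul0r add0r mulr1.
rewrite mulrBr; apply: (@mean_value_enorm _ _ f f' (fun x => c * x) (fun=> c) p q pq
  (fun x _ => is_derive_continuous (df x)) (fun x _ => is_derive_rcontinuous (dc x))
  (fun x _ => df x) (fun x _ => dc x)) => x /andP[/ltW px /ltW xq].
by apply: hf; rewrite px.
Qed.

Lemma is_derive_line (a b : R) (z : V) (t : R) : is_derive t 1 (fun x => (a * x + b) *: z) (a *: z).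
Proof.
have d := is_derive_radd (is_derive_rmul (is_derive_rconst a t) (is_derive_rid t)) (is_derive_rconst b t).
by have := is_derive_scale d (is_derive_const z t); rewrite mul0r add0r mulr1 addr0 scaler0 addr0.
Qed.

(* Outer transition layer of width [h] before the endpoint [a] of the arc: the velocity
   of the variation grows linearly from [0] to [z]. *)
Lemma outer_layer (tau : R -> V) (a r : R) (z : V) : 0 < r ->
  (forall x, a - r <= x <= a -> tau x = tau a /\ enorm (tau a) = 1) \/
  (exists u v : V, [/\ orthopair u v, forall x, a - r <= x <= a -> tau x = rotv u v x &
     dotv (rotv v (- u) a) z < 0]) ->
  exists2 h0 : R, 0 < h0 & h0 <= r /\ forall h : R, 0 < h -> h <= h0 ->
  exists2 e0 : R, 0 < e0 & forall (e : R) (S : R -> R), 0 < e -> e <= e0 ->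
    (forall t, a - h <= t <= a -> is_derive t 1 S (enorm (tau t + e *: ((h^-1 * t + h^-1 * (h - a)) *: z)))) ->
    (forall x y, a - h <= x -> x <= y -> y <= a ->
      enorm (dir (tau y + e *: ((h^-1 * y + h^-1 * (h - a)) *: z)) - dir (tau x + e *: ((h^-1 * x + h^-1 * (h - a)) *: z))) <= S y - S x) /\
    S a - S (a - h) <= h + e * (h * enorm z).
Proof.
move=> r0 hyp; set K := enorm z; have K0 : 0 <= K := enorm_ge0 z.
pose Z h x := (h^-1 * x + h^-1 * (h - a)) *: z.
have coef h x : 0 < h -> a - h <= x <= a -> 0 <= h^-1 * x + h^-1 * (h - a) <= 1.
  move=> h0 /andP[x1 x2]; rewrite -mulrDr; apply/andP; split.
    by apply: mulr_ge0; [rewrite invr_ge0 ltW|lra].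
  by rewrite ler_pdivrMl//; lra.
have Zle h x : 0 < h -> a - h <= x <= a -> enorm (Z h x) <= K.
  by move=> h0 hx; have /andP[c0 c1] := coef h x h0 hx; rewrite enormZ ger0_norm// ler_piMl.
have len (h e : R) (S : R -> R) : 0 < h -> h <= r -> 0 < e ->
    (forall t, a - h <= t <= a -> is_derive t 1 S (enorm (tau t + e *: Z h t))) ->
    S a - S (a - h) <= h + e * (h * K).
  move=> h0 hr e0 dS.
  have := @piece_length S _ (1 + e * K) (a - h) a _ dS; rewrite opprB addrCA subrr addr0 => hS.
  rewrite (_ : h + _ = (1 + e * K) * h); last by ring.
  apply: hS => [|t ht]; first by lra.
  have ht' : a - r <= t <= a by case/andP: ht => ? ?; apply/andP; split; lra.
  have t1 : enorm (tau t) = 1.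
    case: hyp => [hx | [u [v [uv hx _]]]]; last by rewrite hx// rotv_unit.
    by have [-> ->] := hx t ht'.
  by apply: le_trans (enormD _ _) _; rewrite t1 lerD2l enormZ gtr0_norm// ler_pM2l// Zle.
have dZ (h t : R) : is_derive t 1 (Z h) (h^-1 *: z) by exact: is_derive_line.
case: hyp => [hyp | [u [v [uv hyp uz]]]].
  exists r => //; split=> // h h0 hr; have ah : a - h <= a by lra.
  have t1 : enorm (tau a) = 1 by have [] := hyp a _; [apply/andP; split; lra|].
  have [e0 e00 he] := piece_variation ah (fun t => is_derive_const (tau a) t) (dZ h)
     (fun t => cvg_cst _) (fun t => cvg_cst _) (fun t _ => t1) (or_introl (fun t _ => erefl)).
  exists e0 => // e S e_0 ee0 dS; split; last exact: (len h e S h0 hr e_0 dS).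
  have th t : a - h <= t -> t <= a -> tau t = tau a.
    by move=> ? ?; have [] := hyp t _; [apply/andP; split; lra|].
  move=> x y xa xy ya; rewrite !th; try lra; apply: (he e S) => // t /andP[t1' t2'].
  by rewrite -(th t t1' t2'); apply: dS; rewrite t1'.
(* The condition is [h^-1 <N, z> < 2 <T, Z>] with [|Z| <= K]. Of the [3 K], two cover the right side
   and one the drift of [N] over the layer. *)
have [||h0 h00 hh0] := @small_choice (3 * K) (- dotv (rotv v (- u) a) z).
- by rewrite mulr_ge0.
- by rewrite oppr_gt0.
exists (Num.min r h0); first by rewrite lt_min r0.
split; first by rewrite ge_min lexx.
move=> h hp; rewrite le_min => /andP[hr hh]; have ah : a - h <= a by lra.
have hK : h * (3 * K) < - dotv (rotv v (- u) a) z.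
  by apply: le_lt_trans (hh0 (3 * K) (lexx _)); rewrite ler_wpM2r// mulr_ge0.
have o := uv; have o' := orthopair_turn o.
have neg t : a - h <= t <= a -> enorm (rotv v (- u) t) = 1 /\
    dotv (rotv v (- u) t) (h^-1 *: z) - 2 * dotv (rotv u v t) (Z h t) < 0.
  move=> ht; split; first exact: rotv_unit.
  have n1 : `|dotv (rotv u v t) (Z h t)| <= K.
    by apply: le_trans (dotv_norm_le _ _) _; rewrite rotv_unit// mul1r Zle.
  have n2 : dotv (rotv v (- u) t) z <= dotv (rotv v (- u) a) z + h * K.
    have -> : rotv v (- u) t = rotv v (- u) a + (rotv v (- u) t - rotv v (- u) a) by rewrite addrC subrK.
    rewrite dotvDl lerD2l; apply: le_trans (dotv_le _ _) _; rewrite ler_wpM2r//.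
    apply: le_trans (rotv_lip _ _ o') _; rewrite ler_norml.
    by case/andP: ht => ? ?; apply/andP; split; lra.
  have n3 : h^-1 * dotv (rotv v (- u) t) z < - (2 * K).
    by rewrite ltr_pdivrMl//; lra.
  by rewrite dotvZr; move: n1; rewrite ler_norml => /andP[n1 _]; lra.
have [e0 e00 he] := piece_variation ah (rotv_derive u v) (dZ h)
   (fun t => is_derive_continuous (rotv_derive v (- u) t)) (fun t => cvg_cst _) (fun t _ => rotv_unit t o) (or_intror neg).
exists e0 => // e S e_0 ee0 dS; split; last exact: (len h e S hp hr e_0 dS).
have th t : a - h <= t -> t <= a -> tau t = rotv u v t.
  by move=> ? ?; apply: hyp; apply/andP; split; lra.
move=> x y xa xy ya; rewrite !th; try lra; apply: (he e S) => // t /andP[t1' t2'].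
by rewrite -(th t t1' t2'); apply: dS; rewrite t1'.
Qed.

Lemma tan_ratio_gt1 (al : R) : 0 < al -> al < pi / 2 -> 1 < sin al / (al * cos al).
Proof.
move=> a0 a1; have c0 : 0 < cos al by apply: cos_gt0_pihalf; apply/andP; split; lra.
rewrite ltr_pdivlMr ?mulr_gt0// mul1r.
pose f (x : R) := sin x - x * cos x.
have df (x : R) : is_derive x 1 f (x * sin x).
  have := is_derive_rsub (is_derive_sin x) (is_derive_rmul (is_derive_rid x) (is_derive_cos x)).
  by congr is_derive; ring.
have := derivative_gt0_lt a0 (fun x _ => is_derive_rcontinuous (df x)) (fun x _ => df x).
rewrite /f sin0 mul0r subrr => h; rewrite -subr_gt0; apply: h => x /andP[x0 xa].
by rewrite mulr_gt0// sin_gt0_pi// x0; have := @pi_gt0 R; lra.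
Qed.

Lemma smoothstep_bounds (y : R) : 0 <= y <= 1 -> 0 <= y - y * y <= 4^-1.
Proof.
by move=> /andP[y0 y1]; have := sqr_ge0 (y - 2^-1); rewrite expr2 => h; apply/andP; split; nra.
Qed.

(* On the arc [rotv m m'] over [[-al, 0]], the field [- t x T - N + m' / cos al], with
   [t = tan al / al], vanishes at [-al] and shortens the arc at constant curvature rate;
   it is joined within a layer of width [h] to an incoming velocity [z]. *)
Lemma middle_layer (m m' : V) (al : R) (z : V) : orthopair m m' -> 0 < al -> al < pi / 2 ->
  let t := sin al / (al * cos al) in
  dotv (rotv m' (- m) (- al)) z = 2 * (t * al) ->
  exists c h0 : R, [/\ 0 < c, 0 < h0, h0 <= al / 2 &
  forall h : R, 0 < h -> h <= h0 -> exists W W' : R -> V,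
  [/\ forall x : R, is_derive x 1 W (W' x), continuous W',
      W (- al) = (h / 2) *: z /\ W' (- al) = z,
      W 0 = ((cos al)^-1 - 1) *: m' /\ W' 0 = (1 - t) *: m &
  exists2 e0 : R, 0 < e0 & forall (e : R) (S : R -> R), 0 < e -> e <= e0 ->
    (forall x, - al <= x <= 0 -> is_derive x 1 S (enorm (rotv m m' x + e *: W' x))) ->
    (forall x y, - al <= x -> x <= y -> y <= 0 ->
      enorm (dir (rotv m m' y + e *: W' y) - dir (rotv m m' x + e *: W' x)) <= S y - S x) /\
    S 0 - S (- al) <= al - e * c]].
Proof.
move=> o a0 a1 t hz; have o' := orthopair_turn o.
have ca : 0 < cos al by apply: cos_gt0_pihalf; apply/andP; split; lra.
have t1 : 1 < t by exact: tan_ratio_gt1.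
have [T hT] : exists T, T = rotv m m' by exists (rotv m m').
have [N hN] : exists N, N = rotv m' (- m) by exists (rotv m' (- m)).
rewrite -hT; rewrite -hN in hz.
have T1 x : enorm (T x) = 1 by rewrite hT rotv_unit.
have N1 x : enorm (N x) = 1 by rewrite hN rotv_unit.
have dT (x : R) : is_derive x 1 T (N x) by rewrite hT hN; exact: rotv_derive.
have dN (x : R) : is_derive x 1 N (- T x).
  by have := rotv_derive m' (- m) x; rewrite rotv_turn2 hT hN.
have TN x : dotv (T x) (N x) = 0 by rewrite hT hN rotv_dotv.
have NT x : dotv (N x) (T x) = 0 by rewrite dotvC.
have TT x : dotv (T x) (T x) = 1 by rewrite hT rotv_sq.
have NN x : dotv (N x) (N x) = 1 by rewrite hN rotv_sq.
(* Along the whole arc [<T, Zm> = 1 - t] is negative and [<N, Zm1> - 2 <T, Zm>] equals [-1]. The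
   value of [t] makes [Wm] vanish at [- al], but its velocity there keeps the normal component
   [t al], which is what the layer has to supply. *)
pose Wm x := - (t * x) *: T x - N x + (cos al)^-1 *: m'.
pose Zm x := (1 - t) *: T x + - (t * x) *: N x.
pose Zm1 x := (1 - 2 * t) *: N x + (t * x) *: T x.
have dlin (x : R) : is_derive x 1 (fun x => - (t * x)) (- t).
  by have := is_derive_ropp (is_derive_rmul (is_derive_rconst t x) (is_derive_rid x)); rewrite mul0r add0r mulr1.
have dWm (x : R) : is_derive x 1 Wm (Zm x).
  have := is_derive_add (is_derive_sub (is_derive_scale (dlin x) (dT x)) (dN x)) (is_derive_const ((cos al)^-1 *: m') x).
  by congr is_derive; rewrite /Zm; apply/rowP => i; rewrite !mxE; ring.
have dZm (x : R) : is_derive x 1 Zm (Zm1 x).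
  have := is_derive_add (is_derive_scalel (1 - t) (dT x)) (is_derive_scale (dlin x) (dN x)).
  by congr is_derive; rewrite /Zm1; apply/rowP => i; rewrite !mxE; ring.
have ta0 : 0 < t * al by rewrite mulr_gt0//; lra.
pose B := (t - 1) + t * al; pose C := (2 * t - 1) + t * al; pose K := enorm z.
have K0 : 0 <= K := enorm_ge0 z.
have B0 : 0 <= B by rewrite /B; lra.
have C0 : 0 <= C by rewrite /C; lra.
have txb x : - al <= x <= 0 -> `|t * x| <= t * al.
  move=> /andP[x1 x2]; rewrite normrM gtr0_norm; last lra.
  by rewrite ler_pM2l ?ler0_norm//; lra.
have Zmb x : - al <= x <= 0 -> enorm (Zm x) <= B.
  move=> /txb hx; apply: le_trans (enormD _ _) _; rewrite !enormZ T1 N1 !mulr1 normrN.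
  by apply: lerD => //; rewrite ltr0_norm; lra.
have Zm1b x : - al <= x <= 0 -> enorm (Zm1 x) <= C.
  move=> /txb hx; apply: le_trans (enormD _ _) _; rewrite !enormZ T1 N1 !mulr1.
  by apply: lerD => //; rewrite ltr0_norm; lra.
have NZm x : dotv (N x) (Zm1 x) - 2 * dotv (T x) (Zm x) = -1.
  by rewrite /Zm /Zm1 !dotvS TN NT TT NN; ring.
have TZm x : dotv (T x) (Zm x) = 1 - t by rewrite /Zm !dotvS TN TT; ring.
have Wma : Wm (- al) = 0.
  have hs : t * al = sin al / cos al by rewrite /t; field; rewrite !gt_eqF.
  rewrite /Wm mulrN opprK hs hT hN /rotv cosN sinN.
  have cs := cos2Dsin2 al; have cn : cos al != 0 by rewrite gt_eqF.
  apply/rowP => i; rewrite !mxE; move: (m 0 i) (m' 0 i) => x y.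
  have -> : sin al / cos al * (cos al * x + - sin al * y) - (cos al * y + - sin al * - x) + (cos al)^-1 * y =
    y / cos al * (1 - (cos al ^+ 2 + sin al ^+ 2)) by field.
  by rewrite cs subrr mulr0.
have Zma : dotv (N (- al)) (Zm (- al)) = t * al by rewrite /Zm !dotvS NT NN; ring.
(* Bounds [|be2| + 2 |be1|], the effect of the cutoff [be] below on the first-order condition; the
   numbers come from [lam <= 2 / al]. *)
pose kap := 24 / al ^+ 2 + 6 / al.
have kap0 : 0 < kap by rewrite addr_gt0// divr_gt0// exprn_gt0.
have p1 : 0 <= 2 / al by rewrite divr_ge0// ltW.
have p2 : 0 <= 3 * (K + B) + C by lra.
have KB2 : 0 <= K + 2 * B by lra.
have p3 : 0 <= (K + 2 * B) * kap by rewrite mulr_ge0// ltW.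
have p4 : 0 <= 3 / al * (K + 2 * B) by rewrite mulr_ge0// divr_ge0// ltW.
have p5 : 0 <= K + B by lra.
(* Each summand gets multiplied by the width [h] in one of the estimates below, so one bound on the
   sum serves them all. *)
have [||h0 h00 hh0] := @small_choice (2 / al + (3 * (K + B) + C) + (K + 2 * B) * kap + 3 / al * (K + 2 * B) + (K + B))
   (Num.min (Num.min 1 (t * al)) (Num.min ((t - 1) / 2) (al * (t - 1) / 32))).
- by lra.
- by rewrite !lt_min ltr01 ta0 !divr_gt0// ?mulr_gt0//; lra.
have hmin x (h : R) : 0 < h -> h <= h0 -> 0 <= x ->
   x <= 2 / al + (3 * (K + B) + C) + (K + 2 * B) * kap + 3 / al * (K + 2 * B) + (K + B) ->
   [/\ h * x < 1, h * x < t * al, h * x < (t - 1) / 2 & h * x < al * (t - 1) / 32].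
  move=> hp hh x0 /hh0 hx; have {hx} : h * x < Num.min (Num.min 1 (t * al)) (Num.min ((t - 1) / 2) (al * (t - 1) / 32)).
    by apply: le_lt_trans hx; rewrite ler_wpM2r.
  by rewrite !lt_min => /andP[/andP[? ?] /andP[? ?]].
have hal (h : R) : 0 < h -> h <= h0 -> h <= al / 2.
  move=> hp hh; have [] := hmin (2 / al) h hp hh p1 _; first lra.
  by rewrite mulrA ltr_pdivrMr// mul1r => ? _ _ _; lra.
exists (al * (t - 1) / 32), h0; split=> //; first by rewrite divr_gt0// mulr_gt0//; lra.
  exact: hal.
move=> h hp hh; have ha := hal h hp hh.
have [_ c2 _ _] := hmin (3 * (K + B) + C) h hp hh p2 ltac:(lra).
have [c3 _ _ _] := hmin ((K + 2 * B) * kap) h hp hh p3 ltac:(lra).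
have [_ _ c4 _] := hmin (3 / al * (K + 2 * B)) h hp hh p4 ltac:(lra).
have [_ _ _ c5] := hmin (K + B) h hp hh p5 ltac:(lra).
(* On the layer [[- al, b]] the velocity runs linearly from [z] to [Zm b]. The change [w] has normal
   component close to [t al - 2 t al], which is negative, and the slope [h^-1] makes it outweigh
   [2 <T, Z2>]. *)
pose b := - al + h; have bI : - al <= b <= 0 by rewrite /b; apply/andP; split; lra.
pose w := Zm b - z.
pose Z2 x := z + (h^-1 * x + h^-1 * al) *: w.
pose W2 x := (h / 2) *: z + (x + al) *: z + ((2 * h)^-1 * ((x + al) * (x + al))) *: w.
have h0' : h != 0 by rewrite gt_eqF.
have dshift (x : R) : is_derive x 1 (fun x => x + al) 1.
  by have := is_derive_radd (is_derive_rid x) (is_derive_rconst al x); rewrite addr0.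
have dW2 (x : R) : is_derive x 1 W2 (Z2 x).
  have := is_derive_add (is_derive_add (is_derive_const ((h / 2) *: z) x) (is_derive_scale (dshift x) (is_derive_const z x)))
    (is_derive_scale (is_derive_rmul (is_derive_rconst (2 * h)^-1 x) (is_derive_rmul (dshift x) (dshift x))) (is_derive_const w x)).
  by congr is_derive; rewrite /Z2; apply/rowP => i; rewrite !mxE; field.
have dZ2 (x : R) : is_derive x 1 Z2 (h^-1 *: w).
  by have := is_derive_add (is_derive_const z x) (is_derive_line h^-1 (h^-1 * al) w x); rewrite add0r.
pose lam := (al - h)^-1; have lam0 : 0 < lam by rewrite invr_gt0; lra.
have lamE : lam * (al - h) = 1 by rewrite mulVf// gt_eqF//; lra.
have lam2 : lam <= 2 / al by rewrite /lam -[2 / al]invf_div lef_pV2 ?posrE; clear -ha hp a0; lra.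
pose y x := lam * (x + al - h).
have yI x : b <= x <= 0 -> 0 <= y x <= 1.
  rewrite /b => /andP[x1 x2]; rewrite /y; apply/andP; split; first by apply: mulr_ge0; [exact: ltW|clear -x1; lra].
  by rewrite -lamE ler_pM2l//; clear -x2; lra.
(* The integrated layer misses [Wm b] by [v], which is of order [h]. The cubic cutoff [be] removes
   this error over [[b, 0]], at the cost of terms of order [h] in the velocity and its
   derivative. *)
pose v := W2 b - Wm b.
pose be x := 1 - (3 * (y x * y x) - 2 * (y x * (y x * y x))).
pose be1 x := - (6 * lam * (y x - y x * y x)).
pose be2 x := - (6 * lam ^+ 2 * (1 - 2 * y x)).
have dy (x : R) : is_derive x 1 y lam.
  have := is_derive_rmul (is_derive_rconst lam x) (is_derive_rsub (dshift x) (is_derive_rconst h x)).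
  by rewrite mul0r add0r subr0 mulr1.
have dbe (x : R) : is_derive x 1 be (be1 x).
  have yy := is_derive_rmul (dy x) (dy x); have c k := is_derive_rconst k x.
  have := is_derive_rsub (c 1) (is_derive_rsub (is_derive_rmul (c 3) yy) (is_derive_rmul (c 2) (is_derive_rmul (dy x) yy))).
  by congr is_derive; rewrite /be1; ring.
have dbe1 (x : R) : is_derive x 1 be1 (be2 x).
  have yy := is_derive_rmul (dy x) (dy x); have c k := is_derive_rconst k x.
  have := is_derive_ropp (is_derive_rmul (c (6 * lam)) (is_derive_rsub (dy x) yy)).
  by congr is_derive; rewrite /be2; ring.
pose W3 x := Wm x + be x *: v; pose Z3 x := Zm x + be1 x *: v; pose Z31 x := Zm1 x + be2 x *: v.
have dbev (f f' : R -> R) (x : R) : is_derive x 1 f (f' x) -> is_derive x 1 (fun x => f x *: v) (f' x *: v).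
  by move=> df; have := is_derive_scale df (is_derive_const v x); rewrite scaler0 addr0.
have dW3 (x : R) : is_derive x 1 W3 (Z3 x) by apply: is_derive_add => //; exact: dbev.
have dZ3 (x : R) : is_derive x 1 Z3 (Z31 x) by apply: is_derive_add => //; exact: dbev.
have yb : y b = 0 by rewrite /y /b; ring.
have y0 : y 0 = 1 by rewrite /y add0r.
have bal : b + al = h by rewrite /b; ring.
have Zb : Z2 b = Z3 b.
  by rewrite /Z2 /Z3 /be1 yb -mulrDr bal mulVf// scale1r addrC subrK mul0r subrr mulr0 oppr0 scale0r addr0.
have Wb : W2 b = W3 b by rewrite /W3 /be yb !mul0r !mulr0 !subr0 scale1r addrC subrK.
have cZ2 x : continuous_at x Z2 := is_derive_continuous (dZ2 x).
have cZ3 x : continuous_at x Z3 := is_derive_continuous (dZ3 x).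
have b0 : b <= 0 by case/andP: bI.
have ab : - al <= b by case/andP: bI.
have andP_le0 x : - al <= x <= b -> - al <= x <= 0.
  by move=> /andP[-> xb]; exact: le_trans xb b0.
have vle : enorm v <= h * (K + 2 * B).
  have n1 : enorm (Wm b) <= h * B.
    have := bounded_increment ab dWm (fun x hx => Zmb x (andP_le0 x hx)).
    by rewrite Wma subr0 opprK bal mulrC.
  have -> : v = h *: z + (h / 2) *: Zm b - Wm b.
    rewrite /v /W2 bal /w; congr (_ - _); apply/rowP => i; rewrite !mxE; field.
    by rewrite h0'.
  have m1 := enormB (h *: z + (h / 2) *: Zm b) (Wm b); have m2 := enormD (h *: z) ((h / 2) *: Zm b).
  rewrite !enormZ !gtr0_norm ?divr_gt0// in m2.
  have m3 : h / 2 * enorm (Zm b) <= h / 2 * B by rewrite ler_pM2l ?divr_gt0// Zmb.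
  have hB : 0 <= h * B by rewrite mulr_ge0// ltW.
  rewrite -/K in m2; clear -m1 m2 m3 n1 hB; lra.
exists (glue_at b W2 W3), (glue_at b Z2 Z3).
have gl (f1 f2 : R -> V) x : f1 b = f2 b -> b <= x -> glue_at b f1 f2 x = f2 x.
  by move=> fb; rewrite /glue_at le_eqVlt => /predU1P[<-|bx]; [rewrite lexx|rewrite leNgt bx].
have gl2 (f1 f2 : R -> V) x : x <= b -> glue_at b f1 f2 x = f1 x by rewrite /glue_at => ->.
split.
- by move=> x; apply: is_derive_glue.
- by move=> x; apply: continuous_glue.
- by rewrite !gl2// /W2 /Z2 addNr mul0r !mulr0 !scale0r !addr0 mulrN addNr scale0r addr0.
- rewrite !gl// /W3 /Z3 /be /be1 y0 !mulr1 /Wm /Zm mulr0 oppr0 !scale0r subrr mulr0 oppr0 scale0r.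
  rewrite hT hN /rotv cos0 sin0 !scale0r !scale1r !addr0 (_ : 1 - (3 - 2) = 0 :> R); last by ring.
  by rewrite scale0r addr0 sub0r scalerBl scale1r addrC.
have Z2b x : - al <= x <= b -> enorm (Z2 x) <= K + B.
  move=> /andP[x1 x2]; pose s := h^-1 * (x + al).
  have s0 : 0 <= s by apply: mulr_ge0; [rewrite invr_ge0 ltW|clear -x1; lra].
  have s1 : s <= 1 by rewrite ler_pdivrMl// mulr1; clear -x2 bal; lra.
  have -> : Z2 x = (1 - s) *: z + s *: Zm b.
    by rewrite /Z2 /w /s; apply/rowP => i; rewrite !mxE; ring.
  apply: le_trans (enormD _ _) _; rewrite !enormZ !ger0_norm ?subr_ge0//.
  by apply: lerD; [rewrite ler_piMl//; clear -s0; lra|apply: le_trans (Zmb b bI); rewrite ler_piMl// enorm_ge0].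
have neg2 x : - al <= x <= b -> enorm (N x) = 1 /\ dotv (N x) (h^-1 *: w) - 2 * dotv (T x) (Z2 x) < 0.
  move=> hx; split=> //.
  have n1 : `|dotv (T x) (Z2 x)| <= K + B.
    by apply: le_trans (dotv_norm_le _ _) _; rewrite T1 mul1r Z2b.
  have wle : enorm w <= K + B.
    by rewrite /w; apply: le_trans (enormB _ _) _; rewrite addrC lerD2l Zmb.
  have n2 : dotv (N x) w <= dotv (N (- al)) w + h * (K + B).
    have -> : N x = N (- al) + (N x - N (- al)) by rewrite addrC subrK.
    rewrite dotvDl lerD2l; apply: le_trans (dotv_le _ _) _; rewrite ler_pM ?enorm_ge0//.
    rewrite hN; apply: le_trans (rotv_lip _ _ o') _; rewrite opprK; case/andP: hx => hx1 hx2.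
    by clear -hx1 hx2 bal; rewrite ger0_norm; lra.
  have n3 : dotv (N (- al)) w <= - (t * al) + h * C.
    rewrite /w dotvBr hz.
    suff : dotv (N (- al)) (Zm b) <= t * al + h * C by clear; lra.
    have -> : Zm b = Zm (- al) + (Zm b - Zm (- al)) by rewrite addrC subrK.
    rewrite dotvDr Zma lerD2l; apply: le_trans (dotv_le _ _) _; rewrite N1 mul1r.
    have := bounded_increment ab dZm (fun x hx => Zm1b x (andP_le0 x hx)).
    by rewrite opprK bal mulrC.
  have n4 : h^-1 * dotv (N x) w < - (2 * (K + B)) by rewrite ltr_pdivrMl//; clear -n2 n3 c2; lra.
  by rewrite dotvZr; move: n1; rewrite ler_norml => /andP[n1 _]; clear -n1 n4; lra.
have ylo x : b <= x <= 0 -> `|be1 x| <= 3 / al /\ `|be2 x| <= 24 / al ^+ 2.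
  move=> /yI yi; have /andP[q0 q1] := smoothstep_bounds yi; case/andP: yi => y_0 y_1.
  split.
    rewrite normrN ger0_norm; last by rewrite !mulr_ge0// ltW.
    have : 6 * lam * (y x - y x * y x) <= 6 * (2 / al) * 4^-1.
      by apply: ler_pM => //; [rewrite mulr_ge0// ltW|rewrite ler_pM2l].
    by clear; lra.
  rewrite normrN normrM ger0_norm; last by rewrite mulr_ge0// sqr_ge0.
  have k1 : `|1 - 2 * y x| <= 1 by rewrite ler_norml; clear -y_0 y_1; apply/andP; split; lra.
  have k2 : 6 * lam ^+ 2 <= 24 / al ^+ 2.
    have : lam ^+ 2 <= (2 / al) ^+ 2 by rewrite ler_pXn2r ?nnegrE// ltW.
    by rewrite expr_div_n (_ : 2 ^+ 2 = 4 :> R); [clear; lra|rewrite expr2; ring].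
  by apply: le_trans (ler_pM _ _ k2 k1) _; rewrite ?mulr1// mulr_ge0 ?sqr_ge0.
have v0 := enorm_ge0 v.
have nv u : enorm u = 1 -> `|dotv u v| <= enorm v.
  by move=> u1; apply: le_trans (dotv_norm_le _ _) _; rewrite u1 mul1r.
have neg3 x : b <= x <= 0 -> enorm (N x) = 1 /\ dotv (N x) (Z31 x) - 2 * dotv (T x) (Z3 x) < 0.
  move=> hx; split=> //; have [k1 k2] := ylo x hx.
  rewrite /Z31 /Z3 (dotvDr (N x) (Zm1 x)) (dotvDr (T x) (Zm x)) (dotvZr _ (N x) v) (dotvZr _ (T x) v).
  have := NZm x.
  have m1 : `|be2 x * dotv (N x) v| <= 24 / al ^+ 2 * enorm v by rewrite normrM ler_pM// nv.
  have m2 : `|be1 x * dotv (T x) v| <= 3 / al * enorm v by rewrite normrM ler_pM// nv.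
  have m3 : kap * enorm v <= kap * (h * (K + 2 * B)) by rewrite ler_pM2l.
  rewrite /kap in m3 c3; move: m1 m2; rewrite !ler_norml => /andP[_ m1] /andP[m2 _]; clear -m1 m2 m3 c3; lra.
have [e2 e20 he2] := piece_variation ab dT dZ2 (fun x => is_derive_continuous (dN x)) (fun x => cvg_cst _) (fun x _ => T1 x) (or_intror neg2).
have cZ31 : continuous Z31.
  move=> x; apply: continuous_vadd.
    apply: continuous_vadd; apply: continuous_scale; try exact: cvg_cst.
    - exact: is_derive_continuous (dN x).
    - by apply: cvgM; [exact: cvg_cst|exact: cvg_id].
    - exact: is_derive_continuous (dT x).
  apply: continuous_scale; last exact: cvg_cst.
  apply: cvgN; apply: cvgM; first exact: cvg_cst.
  apply: cvgB; first exact: cvg_cst.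
  by apply: cvgM; [exact: cvg_cst|exact: is_derive_rcontinuous (dy x)].
have [e3 e30 he3] := piece_variation b0 dT dZ3 (fun x => is_derive_continuous (dN x)) cZ31 (fun x _ => T1 x) (or_intror neg3).
have [xm _ hxm] := segment_max b0 (fun x => continuous_enorm (cZ3 x)).
set Q := enorm (Z3 xm) in hxm; have Q0 : 0 <= Q := enorm_ge0 _.
have [||e4 e40 he4] := @small_choice (Q ^+ 2) ((t - 1) / 2); [exact: sqr_ge0|clear -t1; lra|].
exists (Num.min (Num.min e2 e3) e4); first by rewrite !lt_min e20 e30.
move=> e S e0; rewrite !le_min => /andP[/andP[ee2 ee3] ee4] dS.
have dS2 x : - al <= x <= b -> is_derive x 1 S (enorm (T x + e *: Z2 x)).
  by move=> /andP[x1 x2]; rewrite -(gl2 Z2 Z3 x x2); apply: dS; rewrite x1 (le_trans x2 b0).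
have dS3 x : b <= x <= 0 -> is_derive x 1 S (enorm (T x + e *: Z3 x)).
  by move=> /andP[x1 x2]; rewrite -(gl Z2 Z3 x Zb x1); apply: dS; rewrite x2 (le_trans ab x1).
have l2 := he2 e S e0 ee2 dS2; have l3 := he3 e S e0 ee3 dS3.
split.
  move=> x1 x2 ax xx x0.
  case: (leP x2 b) => [x2b|/ltW bx2]; first by rewrite (gl2 _ _ x2 x2b) (gl2 _ _ x1 (le_trans xx x2b)); exact: l2.
  case: (leP b x1) => [bx1|/ltW x1b]; first by rewrite (gl _ _ x2 Zb (le_trans bx1 xx)) (gl _ _ x1 Zb bx1); exact: l3.
  rewrite (gl2 _ _ x1 x1b) (gl _ _ x2 Zb bx2).
  apply: le_trans (enorm_dist _ (dir (T b + e *: Z3 b)) _) _.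
  rewrite (_ : S x2 - S x1 = (S x2 - S b) + (S b - S x1)); last by rewrite addrA subrK.
  by apply: lerD; [exact: l3|rewrite -Zb; exact: l2].
have len2 : S b - S (- al) <= (1 + e * (K + B)) * (b - - al).
  apply: (piece_length ab dS2) => x hx; apply: le_trans (enormD _ _) _.
  by rewrite T1 lerD2l enormZ gtr0_norm// ler_pM2l// Z2b.
have len3 : S 0 - S b <= (1 - e * ((t - 1) / 4)) * (0 - b).
  apply: (piece_length b0 dS3) => x hx; apply: le_trans (variation_speed _ _ (T1 x)) _.
  have [k1 _] := ylo x hx.
  rewrite /Z3 dotvDr dotvZr TZm -/(Z3 x).
  have m2 : `|be1 x * dotv (T x) v| <= 3 / al * enorm v by rewrite normrM ler_pM// nv.
  have m3 : 3 / al * enorm v <= 3 / al * (h * (K + 2 * B)) by rewrite ler_pM2l// divr_gt0.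
  move: m2; rewrite ler_norml => /andP[_ m2].
  have m4 : e * (1 - t + be1 x * dotv (T x) v) <= e * (- ((t - 1) / 2)) by rewrite ler_pM2l//; clear -m2 m3 c4; lra.
  have m5 : e ^+ 2 * enorm (Z3 x) ^+ 2 <= e * ((t - 1) / 2).
    rewrite expr2 -mulrA ler_pM2l//; apply: le_trans (ltW (he4 _ (lexx _))).
    by apply: ler_pM; [exact: ltW|exact: sqr_ge0|exact: ee4|rewrite ler_pXn2r ?nnegrE ?enorm_ge0 ?hxm].
  by clear -m4 m5; lra.
rewrite opprK bal in len2.
have f1 : e * (h * (K + B)) <= e * (al * (t - 1) / 32) by rewrite ler_pM2l// ltW.
have f2 : e * (t - 1) * (al / 2) <= e * (t - 1) * (al - h).
  by rewrite ler_pM2l ?mulr_gt0//; clear -ha t1; lra.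
have : 0 - b = al - h by rewrite /b; ring.
move=> eb; rewrite eb in len3; have f3 : 0 < e * (al * (t - 1)) by rewrite !mulr_gt0//; clear -t1; lra.
by clear -len2 len3 f1 f2 f3; lra.
Qed.

End ArcVariation.

(** * From rest before the arc to its midpoint *)

Section FullVariation.
Variables (R : realType) (n : nat).
Notation V := 'rV[R]_n.

(** The piece that precedes an arc starting at [a] with normal [N]: straight, or circular but not
    the same circle continued. *)
Definition junction (tau : R -> V) (a r : R) (N : V) : Prop :=
  (forall x, a - r <= x <= a -> tau x = tau a) \/
  (exists u v : V, [/\ orthopair u v, forall x, a - r <= x <= a -> tau x = rotv u v x &
     rotv v (- u) a != N]).

Lemma dotv_lt1 (u v : V) : enorm u = 1 -> enorm v = 1 -> u != v -> dotv u v < 1.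
Proof.
move=> u1 v1 uv; rewrite (dotv_of_dist u1 v1) gtrBl divr_gt0// exprn_gt0// enorm_gt0.
by rewrite subr_eq0.
Qed.

Lemma half_variation (m m' : V) (al r : R) (tau : R -> V) : orthopair m m' ->
  0 < al -> al < pi / 2 -> 0 < r ->
  (forall x, - al <= x <= 0 -> tau x = rotv m m' x) ->
  junction tau (- al) r (rotv m' (- m) (- al)) ->
  let t := sin al / (al * cos al) in
  exists h : R, 0 < h /\ h <= r /\ exists W W' : R -> V,
  [/\ forall x : R, is_derive x 1 W (W' x), continuous W',
      W (- al - h) = 0 /\ W' (- al - h) = 0,
      W 0 = ((cos al)^-1 - 1) *: m' /\ W' 0 = (1 - t) *: m &
  exists2 e0 : R, 0 < e0 & forall (e : R) (S : R -> R), 0 < e -> e <= e0 ->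
    (forall x, - al - h <= x <= 0 -> is_derive x 1 S (enorm (tau x + e *: W' x))) ->
    (forall x y, - al - h <= x -> x <= y -> y <= 0 ->
      enorm (dir (tau y + e *: W' y) - dir (tau x + e *: W' x)) <= S y - S x) /\
    S 0 - S (- al - h) < al + h].
Proof.
move=> o a0 a1 r0 hT hj t; have o' := orthopair_turn o.
have ca : 0 < cos al by apply: cos_gt0_pihalf; apply/andP; split; lra.
have t1 : 1 < t by exact: tan_ratio_gt1.
have t0 : 0 < t by exact: lt_trans t1.
have ta : 0 < 2 * (t * al) by rewrite mulr_gt0 ?(mulr_gt0 t0 a0).
set a := - al in hT hj *; have aa : a <= 0 by rewrite /a; lra.
set N := rotv m' (- m) a in hj.
have N1 : enorm N = 1 by rewrite /N rotv_unit.
have tau1 : enorm (tau a) = 1 by rewrite hT ?rotv_unit// lexx.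
(* [z] needs normal component [2 t al] for the arc and a negative one for a preceding circle with
   normal [N']. A multiple of [N - N'] does both, since [<N, N - N'>] and [<N', N - N'>] are
   [1 - <N, N'>] and its opposite. *)
have [z hz hz'] : exists2 z : V, dotv N z = 2 * (t * al) &
    (forall x, a - r <= x <= a -> tau x = tau a /\ enorm (tau a) = 1) \/
    (exists u v : V, [/\ orthopair u v, forall x, a - r <= x <= a -> tau x = rotv u v x &
     dotv (rotv v (- u) a) z < 0]).
  case: hj => [hc | [u [v [uv huv ne]]]].
    exists ((2 * (t * al)) *: N); first by rewrite dotvZr -enorm_sq N1 expr1n mulr1.
    by left => x hx; rewrite hc.
  have u1 : enorm (rotv v (- u) a) = 1 by rewrite rotv_unit//; exact: orthopair_turn.
  have d0 : 0 < 1 - dotv N (rotv v (- u) a) by rewrite subr_gt0 dotvC dotv_lt1.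
  exists ((2 * (t * al) / (1 - dotv N (rotv v (- u) a))) *: (N - rotv v (- u) a)).
    by rewrite dotvZr dotvBr -enorm_sq N1 expr1n divfK// gt_eqF.
  right; exists u, v; split=> //.
  rewrite dotvZr dotvBr -enorm_sq u1 expr1n [X in X - 1]dotvC -[X in _ * X]opprB mulrN divfK ?gt_eqF//.
  by rewrite oppr_lt0.
have [c [h1 [c0 h10 _ mid]]] := middle_layer o a0 a1 hz.
have [h2 h20 [h2r out]] := outer_layer r0 hz'.
(* The outer layer may lengthen the curve by [e h |z|]; this must stay below the gain [e c] on the
   arc. *)
have [h3 h30 hK] := small_choice (enorm_ge0 z) c0.
pose h := Num.min h1 (Num.min h2 h3).
have h0 : 0 < h by rewrite !lt_min h10 h20.
have : h <= h by []; rewrite {2}/h !le_min => /and3P[hh1 hh2 hh3].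
have hKc : h * enorm z < c.
  by apply: le_lt_trans (hK _ (lexx _)); rewrite ler_wpM2r ?enorm_ge0.
have [W [W' [dW cW' [Wa W'a] [W0 W'0] [e1 e10 he1]]]] := mid h h0 hh1.
have [e2 e20 he2] := out h h0 hh2.
pose Wo x := ((2 * h)^-1 * ((x + (h - a)) * (x + (h - a)))) *: z.
pose Wo' x := (h^-1 * x + h^-1 * (h - a)) *: z.
have h0' : h != 0 by rewrite gt_eqF.
have dWo (x : R) : is_derive x 1 Wo (Wo' x).
  have ds := is_derive_radd (is_derive_rid x) (is_derive_rconst (h - a) x).
  have := is_derive_scale (is_derive_rmul (is_derive_rconst (2 * h)^-1 x) (is_derive_rmul ds ds)) (is_derive_const z x).
  by congr is_derive; rewrite /Wo'; apply/rowP => i; rewrite !mxE; field.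
have cWo' x : continuous_at x Wo' := is_derive_continuous (is_derive_line h^-1 (h^-1 * (h - a)) z x).
have Wea : Wo a = W a by rewrite Wa /Wo addrC subrK; congr (_ *: _); field.
have W'ea : Wo' a = W' a.
  by rewrite W'a /Wo' -mulrDr addrC subrK mulVf// scale1r.
have ah : a - h <= a by rewrite gerBl ltW.
have gr (f1 f2 : R -> V) x : f1 a = f2 a -> a <= x -> glue_at a f1 f2 x = f2 x.
  by move=> fb; rewrite /glue_at le_eqVlt => /predU1P[<-|bx]; [rewrite lexx|rewrite leNgt bx].
have gl (f1 f2 : R -> V) x : x <= a -> glue_at a f1 f2 x = f1 x by rewrite /glue_at => ->.
exists h; split=> //; split; first exact: le_trans hh2 h2r.
exists (glue_at a Wo W), (glue_at a Wo' W'); split.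
- by move=> x; apply: is_derive_glue.
- by move=> x; apply: continuous_glue.
- have z0 : a - h + (h - a) = 0 by rewrite addrA subrK subrr.
  by rewrite !gl// /Wo /Wo' -mulrDr z0 !mulr0 scale0r.
- by rewrite !gr.
exists (Num.min e1 e2); first by rewrite lt_min e10.
move=> e S e0; rewrite le_min => /andP[ee1 ee2] dS.
have dS1 x : a <= x <= 0 -> is_derive x 1 S (enorm (rotv m m' x + e *: W' x)).
  move=> /andP[x1 x2]; rewrite -(gr Wo' W' x W'ea x1) -hT ?x1//; apply: dS.
  by rewrite x2 (le_trans ah x1).
have dS2 x : a - h <= x <= a -> is_derive x 1 S (enorm (tau x + e *: Wo' x)).
  by move=> /andP[x1 x2]; rewrite -(gl Wo' W' x x2); apply: dS; rewrite x1 (le_trans x2 aa).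
have [l1 len1] := he1 e S e0 ee1 dS1; have [l2 len2] := he2 e S e0 ee2 dS2.
split; last first.
  have f1 : e * (h * enorm z) < e * c by rewrite ltr_pM2l.
  by clear -len1 len2 f1; lra.
have {}l1 x y : a <= x -> x <= y -> y <= 0 ->
    enorm (dir (tau y + e *: W' y) - dir (tau x + e *: W' x)) <= S y - S x.
  move=> ax xy y0; rewrite !hT; [exact: l1| |].
    by rewrite ax (le_trans xy y0).
  by rewrite y0 (le_trans ax xy).
move=> x1 x2 ax xx x0.
case: (leP x2 a) => [x2b|/ltW bx2].
  by rewrite (gl _ _ x2 x2b) (gl _ _ x1 (le_trans xx x2b)); exact: l2.
case: (leP a x1) => [bx1|/ltW x1b].
  by rewrite (gr _ _ x2 W'ea (le_trans bx1 xx)) (gr _ _ x1 W'ea bx1); exact: l1.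
rewrite (gl _ _ x1 x1b) (gr _ _ x2 W'ea bx2).
apply: le_trans (enorm_dist _ (dir (tau a + e *: W' a)) _) _.
rewrite (_ : S x2 - S x1 = (S x2 - S a) + (S a - S x1)); last by rewrite addrA subrK.
by apply: lerD; [exact: l1|rewrite -W'ea; exact: l2].
Qed.

End FullVariation.

(** * Joining the two halves of the variation *)

Section Combine.
Variables (R : realType) (n : nat).
Notation V := 'rV[R]_n.

Lemma dirN (u : V) : dir (- u) = - dir u.
Proof. by rewrite /dir enormN scalerN. Qed.

Lemma is_derive_reflect (f f' : R -> V) (c x : R) : is_derive (c - x) 1 f (f' (c - x)) ->
  is_derive x 1 (fun x => f (c - x)) (- f' (c - x)).
Proof.
move=> h; have := is_derive_comp (is_derive_rsub (is_derive_rconst c x) (is_derive_rid x)) h.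
by rewrite sub0r scaleN1r.
Qed.

(** The second half is [half_variation] for the reversed curve, with [- m] for [m]. At the midpoint
    the two values are the same multiple of [m'], and the velocities, multiples of [m] and [- m],
    agree once the reversal is undone. *)
Lemma arc_not_critical (T : R -> V) (l mid al r : R) (m m' : V) :
  0 < l -> (forall t, T (t + l) = T t) -> (forall t, enorm (T t) = 1) ->
  (forall s t, enorm (T s - T t) <= `|s - t|) -> orthopair m m' ->
  0 < al -> al < pi / 2 -> 0 < r -> 2 * al + 2 * r < l ->
  (forall x, - al <= x <= al -> T (mid + x) = rotv m m' x) ->
  junction (fun x => T (mid + x)) (- al) r (rotv m' (- m) (- al)) ->
  junction (fun x => - T (mid - x)) (- al) r (rotv m' m (- al)) ->
  ~ length_critical T l.
Proof.
move=> l0 Tp T1 Tl o a0 a1 r0 lr hT jL jR crit.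
have cT : continuous T by apply: (@unit_lipschitz_continuous _ _ _ 1) => // s t; rewrite mul1r.
have [d d0 var] := local_variation l0 Tp T1 Tl crit.
have oR : orthopair (- m) m' by case: o => m1 m'1 mm; split=> //; rewrite ?enormN// dotvNl mm oppr0.
have hTL x : - al <= x <= 0 -> T (mid + x) = rotv m m' x.
  by move=> /andP[x1 x2]; apply: hT; rewrite x1 (le_trans x2)// ltW.
have hTR x : - al <= x <= 0 -> - T (mid - x) = rotv (- m) m' x.
  move=> /andP[x1 x2]; rewrite hT; last by apply/andP; split; clear -x1 x2 a0; lra.
  by rewrite /rotv cosN sinN scalerN scaleNr opprD opprK.
have [hL [hL0 [hLr [WL [WL' [dWL cWL' [WLa WL'a] [WL0 WL'0] [eL eL0 heL]]]]]]] := half_variation o a0 a1 r0 hTL jL.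
have jR' : junction (fun x => - T (mid - x)) (- al) r (rotv m' (- - m) (- al)) by rewrite opprK.
have [hR [hR0 [hRr [WR [WR' [dWR cWR' [WRa WR'a] [WR0 WR'0] [eR eR0 heR]]]]]]] := half_variation oR a0 a1 r0 hTR jR'.
set t := sin al / _ in WL'0 WR'0.
pose c := al + hL; pose len := c + (al + hR); pose s0 := mid - c.
have c0 : 0 < c by rewrite addr_gt0.
have clen : c < len by rewrite ltrDl addr_gt0.
have len0 : 0 < len by exact: lt_trans clen.
have lenl : len < l by rewrite /len /c; clear -lr hLr hRr; lra.
pose F x := glue_at c (fun x => WL (x - c)) (fun x => WR (c - x)) x.
pose F' x := glue_at c (fun x => WL' (x - c)) (fun x => - WR' (c - x)) x.
have Fc : WL (c - c) = WR (c - c) by rewrite subrr WL0 WR0.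
have F'c : WL' (c - c) = - WR' (c - c) by rewrite subrr WL'0 WR'0 scalerN opprK.
have dF (x : R) : is_derive x 1 F (F' x).
  apply: (@is_derive_glue _ _ c (fun x => WL (x - c)) (fun x => WR (c - x)) (fun x => WL' (x - c)) (fun x => - WR' (c - x))) => // _.
    have := is_derive_comp (is_derive_rsub (is_derive_rid x) (is_derive_rconst c x)) (dWL (x - c)).
    by rewrite subr0 scale1r.
  exact: is_derive_reflect.
have cF' : continuous F'.
  move=> x; apply: (@continuous_glue _ _ c (fun x => WL' (x - c)) (fun x => - WR' (c - x))) => // _.
    apply: (@continuous_comp _ _ _ (fun x => x - c) WL'); last exact: cWL'.
    by apply: cvgB; [exact: cvg_id|exact: cvg_cst].
  apply: cvgN; apply: (@continuous_comp _ _ _ (fun x => c - x) WR'); last exact: cWR'.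
  by apply: cvgB; [exact: cvg_cst|exact: cvg_id].
have FL x : x <= c -> F' x = WL' (x - c) by rewrite /F' /glue_at => ->.
have FR x : c <= x -> F' x = - WR' (c - x).
  by rewrite le_eqVlt => /predU1P[<-|cx]; rewrite /F' /glue_at ?lexx// leNgt cx.
have [xa _ ha] := segment_max (ltW len0) (fun x => continuous_enorm (is_derive_continuous (dF x))).
have [xb _ hb] := segment_max (ltW len0) (fun x => continuous_enorm (@cF' x)).
set A := enorm (F xa) in ha; set B := enorm (F' xb) in hb.
have A0 : 0 <= A := enorm_ge0 _. have B0 : 0 <= B := enorm_ge0 _.
have [e1 e10 he1] := small_choice (addr_ge0 A0 B0) d0.
pose e := Num.min e1 (Num.min eL eR).
have e0 : 0 < e by rewrite !lt_min e10 eL0.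
have : e <= e by []; rewrite {2}/e !le_min => /and3P[ee1 eeL eeR].
have small x : 0 <= x -> x <= A + B -> e * x <= d.
  move=> x0 xAB; apply: le_trans (ltW (he1 _ xAB)); by rewrite ler_wpM2r.
have cY : continuous (fun x => enorm (T (s0 + x) + e *: F' x)).
  move=> x; apply: continuous_enorm; apply: continuous_vadd.
    apply: (@continuous_comp _ _ _ (fun x => s0 + x) T); last exact: cT.
    by apply: cvgD; [exact: cvg_cst|exact: cvg_id].
  by apply: continuous_scale; [exact: cvg_cst|exact: cF'].
have [S _ dS] := antiderivative cY.
(* One arclength [S], expressed in the parameters of the two halves; the reversal of the second
   changes the sign. *)
pose SL x := S (x + c); pose SR x := - S (c - x).
have s0c x : s0 + (x + c) = mid + x by rewrite /s0; ring.
have s0c' x : s0 + (c - x) = mid - x by rewrite /s0; ring.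
have dSL x : - al - hL <= x <= 0 -> is_derive x 1 SL (enorm (T (mid + x) + e *: WL' x)).
  move=> /andP[_ x2].
  have := is_derive_rcomp (is_derive_radd (is_derive_rid x) (is_derive_rconst c x)) (dS (x + c)).
  by rewrite addr0 mulr1 s0c FL ?addrK// gerDr.
have dSR x : - al - hR <= x <= 0 -> is_derive x 1 SR (enorm (- T (mid - x) + e *: WR' x)).
  move=> /andP[_ x2]; have := dS (c - x).
  have cc : c - (c - x) = x by rewrite opprB addrC subrK.
  rewrite s0c' FR ?lerDl ?oppr_ge0// cc => h.
  have := is_derive_ropp (is_derive_rcomp (is_derive_rsub (is_derive_rconst c x) (is_derive_rid x)) h).
  by rewrite sub0r mulrN1 opprK -enormN opprD scalerN opprK.
have [lL lenL] := heL e SL e0 eeL dSL; have [lR lenR] := heR e SR e0 eeR dSR.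
have tot : S len - S 0 < len.
  move: lenL lenR; rewrite /SL /SR add0r subr0.
  have -> : - al - hL + c = 0 by rewrite /c; ring.
  have -> : c - (- al - hR) = len by rewrite /len; ring.
  move=> h1 h2; apply: (@lt_le_trans _ _ ((al + hL) + (al + hR))); last by [].
  by move: (S len) (S c) h1 h2 => u v; clear; lra.
suff : len <= S len - S 0 by rewrite leNgt tot.
have Lip x y : 0 <= x -> x <= y -> y <= len ->
    enorm (dir (T (s0 + y) + e *: F' y) - dir (T (s0 + x) + e *: F' x)) <= S y - S x.
  have lL' x' y' : 0 <= x' -> x' <= y' -> y' <= c ->
      enorm (dir (T (s0 + y') + e *: F' y') - dir (T (s0 + x') + e *: F' x')) <= S y' - S x'.
    move=> x0 xy yc; rewrite (FL _ yc) (FL _ (le_trans xy yc)).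
    have := lL (x' - c) (y' - c); rewrite /SL !subrK.
    rewrite -!s0c !subrK; apply; rewrite ?lerD2r ?subr_le0//.
    by rewrite /c; clear -x0; lra.
  have lR' x' y' : c <= x' -> x' <= y' -> y' <= len ->
      enorm (dir (T (s0 + y') + e *: F' y') - dir (T (s0 + x') + e *: F' x')) <= S y' - S x'.
    move=> cx xy yl; rewrite (FR _ cx) (FR _ (le_trans cx xy)).
    have cc z : c - (c - z) = z by rewrite opprB addrC subrK.
    have := lR (c - y') (c - x'); rewrite /SR -!s0c' !cc.
    have dd z : dir (T (s0 + z) + e *: - WR' (c - z)) = - dir (- T (s0 + z) + e *: WR' (c - z)).
      by rewrite -dirN opprD opprK scalerN.
    rewrite !dd opprK [- dir _ + _]addrC opprK [- S x' + _]addrC; apply.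
    - by move: yl; rewrite /len; clear; lra.
    - by rewrite lerD2l lerN2.
    - by rewrite subr_le0.
  move=> x0 xy yl.
  case: (leP y c) => [yc|/ltW cy]; first exact: lL'.
  case: (leP c x) => [cx|/ltW xc]; first exact: lR'.
  apply: le_trans (enorm_dist _ (dir (T (s0 + c) + e *: F' c)) _) _.
  rewrite (_ : S y - S x = (S y - S c) + (S c - S x)); last by rewrite addrA subrK.
  by apply: lerD; [exact: lR'|exact: lL'].
apply: (var s0 len (fun x => e *: F x) (fun x => e *: F' x) S len0 lenl) => //.
- by move=> x; apply: continuous_scale; [exact: cvg_cst|exact: cF'].
- rewrite /F /glue_at ltW// sub0r (_ : - c = - al - hL) ?WLa ?scaler0//; by rewrite /c; ring.
- by rewrite FL ?ltW// sub0r (_ : - c = - al - hL) ?WL'a ?scaler0//; rewrite /c; ring.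
- rewrite /F /glue_at leNgt clen /= (_ : c - len = - al - hR) ?WRa ?scaler0//; by rewrite /len; ring.
- by rewrite FR ?ltW// (_ : c - len = - al - hR) ?WR'a ?oppr0 ?scaler0//; rewrite /len; ring.
- move=> x hx; rewrite enormZ gtr0_norm//; apply: small; first exact: enorm_ge0.
  by apply: le_trans (ha x hx) _; rewrite lerDl.
- move=> x hx; rewrite enormZ gtr0_norm//; apply: small; first exact: enorm_ge0.
  by apply: le_trans (hb x hx) _; rewrite lerDr.
Qed.

End Combine.

(** * Structure of critical curves *)

Section Structure.
Variables (R : realType) (n : nat).
Notation V := 'rV[R]_n.

Lemma eq_on_segment (f h : R -> V) (a b : R) : a < b -> continuous f -> continuous h ->
  (forall x, a < x < b -> f x = h x) -> forall x, a <= x <= b -> f x = h x.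
Proof.
move=> ab cf ch fh x /andP[ax xb]; apply/eqP; rewrite -subr_eq0; apply/negPn/negP => ne.
have cd : continuous_at x (fun y => f y - h y) by apply: continuous_vsub; [exact: cf|exact: ch].
have e0 : 0 < enorm (f x - h x) / 2 by rewrite divr_gt0// enorm_gt0.
have [r r0 hr] := continuous_enorm_eps cd e0.
have [y yab yx] : exists2 y, a < y < b & `|y - x| < r.
  pose d := Num.min (r / 2) ((b - a) / 4).
  have d0 : 0 < d by rewrite lt_min !divr_gt0// subr_gt0.
  have : d <= d by []; rewrite {2}/d le_min => /andP[d1 d2].
  case: (leP x ((a + b) / 2)) => hx.
    exists (x + d); first by apply/andP; split; lra.
    by rewrite addrC addrA addNr add0r gtr0_norm//; lra.
  exists (x - d); first by apply/andP; split; lra.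
  by rewrite addrAC subrr add0r normrN gtr0_norm//; lra.
have := hr y yx; rewrite fh// subrr sub0r enormN; lra.
Qed.

Lemma rotv_shift (u v : V) (c x : R) :
  rotv u v (x - c) = rotv (rotv u v (- c)) (rotv v (- u) (- c)) x.
Proof.
rewrite /rotv cosB sinB cosN sinN; apply/rowP => i; rewrite !mxE; ring.
Qed.

Lemma rotv_reflect (u v : V) (c x : R) :
  - rotv u v (c - x) = rotv (- rotv u v c) (rotv v (- u) c) x.
Proof.
rewrite /rotv cosB sinB; apply/rowP => i; rewrite !mxE; ring.
Qed.

Lemma orthopair_rotv (u v : V) (c : R) : orthopair u v -> orthopair (rotv u v c) (rotv v (- u) c).
Proof.
by move=> o; split; [exact: rotv_unit|apply: rotv_unit; exact: orthopair_turn|exact: rotv_dotv].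
Qed.

Lemma rotv_determined (u v u' v' : V) (b : R) : rotv u v b = rotv u' v' b ->
  rotv v (- u) b = rotv v' (- u') b -> forall x, rotv u v x = rotv u' v' x.
Proof.
have key (w z : V) x : rotv w z x = cos (x - b) *: rotv w z b + sin (x - b) *: rotv z (- w) b.
  rewrite -{1}[x](subrK b); move: (x - b) => y; rewrite /rotv cosD sinD; apply/rowP => i; rewrite !mxE; ring.
by move=> e1 e2 x; rewrite key e1 e2 -key.
Qed.

Definition simple_piece (T : R -> V) (a b : R) : Prop :=
  (forall x, a <= x <= b -> T x = T a) \/
  exists u v : V, orthopair u v /\ forall x, a <= x <= b -> T x = rotv u v x.

Lemma simple_piece_sub (T : R -> V) (a b a' b' : R) : a <= a' -> a' <= b' -> b' <= b ->
  simple_piece T a b -> simple_piece T a' b'.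
Proof.
move=> aa ab bb; have sub x : a' <= x <= b' -> a <= x <= b.
  by move=> /andP[x1 x2]; rewrite (le_trans aa x1) (le_trans x2 bb).
case=> [h | [u [v [uv h]]]].
  by left => x hx; rewrite h ?sub// [RHS]h// sub// lexx.
by right; exists u, v; split=> // x /sub /h.
Qed.

(** The derivatives agree inside the interval and, by continuity, also at its ends, beyond which [g]
    and [F] may differ. *)
Lemma curve_simple_piece (g T : R -> V) (s0 a b : R) (F F' : R -> V) : a < b ->
  (forall t : R, is_derive t 1 g (T t)) -> continuous T -> continuous F' ->
  (forall t : R, is_derive t 1 F (F' t)) ->
  (forall x, a <= x <= b -> g (s0 + x) = F x) ->
  forall x, s0 + a <= x <= s0 + b -> T x = F' (x - s0).
Proof.
move=> ab dg cT cF' dF gF; apply: eq_on_segment => //; first by rewrite ltrD2l.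
  move=> x; apply: (@continuous_comp _ _ _ (fun x => x - s0) F'); last exact: cF'.
  by apply: cvgB; [exact: cvg_id|exact: cvg_cst].
move=> x /andP[x1 x2].
have d1 : is_derive x 1 (fun x => F (x - s0)) (F' (x - s0)).
  have := is_derive_comp (is_derive_rsub (is_derive_rid x) (is_derive_rconst s0 x)) (dF (x - s0)).
  by rewrite subr0 scale1r.
apply: is_derive_unique (dg x) _.
apply: (is_derive_local (r := Num.min (x - (s0 + a)) (s0 + b - x))) d1.
  by rewrite lt_min !subr_gt0 x1.
move=> y; rewrite lt_min !ltr_distl => /andP[/andP[y1 _] /andP[_ y2]].
rewrite -gF; first by rewrite addrC subrK.
by apply/andP; split; lra.
Qed.

Lemma arcs_simple_pieces (g T : R -> V) (s0 L x0 : R) :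
  (forall t : R, is_derive t 1 g (T t)) -> continuous T ->
  arcs_and_segment (fun x => g (s0 + x)) L -> 0 < x0 -> x0 < L ->
  exists2 r : R, 0 < r & simple_piece T (s0 + x0) (s0 + x0 + r) /\ simple_piece T (s0 + x0 - r) (s0 + x0).
Proof.
move=> dg cT [k [s [isseg [s_0 [s_k [smono [hp _]]]]]]] x00 x0L.
have piece j : (j < k)%N -> simple_piece T (s0 + s j) (s0 + s j.+1).
  move=> jk; have := hp j jk; case: (isseg j) => [[x [u [u1 hs]]]|[c [e1 [e2 [e11 [e22 [e12 hs]]]]]]].
    left; have key : forall x, s0 + s j <= x <= s0 + s j.+1 -> T x = u.
      apply: (@curve_simple_piece g T s0 _ _ (fun t => x + t *: u) (fun=> u) (smono j jk) dg cT) => //.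
      - by move=> t; exact: cvg_cst.
      - move=> t; have := is_derive_add (is_derive_const x t) (is_derive_scale (is_derive_rid t) (is_derive_const u t)).
        by rewrite scale1r scaler0 addr0 add0r.
    by move=> y hy; rewrite !key// lexx/= lerD2l ltW// smono.
  have o : orthopair e1 e2.
    have un (w : V) : dotv w w = 1 -> enorm w = 1 by move=> w1; rewrite /enorm w1 sqrtr1.
    by split=> //; exact: un.
  right; exists (rotv e2 (- e1) (- s0)), (rotv (- e1) (- e2) (- s0)); split.
    by apply: orthopair_rotv; exact: orthopair_turn.
  move=> y hy; rewrite -rotv_shift.
  apply: (@curve_simple_piece g T s0 _ _ (fun t => c + rotv e1 e2 t) (rotv e2 (- e1)) (smono j jk) dg cT) hy.
  - by move=> t; exact: is_derive_continuous (rotv_derive _ _ t).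
  - move=> t; have := is_derive_add (is_derive_const c t) (rotv_derive e1 e2 t).
    by rewrite add0r.
  - by move=> x hx; rewrite hs// addrA.
(* The strict search finds the piece to the right of [x0], the weak one the piece to its left; they
   differ when [x0] is a breakpoint. *)
have ex1 : exists i, x0 < s i by exists k; rewrite s_k.
have ex2 : exists i, x0 <= s i by exists k; rewrite s_k ltW.
have [i hi mi] := ex_minnP ex1; have [i' hi' mi'] := ex_minnP ex2.
have ik : (i <= k)%N by apply: mi; rewrite s_k.
have ik' : (i' <= k)%N by apply: mi'; rewrite s_k ltW.
case: i hi mi ik => [|i] hi mi ik; first by move: hi; rewrite s_0 ltNge ltW.
case: i' hi' mi' ik' => [|i'] hi' mi' ik'; first by move: hi'; rewrite s_0 leNgt x00.
have si : s i <= x0 by rewrite leNgt; apply/negP => /mi; rewrite ltnn.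
have si' : s i' < x0 by rewrite ltNge; apply/negP => /mi'; rewrite ltnn.
exists (Num.min (s i.+1 - x0) (x0 - s i')); first by rewrite lt_min !subr_gt0 hi.
set r := Num.min _ _.
have r0 : 0 <= r by rewrite le_min !subr_ge0 ltW//= ltW.
have : r <= r by []; rewrite {2}/r le_min => /andP[r1 r2].
split; apply: simple_piece_sub.
4: exact: (piece i).
7: exact: (piece i').
all: lra.
Qed.

Lemma curv1_smooth_at (g T : R -> V) (s0 L x0 : R) :
  (forall t : R, is_derive t 1 g (T t)) -> continuous T ->
  smooth_curv1_pos_torsion (fun x => g (s0 + x)) L -> 0 < x0 -> x0 < L -> smooth_at T (s0 + x0).
Proof.
move=> dg cT [f [sm [fg hf]]] x00 x0L.
have d k (t : R) : is_derive t 1 (derive1n k f) (derive1n k.+1 f t).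
  by rewrite derive1nS derive1E; apply: derivableP; exact: sm.
have c k : continuous (derive1n k f) by move=> t; exact: is_derive_continuous (d k t).
have c0 t : curv f t = enorm (derive1n 2 f t) by rewrite /curv !derive1nS derive1n0.
have TF x : s0 <= x <= s0 + L -> T x = derive1n 1 f (x - s0).
  move=> hx; apply: (@curve_simple_piece g T s0 0 L f (derive1n 1 f)) => //.
  - exact: lt_trans x0L.
  - exact: (d 0).
  - by move=> y hy; rewrite fg.
  - by rewrite addr0.
exists (fun x => derive1n 2 f (x - s0)), (fun x => derive1n 3 f (x - s0)), (fun x => derive1n 4 f (x - s0)).
exists (Num.min x0 (L - x0)); split; first by rewrite lt_min x00 subr_gt0.
move=> x; rewrite lt_min !ltr_distl => /andP[/andP[y1 y2] /andP[y3 y4]].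
have xL : 0 < x - s0 < L by apply/andP; split; lra.
have xL' : 0 <= x - s0 <= L by case/andP: xL => /ltW -> /ltW ->.
have ds k : is_derive x 1 (fun x => derive1n k f (x - s0)) (derive1n k.+1 f (x - s0)).
  have := is_derive_comp (is_derive_rsub (is_derive_rid x) (is_derive_rconst s0 x)) (d k (x - s0)).
  by rewrite subr0 scale1r.
have [k1 t0] := hf (x - s0) xL'.
have nbh y : `|y - x| < Num.min (x - s0) (L - (x - s0)) -> 0 <= y - s0 <= L.
  by rewrite lt_min !ltr_distl => /andP[/andP[z1 z2] /andP[z3 z4]]; apply/andP; split; lra.
have r0 : 0 < Num.min (x - s0) (L - (x - s0)) by rewrite lt_min; case/andP: xL => -> ?; rewrite subr_gt0.
split.
- apply: (is_derive_local r0) (ds 1) => y /nbh /andP[z1 z2].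
  by rewrite TF//; apply/andP; split; lra.
- exact: ds.
- exact: ds.
- apply: (@continuous_comp _ _ _ (fun x => x - s0) (derive1n 4 f)); last exact: c.
  by apply: cvgB; [exact: cvg_id|exact: cvg_cst].
split; first by rewrite -c0.
move: t0; rewrite /torsion k1 scale1r enorm_gt0.
(* Curvature [1] on a neighbourhood makes [normalv f] equal to the second derivative there, so that
   it can be differentiated. *)
have -> : derive1 (normalv f) (x - s0) = derive1n 3 f (x - s0).
  apply: derive1_val; apply: (is_derive_local (r := Num.min (x - s0) (L - (x - s0)))) (d 2 (x - s0)) => //.
  move=> y hy; rewrite /normalv.
  have [|-> _] := hf y; last by rewrite invr1 scale1r !derive1nS derive1n0.
  have := nbh (y + s0); rewrite addrK; apply.
  by rewrite (_ : y + s0 - x = y - (x - s0))//; ring.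
by rewrite TF; [rewrite derive1n1|apply/andP; split; lra].
Qed.

End Structure.

(** * Maximal arcs, their ends, and the contradiction *)

Section Extremal.
Variables (R : realType) (n : nat).
Notation V := 'rV[R]_n.

Lemma maximal_agreement (T h : R -> V) (a b0 M : R) : continuous T -> continuous h -> a < b0 ->
  (forall y, a <= y <= b0 -> T y = h y) ->
  (forall x, (forall y, a <= y <= x -> T y = h y) -> x <= M) ->
  exists b : R, [/\ b0 <= b, forall y, a <= y <= b -> T y = h y &
    forall x, (forall y, a <= y <= x -> T y = h y) -> x <= b].
Proof.
move=> cT ch ab0 h0 hM.
pose A := [set x : R | forall y, a <= y <= x -> T y = h y].
have Ab0 : A b0 by exact: h0.
have supA : has_sup A by split; [exists b0|exists M => x; exact: hM].
have ubA x : A x -> x <= sup A by move=> Ax; apply: sup_upper_bound.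
exists (sup A); split; [exact: ubA| |exact: ubA].
apply: (@eq_on_segment _ _ T h a (sup A)) => //; first exact: lt_le_trans ab0 (ubA _ Ab0).
move=> x /andP[ax xs].
have [y Ay xy] := @sup_adherent _ A (sup A - x) ltac:(by rewrite subr_gt0) supA.
by apply: Ay; rewrite ltW//=; move: xy; lra.
Qed.

(** A smooth point can end neither a segment, where [h1] vanishes, nor a unit arc, where
    [h2 = - T]. *)
Lemma smooth_at_left (T h h1 h2 : R -> V) (a s : R) : smooth_at T s -> a < s ->
  (forall t : R, is_derive t 1 h (h1 t)) -> (forall t : R, is_derive t 1 h1 (h2 t)) ->
  (forall y, a <= y <= s -> T y = h y) ->
  exists x, [/\ a <= x <= s, enorm (h1 x) = 1 & h2 x + T x != 0].
Proof.
move=> [N [N1 [N2 [r [r0 hr]]]]] as_ dh dh1 Th.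
pose d := Num.min r (s - a) / 4.
have m0 : 0 < Num.min r (s - a) by rewrite lt_min r0 subr_gt0.
have d0 : 0 < d by rewrite divr_gt0.
have [d1 d2] : 4 * d <= r /\ 4 * d <= s - a.
  by rewrite /d mulrC divfK//; split; rewrite ge_min lexx ?orbT.
have near x y : `|x - (s - 2 * d)| < d -> `|y - x| < d -> a <= y <= s /\ `|y - s| < r.
  by rewrite !ltr_norml => /andP[? ?] /andP[? ?]; split; apply/andP; split; lra.
have dd (x : R) : `|x - x| < d by rewrite subrr normr0.
have NE x : `|x - (s - 2 * d)| < d -> N x = h1 x.
  move=> hx; have [_ xs] := near x x hx (dd x); have [dT _ _ _ _] := hr x xs.
  apply: is_derive_unique dT _; apply: (is_derive_local d0) (dh x) => y hy.
  by rewrite Th//; case: (near x y hx hy).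
have x0 := dd (s - 2 * d); have [ax xr] := near _ _ x0 x0.
have [dT dN _ _ [N1u nz]] := hr _ xr.
exists (s - 2 * d); split=> //; first by rewrite -NE.
suff -> : h2 (s - 2 * d) = N1 (s - 2 * d) by [].
apply: is_derive_unique (dh1 _) _; apply: (is_derive_local d0) dN => y hy.
by rewrite NE.
Qed.

Definition piecewise_smooth (T : R -> V) : Prop := forall s, smooth_at T s \/
  exists2 r : R, 0 < r & simple_piece T s (s + r) /\ simple_piece T (s - r) s.

Definition right_junction (T : R -> V) (b r : R) (N : V) : Prop :=
  (forall x, b <= x <= b + r -> T x = T b) \/
  exists u v : V, [/\ orthopair u v, forall x, b <= x <= b + r -> T x = rotv u v x &
    rotv v (- u) b != N].

Lemma rotv_derive2 (u v : V) (x : R) : is_derive x 1 (rotv v (- u)) (- rotv u v x).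
Proof. by have := rotv_derive v (- u) x; rewrite rotv_turn2. Qed.

Lemma agree_concat (T h : R -> V) (a b c : R) : (forall y, a <= y <= b -> T y = h y) ->
  (forall y, b <= y <= c -> T y = h y) -> forall y, a <= y <= c -> T y = h y.
Proof.
move=> h1 h2 y /andP[ay yc]; case: (leP y b) => [yb|/ltW by_]; first by apply: h1; rewrite ay.
by apply: h2; rewrite by_.
Qed.

(** Extend the arc as far as possible. Its end is not a smooth point, so a simple piece follows; a
    circle with the same tangent and normal there would continue the arc. *)
Lemma arc_right_end (T : R -> V) (a b0 M : R) (u v : V) : continuous T -> piecewise_smooth T ->
  orthopair u v -> a < b0 -> (forall y, a <= y <= b0 -> T y = rotv u v y) ->
  (forall x, (forall y, a <= y <= x -> T y = rotv u v y) -> x <= M) ->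
  exists b : R, [/\ b0 <= b, forall y, a <= y <= b -> T y = rotv u v y &
    exists2 r : R, 0 < r & right_junction T b r (rotv v (- u) b)].
Proof.
move=> cT pw o ab h0 hM.
have cr : continuous (rotv u v) by move=> t; exact: is_derive_continuous (rotv_derive u v t).
have [b [bb hb bmax]] := maximal_agreement cT cr ab h0 hM.
have ab' : a < b by exact: lt_le_trans bb.
have Tb : T b = rotv u v b by apply: hb; rewrite lexx ltW.
exists b; split=> //; case: (pw b) => [sm | [r r0 [pr _]]].
  have [x [hx _]] := smooth_at_left sm ab' (rotv_derive u v) (rotv_derive2 u v) hb.
  by rewrite (hb x hx) addNr eqxx.
exists r => //; case: pr => [c | [u' [v' [uv' hr]]]]; first by left.
have o' := uv'; right; exists u', v'; split=> //; apply/negP => /eqP e.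
have Tb' : rotv u' v' b = rotv u v b by rewrite -Tb hr// lexx lerDl ltW.
have key := rotv_determined Tb' e.
have hr' y : b <= y <= b + r -> T y = rotv u v y by move=> /hr ->.
have := bmax _ (agree_concat hb hr'); by rewrite gerDl leNgt r0.
Qed.

(** Reversing a curve changes the sign of the tangent but keeps the curvature vector, hence the same
    [N] on both sides. *)
Lemma right_junction_reflect (tau : R -> V) (c al r : R) (N : V) :
  right_junction tau (c + al) r N -> junction (fun x => - tau (c - x)) (- al) r N.
Proof.
have flip x : - al - r <= x <= - al -> c + al <= c - x <= c + al + r.
  by move=> /andP[? ?]; apply/andP; split; lra.
case=> [h | [u [v [uv h ne]]]].
  by left => x /flip /h ->; rewrite opprK.
right; exists (- rotv u v c), (rotv v (- u) c); split.
- by have [u1 v1 w] := orthopair_rotv c uv; split; rewrite ?enormN// dotvNl w oppr0.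
- by move=> x /flip /h ->; exact: rotv_reflect.
have := rotv_reflect (- v) u c (- al); rewrite opprK.
have e1 : - rotv (- v) u (c + al) = rotv v (- u) (c + al) by rewrite -rotv_turn2 opprK.
have e2 : - rotv (- v) u c = rotv v (- u) c by rewrite -rotv_turn2 opprK.
by rewrite e1 e2 !opprK => <-.
Qed.

Lemma junction_le (T : R -> V) (a r r' : R) (N : V) : r' <= r -> junction T a r N -> junction T a r' N.
Proof.
move=> rr; have sub x : a - r' <= x <= a -> a - r <= x <= a.
  by move=> /andP[h ->]; rewrite (le_trans _ h)// lerD2l lerN2.
case=> [h | [u [v [uv h ne]]]]; first by left => x /sub /h.
by right; exists u, v; split=> // x /sub /h.
Qed.

(** The tangent of the reversed curve [g (- x)]; it turns left ends into right ends. *)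
Definition reflect_tangent (T : R -> V) (x : R) : V := - T (- x).

Lemma reflect_derive (f f' : R -> V) (x : R) : is_derive (- x) 1 f (f' (- x)) ->
  is_derive x 1 (fun x => f (- x)) (- f' (- x)).
Proof.
by move=> h; have := is_derive_comp (is_derive_ropp (is_derive_rid x)) h; rewrite scaleN1r.
Qed.

Lemma reflect_piecewise (T : R -> V) : piecewise_smooth T -> piecewise_smooth (reflect_tangent T).
Proof.
have flip (a b x : R) : a <= x <= b -> - b <= - x <= - a by rewrite !lerN2 andbC.
have sp a b : simple_piece T (- b) (- a) -> simple_piece (reflect_tangent T) a b.
  case=> [h | [u [v [uv h]]]].
    left => x hx; have ab : a <= b by case/andP: hx => x1 x2; exact: le_trans x1 x2.
    by rewrite /reflect_tangent (h (- x) (flip _ _ _ hx)) (h (- a))// lexx lerN2 ab.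
  right; exists (- u), v; split; first by case: uv => u1 v1 w; split; rewrite ?enormN// dotvNl w oppr0.
  move=> x hx; rewrite /reflect_tangent h ?flip// /rotv cosN sinN scalerN scaleNr opprD opprK //.
move=> pw s; case: (pw (- s)) => [[N [N1 [N2 [r [r0 hr]]]]] | [r r0 [p1 p2]]]; last first.
  right; exists r => //; split; apply: sp; first by rewrite opprD.
  by rewrite opprB addrC.
left; exists (fun x => N (- x)), (fun x => - N1 (- x)), (fun x => N2 (- x)), r; split=> // x xs.
have xs' : `|- x - - s| < r by rewrite -opprD normrN.
have [d1 d2 d3 c [N_1 nz]] := hr (- x) xs'.
split.
- by have := is_derive_opp (reflect_derive d1); rewrite opprK.
- exact: reflect_derive.
- by have := is_derive_opp (reflect_derive d3); rewrite opprK.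
- by apply: (@continuous_comp _ _ _ (fun x => - x) N2) => //; apply: cvgN; exact: cvg_id.
by split=> //; rewrite /reflect_tangent -opprD oppr_eq0.
Qed.

Lemma arc_length_lt_pi (g T : R -> V) (a b : R) (u v : V) :
  (forall t : R, is_derive t 1 g (T t)) -> orthopair u v ->
  (forall y, a <= y <= b -> T y = rotv u v y) ->
  (forall s t, g s != g t -> dotv (g t - g s) (T s) = 0 -> dotv (g t - g s) (T t) = 0 ->
    2 < enorm (g s - g t)) -> b - a < pi.
Proof.
move=> dg o hT dc; rewrite ltNge; apply/negP => piba.
have pi0 := @pi_gt0 R.
have [oa ob oc] := orthopair_rotv a o.
have e : g (a + pi) - g a = 2 *: rotv v (- u) a.
  (* The centre of the circle, constant along the arc. *)
  pose d x := g x + rotv v (- u) x.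
  have dd x : a <= x <= b -> is_derive x 1 d 0.
    by move=> hx; have := is_derive_add (dg x) (rotv_derive2 u v x); rewrite hT// subrr.
  have dcst : d a = d (a + pi).
    apply/rowP => i.
    have di x : a <= x <= a + pi -> is_derive x 1 (fun x => d x 0 i) (0 : R).
      move=> /andP[x1 x2]; have /dd /is_derive_rowP /(_ i) : a <= x <= b by apply/andP; split; lra.
      by rewrite mxE.
    by apply: derivative0_const di; rewrite lerDl ltW.
  have rp : rotv v (- u) (a + pi) = - rotv v (- u) a.
    by rewrite /rotv cosDpi sinDpi !scaleNr opprD.
  move: dcst; rewrite /d rp => dcst.
  have -> : g (a + pi) = g a + rotv v (- u) a + rotv v (- u) a by rewrite dcst subrK.
  by apply/rowP => i; rewrite !mxE; ring.
have Ta : T a = rotv u v a by apply: hT; rewrite lexx; lra.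
have Tpi : T (a + pi) = - rotv u v a.
  rewrite hT; last by apply/andP; split; lra.
  by rewrite /rotv cosDpi sinDpi !scaleNr opprD.
have en : enorm (g (a + pi) - g a) = 2 by rewrite e enormZ ob mulr1 ger0_norm.
have ne : g a != g (a + pi) by rewrite eq_sym -subr_eq0 -enorm_eq0 en pnatr_eq0.
have d1 : dotv (g (a + pi) - g a) (T a) = 0 by rewrite e Ta dotvZl dotvC oc mulr0.
have d2 : dotv (g (a + pi) - g a) (T (a + pi)) = 0 by rewrite e Tpi dotvNr dotvZl dotvC oc mulr0 oppr0.
by have := dc _ _ ne d1 d2; rewrite enormBC en ltxx.
Qed.

(** To the right of a non-smooth point lies an arc or a segment. A maximal segment ends, and what
    follows it is neither smooth nor straight, so it is an arc. *)
Lemma arc_exists (g T : R -> V) (l : R) : 0 < l -> (forall t, g (t + l) = g t) ->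
  (forall t : R, is_derive t 1 g (T t)) -> (forall t, enorm (T t) = 1) -> continuous T ->
  piecewise_smooth T -> (forall s, smooth_at T s) \/
  exists (a b : R) (u v : V), [/\ a < b, orthopair u v & forall y, a <= y <= b -> T y = rotv u v y].
Proof.
move=> l0 gp dg T1 cT pw.
have [alls|] := pselect (forall s, smooth_at T s); first by left.
move=> /existsNP[s ns]; right; case: (pw s) => // -[r r0 [p _]].
have sr : s < s + r by rewrite ltrDl.
case: p => [hc | [u [v [uv h]]]]; last by exists s, (s + r), u, v.
have [||b [sb hb bmax]] := @maximal_agreement T (fun=> T s) s (s + r) (s + l) cT _ sr hc.
- by move=> t; exact: cvg_cst.
(* A segment of length at least [l] would contradict the periodicity of [g]. *)
- move=> x hx; rewrite leNgt; apply/negP => lx.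
  have dd t : s <= t <= s + l -> is_derive t 1 (fun t => g t - t *: T s) 0.
    move=> /andP[t1 t2]; have := is_derive_sub (dg t) (is_derive_scale (is_derive_rid t) (is_derive_const (T s) t)).
    by rewrite scale1r scaler0 addr0 hx ?subrr// t1 (le_trans t2)// ltW.
  have : g s - s *: T s = g (s + l) - (s + l) *: T s.
    apply/rowP => i; have di t : s <= t <= s + l -> is_derive t 1 (fun t => (g t - t *: T s) 0 i) (0 : R).
      by move=> /dd /is_derive_rowP /(_ i); rewrite mxE.
    by apply: derivative0_const di; rewrite lerDl ltW.
  rewrite gp => /addrI /oppr_inj /eqP; rewrite -subr_eq0 -scalerBl scaler_eq0 opprD addrA subrr add0r oppr_eq0.
  by rewrite gt_eqF//= -enorm_eq0 T1 oner_eq0.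
have sb' : s < b by exact: lt_le_trans sb.
case: (pw b) => [sm | [r' r'0 [p _]]].
  have [x [_]] := smooth_at_left sm sb' (is_derive_const (T s)) (is_derive_const 0) hb.
  by rewrite enorm0 => /eqP; rewrite eq_sym oner_eq0.
have br : b < b + r' by rewrite ltrDl.
case: p => [hc' | [u [v [uv h]]]]; last by exists b, (b + r'), u, v.
have Tb : T b = T s by apply: hb; rewrite lexx ltW.
have hc'' y : b <= y <= b + r' -> T y = T s by move=> /hc' ->.
by have := bmax _ (agree_concat (h := fun=> T s) hb hc''); rewrite gerDl leNgt r'0.
Qed.

(** Over a closed curve shorter than [pi] the advance along the initial tangent would be positive.
    With arcs shorter than [pi] this leaves room for the layers outside the arc. *)
Lemma closed_length_ge_pi (g T : R -> V) (l : R) : 0 < l -> (forall t, g (t + l) = g t) ->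
  (forall t : R, is_derive t 1 g (T t)) -> (forall t, enorm (T t) = 1) ->
  (forall s t, enorm (T s - T t) <= `|s - t|) -> pi <= l.
Proof.
move=> l0 gp dg T1 Tl; rewrite leNgt; apply/negP => lpi.
have Tl1 s t : enorm (T s - T t) <= 1 * `|s - t| by rewrite mul1r.
have := @chord_forward _ _ g T 1 0 l ltr01 dg T1 Tl1 (ltW l0); rewrite !mul1r divr1 gp subrr dotv0l.
by move=> /(_ (ltW lpi)); rewrite leNgt sin_gt0_pi// l0.
Qed.

Lemma thick_critical_absurd (g T : R -> V) (l : R) : 0 < l -> (forall t, g (t + l) = g t) ->
  (forall t : R, is_derive t 1 g (T t)) -> (forall t, enorm (T t) = 1) ->
  (forall s t, enorm (T s - T t) <= `|s - t|) ->
  (forall s t, g s != g t -> dotv (g t - g s) (T s) = 0 -> dotv (g t - g s) (T t) = 0 ->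
    2 < enorm (g s - g t)) ->
  (forall (p q v w : V) (L : R) (b : R -> V), dubins_minimizer p q v w L b ->
    smooth_curv1_pos_torsion b L \/ arcs_and_segment b L) ->
  ~ length_critical T l.
Proof.
move=> l0 gp dg T1 Tl dc hyp crit.
have cT : continuous T by apply: (@unit_lipschitz_continuous _ _ _ 1) => // s t; rewrite mul1r.
have Tp := periodic_derivative dg gp.
have [e e0 short] := critical_short_dubins l0 gp dg T1 Tl crit.
have pw : piecewise_smooth T.
  (* Centre a short minimizer at [s], so that [s] is interior to it. *)
  move=> s; have h0 : 0 < e / 2 by rewrite divr_gt0.
  have h1 : e / 2 < e by lra.
  have se : s - e / 2 + e / 2 = s by rewrite subrK.
  case: (hyp _ _ _ _ _ _ (short (s - e / 2))) => [sm|ar].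
    by left; rewrite -se; apply: (curv1_smooth_at dg cT sm).
  by right; have := arcs_simple_pieces dg cT ar h0 h1; rewrite se.
have [alls | [a0 [b0 [u [v [ab o hT]]]]]] := arc_exists l0 gp dg T1 cT pw.
  exact: (smooth_not_critical l0 gp dg T1 alls crit).
have bound x : (forall y, a0 <= y <= x -> T y = rotv u v y) -> x <= a0 + pi.
  by move=> hx; have := arc_length_lt_pi dg o hx dc; lra.
have [b [bb hb [rR rR0 jR]]] := arc_right_end cT pw o ab hT bound.
have a0b : a0 < b by exact: lt_le_trans bb.
pose T' := reflect_tangent T.
have cT' : continuous T'.
  move=> x; apply: cvgN; apply: (@continuous_comp _ _ _ (fun x => - x) T); last exact: cT.
  by apply: cvgN; exact: cvg_id.
have o' : orthopair (- u) v by case: o => u1 v1 uv; split; rewrite ?enormN// dotvNl uv oppr0.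
have rN x : rotv (- u) v x = - rotv u v (- x).
  by rewrite /rotv cosN sinN scalerN scaleNr opprD opprK.
have flip (p q x : R) : p <= x <= q -> - q <= - x <= - p by rewrite !lerN2 andbC.
have hT' y : - b <= y <= - a0 -> T' y = rotv (- u) v y.
  by move=> /flip; rewrite !opprK => hy; rewrite /T' /reflect_tangent rN hb.
have bound' x : (forall y, - b <= y <= x -> T' y = rotv (- u) v y) -> x <= - b + pi.
  move=> hx; suff : b - - x < pi by lra.
  apply: (arc_length_lt_pi dg o _ dc) => y /flip; rewrite opprK => /hx.
  by rewrite rN /T' /reflect_tangent opprK => /oppr_inj.
have nba : - b < - a0 by rewrite ltrN2.
have [a' [a0a' ha' [rL rL0 jL]]] := arc_right_end cT' (reflect_piecewise pw) o' nba hT' bound'.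
pose a := - a'; have aa0 : a <= a0 by rewrite /a lerNl.
have hab y : a <= y <= b -> T y = rotv u v y.
  move=> /flip; rewrite opprK => /ha'; by rewrite rN /T' /reflect_tangent opprK => /oppr_inj.
have abpi : b - a < pi := arc_length_lt_pi dg o hab dc.
have ab' : a < b by exact: le_lt_trans aa0 a0b.
have lpi := closed_length_ge_pi l0 gp dg T1 Tl.
pose al := (b - a) / 2; pose mid := (a + b) / 2.
have al0 : 0 < al by rewrite divr_gt0// subr_gt0.
have alpi : al < pi / 2 by rewrite /al; lra.
(* A quarter of the remaining length on each side keeps the arc and its layers within one period. *)
pose r := Num.min (Num.min rL rR) ((l - 2 * al) / 4).
have r0 : 0 < r by rewrite !lt_min rL0 rR0 divr_gt0//; lra.
have : r <= r by []; rewrite {2}/r !le_min => /andP[/andP[rrL rrR] rl].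
have bE : b = mid + al by rewrite /mid /al; lra.
have aE : a' = - mid + al by rewrite /mid /al /a; lra.
apply: (@arc_not_critical _ _ T l mid al r (rotv u v mid) (rotv v (- u) mid)) crit => //.
- exact: orthopair_rotv.
- by lra.
- move=> x /andP[x1 x2]; rewrite hab; last by rewrite /a bE aE; apply/andP; split; lra.
  have := rotv_shift u v (- mid) x; by rewrite !opprK addrC.
- rewrite bE in jR; rewrite aE in jL.
  have := junction_le rrL (right_junction_reflect jL).
  rewrite (_ : (fun x => _) = fun x => T (mid + x)); last first.
    by apply/funext => x; rewrite /T' /reflect_tangent !opprK opprB opprK addrC.
  congr junction.
  rewrite /rotv cosD sinD !cosN !sinN; apply/rowP => i; rewrite !mxE; ring.
- rewrite bE in jR; have := junction_le rrR (right_junction_reflect jR).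
  congr junction.
  rewrite /rotv cosD sinD !cosN !sinN; apply/rowP => i; rewrite !mxE; ring.
Qed.

End Extremal.

(** * From a relative minimum to a critical component *)

Section Reduction.
Variables (R : realType) (n : nat).
Notation V := 'rV[R]_n.

Lemma NIR_real m (g : 'I_m -> R -> V) : is_link g -> C11 g ->
  (NIR g < (2%:R)^-1%:E * DCSD g)%E -> exists (r : R) (i0 : 'I_m), 0 < r /\ NIR g = r%:E.
Proof.
move=> lg c11 lt; have := NIR_gt0 lg c11.
case E: (NIR g) => [r| |] // r0; last by move: lt; rewrite E ltNge leey.
case: (pickP (predT : pred 'I_m)) => [i0 _|i0].
  by exists r, i0; split=> //; rewrite -lte_fin.
(* Without components every radius is admissible, so [NIR] would exceed the real number [r]. *)
have ni : normal_inj g (r + 1) by move=> p v p' v' [i]; have := i0 i.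
have r0' : 0 < r by rewrite -lte_fin.
by have := NIR_ge (addr_gt0 r0' ltr01) ni; rewrite E lee_fin gerDl ler10.
Qed.

Lemma minimal_component m (g : 'I_m -> R -> V) : is_link g -> C11 g -> rel_min_ropelength g ->
  (NIR g < (2%:R)^-1%:E * DCSD g)%E ->
  exists (c T : R -> V) (l : R),
  [/\ 0 < l, forall t, c (t + l) = c t, forall t : R, is_derive t 1 c (T t),
      (forall t, enorm (T t) = 1) /\ (forall s t, enorm (T s - T t) <= `|s - t|) &
      (forall s t, c s != c t -> dotv (c t - c s) (T s) = 0 -> dotv (c t - c s) (T t) = 0 ->
        2 < enorm (c s - c t)) /\ length_critical T l].
Proof.
move=> lg c11 rm lt; have [r [i0 [r0 Er]]] := NIR_real lg c11 lt.
have [c [T [l [s [q uf]]]]] := link_unit_form lg r0.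
have sys := uf_sys uf; have [l0 per dc T1 _] := sys.
have ni : normal_inj c 1 := normal_inj_unit_form lg r0 uf (normal_inj_NIR Er).
have Tl := thick_lipschitz sys (uf_cont uf) ni.
have dcs i j x y : c i x != c j y -> dotv (c j y - c i x) (T i x) = 0 ->
    dotv (c j y - c i x) (T j y) = 0 -> 2 < enorm (c i x - c j y).
  move=> ne d1 d2.
  have ltr : (r%:E < (2%:R)^-1%:E * DCSD g)%E by rewrite -Er.
  have gE k z : g k (q k z) = r *: c k z by rewrite (uf_eq uf) (uf_qK uf).
  have dE k z : derive1 (g k) (q k z) = enorm (derive1 (g k) (q k z)) *: T k z.
    by rewrite {1}(uf_der uf) (uf_qK uf).
  have := lt_DCSD ltr (p := r *: c i x) (q := r *: c j y).
  rewrite -scalerBr enormZ gtr0_norm// mulrC ltr_pM2l//; apply; split.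
    by apply: contra ne => /eqP /(scalerI (lt0r_neq0 r0)) ->.
  split; [exists i, (q i x)|exists j, (q j y)]; rewrite gE dE -scalerBr dotvZl dotvZr.
    by rewrite d1 !mulr0.
  by rewrite d2 !mulr0.
have [e e0 far] := unit_system_far sys Tl dcs.
exists (c i0), (T i0), (l i0); split=> //.
split; first by move=> x y; exact: dcs.
exact: (core_variation lg r0 uf Tl e0 far rm Er).
Qed.

End Reduction.

Theorem theorem1 (R : realType) (n : nat) (hn : (2 <= n)%N)
  (hyp_i : forall (p q v w : 'rV[R]_n) (L : R) (g : R -> 'rV[R]_n),
      dubins_minimizer p q v w L g ->
      smooth_curv1_pos_torsion g L \/ arcs_and_segment g L)
  (hyp_ii : forall (L s1 s2 : R) (g : R -> 'rV[R]_n),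
      CCC g L s1 s2 -> s2 - s1 < pi ->
      ~ dubins_minimizer (g 0) (g L) (derive1 g 0) (derive1 g L) L g) :
  forall (m : nat) (g : 'I_m -> R -> 'rV[R]_n),
    is_link g -> C11 g -> rel_min_ropelength g ->
    NIR g = ((2%:R)^-1%:E * DCSD g)%E.
Proof.
move=> m g lg c11 rm; apply/eqP; rewrite eq_le NIR_le_DCSD /= leNgt; apply/negP => lt.
have [c [T [l [l0 per dc [T1 Tl] [dcs crit]]]]] := minimal_component lg c11 rm lt.
exact: (thick_critical_absurd l0 per dc T1 Tl dcs hyp_i crit).
Qed.
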